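(* Let $g\in L^\infty$ and let $k$ be a maximal vector for $\ker T_g$. Then for every nonconstant inner function $\psi$ and every $h_+\in\mathcal{G}H^\infty$, $h_-\in\mathcal{G}\overline{H^\infty}$, the function $h_+^{-1}(k\circ\psi)\psi$ is a maximal vector for $\ker T_{\overline{z}h_-(g\circ\psi)h_+}=h_+^{-1}\ker T_{\overline{z}(g\circ\psi)}$. That is, $$\mathrm{K}_{\min}\big(h_+^{-1}(k\circ\psi)\psi\big)=\ker T_{\overline{z}h_-(g\circ\psi)h_+}=h_+^{-1}\ker T_{\overline{z}(g\circ\psi)}.$$
   Context: $\mathbb{T}$ is the unit circle with normalized Lebesgue measure, $L^\infty=L^\infty(\mathbb{T})$, $H^2$ is the Hardy space of the unit disc $\mathbb{D}$, regarded as a closed subspace of $L^2(\mathbb{T})$ via boundary values, and $H^\infty$ is the algebra of bounded analytic functions on $\mathbb{D}$; $\overline{H^\infty}$ is the set of complex conjugates of (boundary functions of) elements of $H^\infty$. $\mathcal{G}H^\infty$ and $\mathcal{G}\overline{H^\infty}$ denote the sets of invertible elements of these algebras. For $g\in L^\infty$, $T_g:H^2\to H^2$, $T_gf=P_{H^2}(gf)$ with $P_{H^2}:L^2(\mathbb{T})\to H^2$ the orthogonal projection. For an inner function $\psi$, $g\circ\psi$ is the composition of $g$ with the boundary function of $\psi$, and $z$ in symbols denotes the identity function on $\mathbb{T}$. For $k\in H^2\setminus\{0\}$, $\mathrm{K}_{\min}(k)$ denotes the minimal Toeplitz kernel containing $k$: $\mathrm{K}_{\min}(k)=\ker T_f$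 for some $f\in L^\infty$, $k\in\ker T_f$, and $\ker T_f\subseteq\ker T_h$ for every $h\in L^\infty$ with $k\in\ker T_h$. $k$ is a maximal vector for $\ker T_g$ if $\mathrm{K}_{\min}(k)=\ker T_g$. In this statement $g$ is not the zero function. *)

(* Defs.v *)
From HB Require Import structures.
From mathcomp Require Import all_boot all_order all_algebra.
From mathcomp Require Import complex.
From mathcomp Require Import all_classical all_reals all_analysis.
From mathcomp Require Import measurable_realfun.

Set Implicit Arguments.
Unset Strict Implicit.
Unset Printing Implicit Defensive.

Import Order.TTheory GRing.Theory Num.Theory.
Import numFieldTopology.Exports numFieldNormedType.Exports.
Import ComplexField.Normc.

Local Open Scope classical_set_scope.
Local Open Scope complex_scope.
Local Open Scope ring_scope.

HB.instance Definition _ (R : realType) := NormedModule.copy R[i] R[i]^o.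

(* The sigma-algebra of the plane: the product Borel sigma-algebra of
   [R * R], read through [z |-> (Re z, Im z)]. *)
Definition complex_pair (R : realType) (z : R[i]) : R * R :=
  (complex.Re z, complex.Im z).

HB.instance Definition _ (R : realType) :=
  Measurable.copy R[i] (g_sigma_algebra_preimageType (@complex_pair R)).

Section circle.
Context {R : realType}.
Implicit Types (t : R) (f g h : R[i] -> R[i]).

Definition expi t : R[i] := cos (2 * pi * t) +i* sin (2 * pi * t).

Lemma measurable_expi : measurable_fun [set: R] expi.
Proof.
move=> _ _ [B mB <-]; rewrite !setTI -comp_preimage.
rewrite -[X in measurable X]setTI.
suff : measurable_fun [set: R] (@complex_pair R \o expi) by exact.
apply/measurable_fun_pair => /=.
- apply: continuous_measurable_fun => t.
  by apply: continuous_comp; [exact: mulrl_continuous|exact: continuous_cos].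
- apply: continuous_measurable_fun => t.
  by apply: continuous_comp; [exact: mulrl_continuous|exact: continuous_sin].
Qed.

(* Normalized Lebesgue measure of the unit circle, as a measure on the plane:
   the image of Lebesgue measure on [0, 1] under [t |-> exp (2 i pi t)]. It is
   carried by the circle, so Borel functions on the plane, taken up to
   almost-everywhere equality for it, are the measurable functions on the
   circle. *)
Definition circle_measure : set R[i] -> \bar R :=
  pushforward (mrestr (@lebesgue_measure R) (measurable_itv `[0, 1])) expi.

Let circle_measure0 : circle_measure set0 = 0%E.
Proof. by rewrite /circle_measure /pushforward preimage_set0 measure0. Qed.

Let measurable_preimage_expi A : measurable A -> measurable (expi @^-1` A).
Proof.
by rewrite -[X in _ -> measurable X]setTI => /(measurable_expi measurableT).
Qed.

Let circle_measure_ge0 A : (0 <= circle_measure A)%E.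
Proof. by rewrite /circle_measure /pushforward; apply: measure_ge0. Qed.

Let circle_measure_sigma_additive : semi_sigma_additive circle_measure.
Proof.
move=> F mF tF mUF; rewrite /circle_measure /pushforward preimage_bigcup.
apply: measure_semi_sigma_additive.
- by move=> n; exact: measurable_preimage_expi.
- apply/trivIsetP => /= i j _ _ ij; rewrite -preimage_setI.
  by move/trivIsetP : tF => /(_ _ _ _ _ ij) ->//; rewrite preimage_set0.
- by rewrite -preimage_bigcup; exact: measurable_preimage_expi.
Qed.

HB.instance Definition _ := isMeasure.Build _ _ _ circle_measure
  circle_measure0 circle_measure_ge0 circle_measure_sigma_additive.

Let circle_measure_setT : circle_measure [set: R[i]] = 1%E.
Proof.
rewrite /circle_measure /pushforward preimage_setT /mrestr setTI.
by rewrite lebesgue_measure_itv/= lte01 oppr0 adde0.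
Qed.

HB.instance Definition _ := Measure_isProbability.Build _ _ _ circle_measure
  circle_measure_setT.

Definition unit_circle : set R[i] := [set z | normc z = 1].

Definition unit_disc : set R[i] := [set z | normc z < 1].

Definition L2 : set (R[i] -> R[i]) := [set f | measurable_fun setT f /\
  (\int[circle_measure]_z ((normc (f z)) ^+ 2)%:E < +oo)%E].

Definition Linf : set (R[i] -> R[i]) := [set f | measurable_fun setT f /\
  exists M : R, \forall z \ae circle_measure, normc (f z) <= M].

Definition inner_product f g : R[i] :=
  (\int[circle_measure]_z complex.Re (f z * conjc (g z))) +i*
  (\int[circle_measure]_z complex.Im (f z * conjc (g z))).

(* The values of [F] outside the open unit disc are irrelevant, here and in the
   two Hardy spaces of the disc below. *)
Definition analytic_on_disc (F : R[i] -> R[i]) : Prop :=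
  exists a : nat -> R[i], forall z, unit_disc z ->
    (fun n => \sum_(j < n) a j * z ^+ j) @ \oo --> F z.

Definition hardy2_disc : set (R[i] -> R[i]) := [set F | analytic_on_disc F /\
  exists M : R, forall r : R, 0 <= r < 1 ->
    (\int[circle_measure]_(z in unit_circle)
       ((normc (F (r%:C * z))) ^+ 2)%:E <= M%:E)%E].

Definition hardyinf_disc : set (R[i] -> R[i]) := [set F | analytic_on_disc F /\
  exists M : R, forall z, unit_disc z -> normc (F z) <= M].

(* Radial limits, almost everywhere on the circle. *)
Definition boundary_function (F f : R[i] -> R[i]) : Prop :=
  measurable_fun setT f /\
  \forall z \ae circle_measure, F (r%:C * z) @[r --> (1 : R)^'-] --> f z.

(* [H2] and [Hinf] consist of boundary functions, so that an expression such as
   [k \o psi] with [k] in [H2] and [psi] inner is a composition of boundary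
   functions; as all functions here are Borel on the whole plane, it is Borel
   even though [psi] is unimodular only almost everywhere. *)
Definition H2 : set (R[i] -> R[i]) :=
  [set f | exists2 F, hardy2_disc F & boundary_function F f].

Definition Hinf : set (R[i] -> R[i]) :=
  [set f | exists2 F, hardyinf_disc F & boundary_function F f].

Definition conj_Hinf : set (R[i] -> R[i]) :=
  [set f | Hinf (fun z => conjc (f z))].

Definition invertible_in (A : set (R[i] -> R[i])) : set (R[i] -> R[i]) :=
  [set f | A f /\
    exists2 g, A g & (fun z => f z * g z) = cst 1 %[ae circle_measure]].

Definition inner (psi : R[i] -> R[i]) : Prop :=
  Hinf psi /\ \forall z \ae circle_measure, normc (psi z) = 1.

Definition nonconstant f : Prop :=
  ~ exists c : R[i], f = cst c %[ae circle_measure].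

Definition orthogonal_projection (V : set (R[i] -> R[i])) f p : Prop :=
  [/\ L2 f, V p &
    forall h, V h -> inner_product (fun z => f z - p z) h = 0].

(* The graph of the Toeplitz operator with symbol [g]: for [f] in [H2],
   [toeplitz g f u] means that [u] is (a representative of) [T_g f]. *)
Definition toeplitz g f u : Prop :=
  orthogonal_projection H2 (fun z => g z * f z) u.

Definition toeplitz_ker g : set (R[i] -> R[i]) :=
  [set f | H2 f /\ toeplitz g f (cst 0)].

(* [K] is the minimal Toeplitz kernel containing [k]. *)
Definition is_Kmin k (K : set (R[i] -> R[i])) : Prop :=
  exists f, [/\ Linf f, K = toeplitz_ker f, toeplitz_ker f k &
    forall h, Linf h -> toeplitz_ker h k -> toeplitz_ker f `<=` toeplitz_ker h].

Definition maximal_vector k g : Prop :=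
  [/\ H2 k, ~ (k = cst 0 %[ae circle_measure]) & is_Kmin k (toeplitz_ker g)].

(* [u V], as a set of classes for almost-everywhere equality. *)
Definition mul_set u (V : set (R[i] -> R[i])) : set (R[i] -> R[i]) :=
  [set f | measurable_fun setT f /\
    exists2 v, V v & f = (fun z => u z * v z) %[ae circle_measure]].

End circle.

(* Main.v *)
Require Import Defs.
From HB Require Import structures.
From mathcomp Require Import all_boot all_order all_algebra.
From mathcomp Require Import complex.
From mathcomp Require Import all_classical all_reals all_analysis.
From mathcomp Require Import measurable_realfun.
From mathcomp Require Import ring lra.

Set Implicit Arguments.
Unset Strict Implicit.
Unset Printing Implicit Defensive.

Import Order.TTheory GRing.Theory Num.Theory.
Import numFieldTopology.Exports numFieldNormedType.Exports.
Import ComplexField.Normc.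

Local Open Scope classical_set_scope.
Local Open Scope complex_scope.
Local Open Scope ring_scope.

(* A vector [k] of [ker T_g] is maximal exactly when [p = conj (z g k)], which
   lies in [H2], is cyclic: [b_n p -> 1] in [L2] for some bounded [b_n] in [H2].
   If [p] is cyclic and [k], [f] lie in [ker T_h], [ker T_g] respectively, then
   [(h f) (g k) = (h k) (g f)] shows that [conj (z h f)] is the weak limit of
   [b_n conj (z h k) conj (z g f)], so it lies in [H2] and [f] in [ker T_h].
   Conversely, if [p = I q] with [I] inner and nonconstant, then [k] lies in
   [ker T_(I g)], and minimality gives [I^n k] in [ker T_g] and [p = I^n q_n]
   for all [n], which is absurd; such an [I] is found by projecting [1] on the
   closed span of the [b p], as in Beurling's theorem.
   Up to a bounded invertible factor, the function [p] attached to
   [h_+^-1 (k o psi) psi] is [conj h_- (p o psi)]. It is again cyclic because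
   the measure of [psi^-1 A] is at most a constant times that of [A], so that
   composition with [psi] is bounded on [L2] and maps [H2] to [H2]. *)

(** * Complex numbers *)

(** Membership in [H2] is defined by radial limits, but the arguments run on Fourier coefficients: a
    square-integrable function lies in [H2] exactly when its integrals against all [z ^+ n.+1]
    vanish. One direction rests on the radial convergence of Poisson integrals, the other on a weak
    limit from inside the disc. Products, limits and compositions are then checked on coefficients;
    in particular functions on the disc are never composed.

    The bound on the measure of the preimages under [psi] replaces the invariance of the measure,
    which would ask that [psi] have mean 0. The mean over [z] of the Poisson kernel at [b * psi z]
    is the kernel at [b * a], with [a] the mean of [psi]; it is at most [2 / (1 - |a|)], and
    [|a| < 1] because [psi] is not constant.

    The projection of 1 on the closed span of the [b p] is nonzero only if [p] has nonzero mean;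
    otherwise [z] serves as [I]. That [g] is not zero ensures that [p] is not zero, since a nonzero
    function of [H2] cannot vanish on a set of positive measure. *)

Section complex_norm.
Context {R : realType}.
Implicit Types x y z : R[i].

Lemma complex_eqP x y : complex.Re x = complex.Re y ->
  complex.Im x = complex.Im y -> x = y.
Proof. by case: x => a b; case: y => c d /= -> ->. Qed.

Lemma normr_normc z : `|z| = (normc z)%:C.
Proof. by case: z => a b; rewrite normc_def. Qed.

Lemma normc_ge0 z : 0 <= normc z.
Proof. by case: z => a b; exact: sqrtr_ge0. Qed.

Lemma normc_sqr z : normc z ^+ 2 = complex.Re z ^+ 2 + complex.Im z ^+ 2.
Proof. by case: z => a b /=; rewrite sqr_sqrtr// addr_ge0// sqr_ge0. Qed.

Lemma ler_normcD x y : normc (x + y) <= normc x + normc y.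
Proof. exact: le_normcD. Qed.

Lemma normcNc z : normc (- z) = normc z.
Proof. exact: normcN. Qed.

Lemma normcBC x y : normc (x - y) = normc (y - x).
Proof. by rewrite -normcNc opprB. Qed.

Lemma ler_normcB x y : normc (x - y) <= normc x + normc y.
Proof. by rewrite (le_trans (ler_normcD _ _))// normcNc. Qed.

Lemma ler_normc_dist x y z : normc (x - z) <= normc (x - y) + normc (y - z).
Proof.
by rewrite (le_trans _ (ler_normcD _ _))// addrA subrK.
Qed.

Lemma normcB_dist x y : `|normc x - normc y| <= normc (x - y).
Proof.
rewrite ler_norml lerNl opprB !lerBlDr -[X in normc X <= _](subrK x y).
rewrite -[X in _ && (normc X <= _)](subrK y x) ler_normcD andbT.
by rewrite (normcBC x y) ler_normcD.
Qed.

Lemma normcX z n : normc (z ^+ n) = normc z ^+ n.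
Proof.
by elim: n => [|n ih]; rewrite ?expr0 ?normc1// !exprS normcM ih.
Qed.

Lemma normc_conj z : normc (conjc z) = normc z.
Proof. by case: z => a b /=; rewrite sqrrN. Qed.


Lemma normr_Re z : `|complex.Re z| <= normc z.
Proof.
rewrite -ler_sqr ?nnegrE ?normc_ge0// real_normK ?num_real//.
by rewrite normc_sqr lerDl sqr_ge0.
Qed.

Lemma normr_Im z : `|complex.Im z| <= normc z.
Proof.
rewrite -ler_sqr ?nnegrE ?normc_ge0// real_normK ?num_real//.
by rewrite normc_sqr lerDr sqr_ge0.
Qed.

Lemma normc_ReIm z : normc z <= `|complex.Re z| + `|complex.Im z|.
Proof.
rewrite -ler_sqr ?nnegrE ?normc_ge0 ?addr_ge0// normc_sqr sqrrD !real_normK ?num_real//.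
by rewrite [leRHS]addrAC lerDl mulrn_wge0// mulr_ge0.
Qed.

Lemma mulc_conj z : z * conjc z = (normc z ^+ 2)%:C.
Proof. by rewrite -sqr_normc normr_normc rmorphXn. Qed.


Lemma normc_real (a : R) : normc a%:C = `|a|.
Proof. by rewrite /= expr0n /= addr0 sqrtr_sqr. Qed.

Lemma normc_eq0 z : (normc z == 0) = (z == 0).
Proof.
apply/idP/idP => [/eqP/eq0_normc ->//|/eqP ->].
by rewrite -[0]/(0%:C) normc_real normr0.
Qed.

Lemma realcM (a b : R) : (a * b)%:C = a%:C * b%:C :> R[i].
Proof. by apply: complex_eqP => /=; rewrite ?mulr0 ?mul0r ?subr0 ?addr0. Qed.

Lemma realcD (a b : R) : (a + b)%:C = a%:C + b%:C :> R[i].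
Proof. by apply: complex_eqP => /=; rewrite ?addr0. Qed.

Lemma realcB (a b : R) : (a - b)%:C = a%:C - b%:C :> R[i].
Proof. by apply: complex_eqP => /=; rewrite ?subr0. Qed.

Lemma realcV (a : R) : (a^-1)%:C = a%:C^-1 :> R[i].
Proof.
have [->|a0] := eqVneq a 0; first by rewrite !invr0.
have ac : a%:C != 0 :> R[i] by rewrite -normc_eq0 normc_real normr_eq0.
by apply: (mulfI ac); rewrite -realcM !divff.
Qed.

Lemma conjcM x y : conjc (x * y) = conjc x * conjc y :> R[i].
Proof. by rewrite rmorphM. Qed.

Lemma conjcX x n : conjc (x ^+ n) = conjc x ^+ n :> R[i].
Proof. by rewrite rmorphXn. Qed.

Lemma conjcD x y : conjc (x + y) = conjc x + conjc y :> R[i].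
Proof. by rewrite rmorphD. Qed.

Lemma conjcN x : conjc (- x) = - conjc x :> R[i].
Proof. by rewrite rmorphN. Qed.

Lemma conjcB x y : conjc (x - y) = conjc x - conjc y :> R[i].
Proof. by rewrite rmorphB. Qed.

Lemma cReM x y : @complex.Re R (x * y) =
  complex.Re x * complex.Re y - complex.Im x * complex.Im y.
Proof. by case: x => a b; case: y => c d. Qed.

Lemma cImM x y : @complex.Im R (x * y) =
  complex.Re x * complex.Im y + complex.Im x * complex.Re y.
Proof. by case: x => a b; case: y => c d. Qed.

Lemma cReD x y : @complex.Re R (x + y) = complex.Re x + complex.Re y.
Proof. by case: x => a b; case: y => c d. Qed.

Lemma cImD x y : @complex.Im R (x + y) = complex.Im x + complex.Im y.
Proof. by case: x => a b; case: y => c d. Qed.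

Lemma cReN x : @complex.Re R (- x) = - complex.Re x.
Proof. by case: x. Qed.

Lemma cImN x : @complex.Im R (- x) = - complex.Im x.
Proof. by case: x. Qed.


(** The norm of [R[i]] as a normed module takes its values in [R[i]] itself; this turns limits into
    statements about the real-valued [normc]. *)
Lemma normc_cvgP {T : Type} (F : set_system T) {FF : Filter F} (f : T -> R[i]) (l : R[i]) :
  f @ F --> l <-> normc (f x - l) @[x --> F] --> (0 : R).
Proof.
split => [/cvgrPdist_lt h|/cvgrPdist_lt h].
- apply/cvgrPdist_lt => e e0.
  have := h e%:C; rewrite ltcR => /(_ e0); apply: filterS => x.
  rewrite normr_normc ltcR => xe.
  by rewrite sub0r normrN ger0_norm ?normc_ge0// normcBC.
(* A positive element of [R[i]] is a real number: the order forces its imaginary part to be 0. *)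
- apply/cvgrPdist_lt => e; case: e => a b; rewrite ltcE /= => /andP[/eqP -> a0].
  have := h a a0; apply: filterS => x.
  rewrite sub0r normrN ger0_norm ?normc_ge0// => xa.
  by rewrite normr_normc ltcR normcBC.
Qed.

Lemma cvg_normc {T : Type} (F : set_system T) {FF : Filter F} (f : T -> R[i]) (l : R[i]) :
  f @ F --> l -> normc (f x) @[x --> F] --> normc l.
Proof.
move=> /normc_cvgP /cvgrPdist_le h; apply/cvgrPdist_le => e /h; apply: filterS => x.
rewrite sub0r normrN ger0_norm ?normc_ge0//; apply: le_trans.
by rewrite normcBC normcB_dist.
Qed.

Lemma cvgc_Re {T : Type} (F : set_system T) {FF : Filter F} (f : T -> R[i]) (l : R[i]) :
  f @ F --> l -> complex.Re (f x) @[x --> F] --> complex.Re l.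
Proof.
move=> /normc_cvgP /cvgrPdist_lt h; apply/cvgrPdist_lt => e /h; apply: filterS => x.
rewrite sub0r normrN ger0_norm ?normc_ge0//; apply: le_lt_trans.
by rewrite distrC -cReN -cReD normr_Re.
Qed.

Lemma cvgc_Im {T : Type} (F : set_system T) {FF : Filter F} (f : T -> R[i]) (l : R[i]) :
  f @ F --> l -> complex.Im (f x) @[x --> F] --> complex.Im l.
Proof.
move=> /normc_cvgP /cvgrPdist_lt h; apply/cvgrPdist_lt => e /h; apply: filterS => x.
rewrite sub0r normrN ger0_norm ?normc_ge0//; apply: le_lt_trans.
by rewrite distrC -cImN -cImD normr_Im.
Qed.

Lemma cvgc_ReIm {T : Type} (F : set_system T) {FF : Filter F} (f : T -> R[i]) (l : R[i]) :
  complex.Re (f x) @[x --> F] --> complex.Re l ->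
  complex.Im (f x) @[x --> F] --> complex.Im l -> f @ F --> l.
Proof.
move=> /cvgrPdist_lt hr /cvgrPdist_lt hi; apply/normc_cvgP/cvgrPdist_lt => e e0.
have e2 : 0 < e / 2 by rewrite divr_gt0.
have := hi _ e2; have := hr _ e2; apply: filterS2 => x h1 h2.
rewrite sub0r normrN ger0_norm ?normc_ge0// normcBC.
apply: le_lt_trans (normc_ReIm _) _; rewrite cReD cImD cReN cImN.
by rewrite (splitr e) ltrD.
Qed.

Lemma cvgc_unique {T : Type} (F : set_system T) {FF : ProperFilter F} (f : T -> R[i])
  (l m : R[i]) : f @ F --> l -> f @ F --> m -> l = m.
Proof.
move=> fl fm; apply: complex_eqP.
- exact: (cvg_unique (@Rhausdorff R) (cvgc_Re fl) (cvgc_Re fm)).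
- exact: (cvg_unique (@Rhausdorff R) (cvgc_Im fl) (cvgc_Im fm)).
Qed.

End complex_norm.

(** * Measurability of complex-valued functions *)

Section complex_measurable.
Context d (T : measurableType d) {R : realType}.
Implicit Types f g : T -> R[i].

Lemma measurable_complexP f : measurable_fun [set: T] f <->
  measurable_fun [set: T] (fun x => complex.Re (f x)) /\
  measurable_fun [set: T] (fun x => complex.Im (f x)).
Proof.
have pairE : (@complex_pair R \o f) = (fun x => (complex.Re (f x), complex.Im (f x))).
  by [].
split => [mf|[mr mi]].
- have /measurable_fun_pairP : measurable_fun [set: T] (@complex_pair R \o f).
    move=> _ B mB; have := mf measurableT (@complex_pair R @^-1` B).
    apply; exists B => //; by rewrite setTI.
  by [].
- have /= mp : measurable_fun [set: T] (@complex_pair R \o f).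
    by rewrite pairE; apply: measurable_fun_pair.
  move=> _ _ [B mB <-]; rewrite !setTI.
  by have := mp measurableT B mB; rewrite setTI.
Qed.

Lemma measurable_cRe f : measurable_fun [set: T] f ->
  measurable_fun [set: T] (fun x => complex.Re (f x)).
Proof. by move=> /measurable_complexP[]. Qed.

Lemma measurable_cIm f : measurable_fun [set: T] f ->
  measurable_fun [set: T] (fun x => complex.Im (f x)).
Proof. by move=> /measurable_complexP[]. Qed.

Lemma measurable_cD f g : measurable_fun [set: T] f -> measurable_fun [set: T] g ->
  measurable_fun [set: T] (fun x => f x + g x).
Proof.
move=> mf mg; apply/measurable_complexP; split => /=.
- under eq_fun do rewrite /= cReD.
  by apply: measurable_funD; exact: measurable_cRe.
- under eq_fun do rewrite /= cImD.
  by apply: measurable_funD; exact: measurable_cIm.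
Qed.

Lemma measurable_cN f : measurable_fun [set: T] f ->
  measurable_fun [set: T] (fun x => - f x).
Proof.
move=> mf; apply/measurable_complexP; split => /=.
- under eq_fun do rewrite /= cReN.
  by apply: measurable_funN; exact: measurable_cRe.
- under eq_fun do rewrite /= cImN.
  by apply: measurable_funN; exact: measurable_cIm.
Qed.

Lemma measurable_cB f g : measurable_fun [set: T] f -> measurable_fun [set: T] g ->
  measurable_fun [set: T] (fun x => f x - g x).
Proof. by move=> mf mg; apply: measurable_cD => //; exact: measurable_cN. Qed.

Lemma measurable_cM f g : measurable_fun [set: T] f -> measurable_fun [set: T] g ->
  measurable_fun [set: T] (fun x => f x * g x).
Proof.
move=> mf mg; apply/measurable_complexP; split => /=.
- under eq_fun do rewrite /= cReM.
  by apply: measurable_funB; apply: measurable_funM;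
    (exact: measurable_cRe || exact: measurable_cIm).
- under eq_fun do rewrite /= cImM.
  by apply: measurable_funD; apply: measurable_funM;
    (exact: measurable_cRe || exact: measurable_cIm).
Qed.

Lemma measurable_cX f n : measurable_fun [set: T] f ->
  measurable_fun [set: T] (fun x => f x ^+ n).
Proof.
move=> mf; elim: n => [|n ih]; first by under eq_fun do rewrite expr0; exact: measurable_cst.
by under eq_fun do rewrite exprS; exact: measurable_cM.
Qed.

Lemma measurable_cconj f : measurable_fun [set: T] f ->
  measurable_fun [set: T] (fun x => conjc (f x)).
Proof.
move=> mf; apply/measurable_complexP; split => /=.
- rewrite (_ : (fun _ => _) = (fun x => complex.Re (f x))).
    exact: measurable_cRe.
  by apply/funext => x; case: (f x).
- rewrite (_ : (fun _ => _) = (fun x => - complex.Im (f x))).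
    by apply: measurable_funN; exact: measurable_cIm.
  by apply/funext => x; case: (f x).
Qed.

Lemma measurable_normc2 f : measurable_fun [set: T] f ->
  measurable_fun [set: T] (fun x => normc (f x) ^+ 2).
Proof.
move=> mf; under eq_fun do rewrite normc_sqr.
by apply: measurable_funD; apply: measurable_funX;
  (exact: measurable_cRe || exact: measurable_cIm).
Qed.

Lemma measurable_normc f : measurable_fun [set: T] f ->
  measurable_fun [set: T] (fun x => normc (f x)).
Proof.
move=> mf; rewrite (_ : (fun _ => _) = (fun y : R => Num.sqrt y) \o (fun x => normc (f x) ^+ 2)).
  apply: measurableT_comp; last exact: measurable_normc2.
  by apply: continuous_measurable_fun; exact: sqrt_continuous.
by apply/funext => x /=; rewrite sqrtr_sqr ger0_norm ?normc_ge0.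
Qed.

Lemma measurable_realc (u : T -> R) : measurable_fun [set: T] u ->
  measurable_fun [set: T] (fun x => (u x)%:C).
Proof.
by move=> mu; apply/measurable_complexP; split => //=; exact: measurable_cst.
Qed.

Lemma invc_normc (z : R[i]) : z^-1 = ((normc z ^+ 2)^-1)%:C * conjc z.
Proof.
have [->|z0] := eqVneq z 0; first by rewrite invr0 conjc0 mulr0.
apply: (mulfI z0); rewrite divff// mulrCA mulc_conj -rmorphM /= mulVf//.
by rewrite expf_neq0// normc_eq0.
Qed.

(** By [invc_normc] the inverse is the conjugate over the squared modulus, and the real inverse is
    the power [-1], which is measurable; the conventions agree at 0. *)
Lemma measurable_cV f : measurable_fun [set: T] f ->
  measurable_fun [set: T] (fun x => (f x)^-1).
Proof.
move=> mf; under eq_fun do rewrite invc_normc.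
apply: measurable_cM; last exact: measurable_cconj.
apply: measurable_realc.
rewrite (_ : (fun _ => _) = (@powR R ^~ (-1)) \o (fun x => normc (f x) ^+ 2)).
  by apply: measurableT_comp; [exact: measurable_powR|exact: measurable_normc2].
by apply/funext => x /=; rewrite powR_inv1// exprn_ge0 ?normc_ge0.
Qed.

Lemma measurable_funV (u : T -> R) : measurable_fun [set: T] u ->
  measurable_fun [set: T] (fun x => (u x)^-1).
Proof.
move=> mu; have := measurable_cRe (measurable_cV (measurable_realc mu)).
congr (measurable_fun _ _); apply/funext => x /=; rewrite expr0n /= addr0.
have [->|h] := eqVneq (u x) 0; first by rewrite mul0r invr0.
by field.
Qed.

(** Convergence is required at every point, since a limit that exists only almost everywhere need
    not be measurable; the uses below first put the functions to 0 off a measurable set. *)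
Lemma measurable_ccvg (h : nat -> T -> R[i]) f :
  (forall n, measurable_fun [set: T] (h n)) ->
  (forall x, h ^~ x @ \oo --> f x) -> measurable_fun [set: T] f.
Proof.
move=> mh hf; apply/measurable_complexP; split.
- apply: (@measurable_fun_cvg _ _ _ _ (fun n x => complex.Re (h n x))) => [n|x _].
    exact: measurable_cRe.
  exact: cvgc_Re.
- apply: (@measurable_fun_cvg _ _ _ _ (fun n x => complex.Im (h n x))) => [n|x _].
    exact: measurable_cIm.
  exact: cvgc_Im.
Qed.

End complex_measurable.

Local Arguments normc : simpl never.

(** * Integration and square-integrable functions *)

Section real_integral.
Context d (T : measurableType d) {R : realType} (P : probability T R).
Implicit Types u v : T -> R.

Definition rint u := P.-integrable [set: T] (EFin \o u).

Lemma rint_meas u : rint u -> measurable_fun [set: T] u.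
Proof. by move=> /measurable_int /measurable_EFinP. Qed.

Lemma rint_ge0P u : measurable_fun [set: T] u -> (forall x, 0 <= u x) ->
  (\int[P]_x (u x)%:E < +oo)%E -> rint u.
Proof.
move=> mu u0 h; apply/integrableP; split; first exact/measurable_EFinP.
by under eq_integral do rewrite gee0_abs ?lee_fin//.
Qed.

Lemma EFin_rint u : rint u -> (\int[P]_x u x)%:E = (\int[P]_x (u x)%:E)%E.
Proof. by move=> iu; rewrite /Rintegral fineK//; exact: integrable_fin_num. Qed.

Lemma rint_dom u v : measurable_fun [set: T] u -> (forall x, 0 <= u x) ->
  rint v -> (\forall x \ae P, u x <= v x) ->
  rint u /\ \int[P]_x u x <= \int[P]_x v x.
Proof.
move=> mu u0 iv uv; have mv := rint_meas iv.
(* The bound by [v] holds only almost everywhere, so [v] may be negative on a null set;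
   [Num.max (v x) 0] is nonnegative everywhere and agrees with [v] almost everywhere. *)
have mv' : measurable_fun [set: T] (fun x => Num.max (v x) 0).
  by apply: measurable_maxr => //; exact: measurable_cst.
have le (w : T -> R) : measurable_fun [set: T] w -> (forall x, 0 <= w x) ->
    (\forall x \ae P, u x <= w x) -> (\int[P]_x (u x)%:E <= \int[P]_x (w x)%:E)%E.
  move=> mw w0 uw; apply: ae_ge0_le_integral => //;
    do ?[exact/measurable_EFinP | by move=> x _; rewrite lee_fin].
  by apply: filterS uw => x uw _; rewrite lee_fin.
have fv : (\int[P]_x (`|v x|)%:E < +oo)%E by case/integrableP : iv.
have iu : rint u.
  apply: rint_ge0P => //; apply: le_lt_trans fv; apply: le => //.
  - exact: measurableT_comp.
  - by apply: filterS uv => x uv; rewrite (le_trans uv)// ler_norm.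
split=> //; rewrite -lee_fin !EFin_rint//.
rewrite [leRHS](_ : _ = \int[P]_x (Num.max (v x) 0)%:E)%E; last first.
  apply: ae_eq_integral => //.
  - exact/measurable_EFinP.
  - exact/measurable_EFinP.
  - by apply: filterS uv => x uv _; rewrite max_l// (le_trans (u0 x)).
apply: le => //.
- by move=> x; rewrite le_max lexx orbT.
- by apply: filterS uv => x uv; rewrite le_max uv.
Qed.

Lemma rint_cst (c : R) : rint (fun=> c).
Proof. exact: finite_measure_integrable_cst. Qed.

Lemma Rint_cst (c : R) : \int[P]_x c = c.
Proof.
rewrite Rintegral_cst//.
by have /= -> := @probability_setT _ _ _ P; rewrite mulr1.
Qed.

Lemma rintD u v : rint u -> rint v -> rint (fun x => u x + v x).
Proof. by move=> iu iv; exact: (integrableD measurableT iu iv). Qed.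

Lemma rintB u v : rint u -> rint v -> rint (fun x => u x - v x).
Proof. by move=> iu iv; exact: (integrableB measurableT iu iv). Qed.

Lemma rintZ c u : rint u -> rint (fun x => c * u x).
Proof. by move=> iu; exact: (integrableZl measurableT c iu). Qed.

Lemma RintD u v : rint u -> rint v ->
  \int[P]_x (u x + v x) = \int[P]_x u x + \int[P]_x v x.
Proof. exact: RintegralD. Qed.

Lemma RintB u v : rint u -> rint v ->
  \int[P]_x (u x - v x) = \int[P]_x u x - \int[P]_x v x.
Proof. exact: RintegralB. Qed.

Lemma RintZ c u : rint u -> \int[P]_x (c * u x) = c * \int[P]_x u x.
Proof. by move=> iu; exact: RintegralZl. Qed.

Lemma Rint_ae u v : measurable_fun [set: T] u -> measurable_fun [set: T] v ->
  (\forall x \ae P, u x = v x) -> \int[P]_x u x = \int[P]_x v x.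
Proof.
move=> mu mv uv; congr fine; apply: ae_eq_integral => //.
- exact/measurable_EFinP.
- exact/measurable_EFinP.
- by apply: filterS uv => x ->.
Qed.

Lemma Rint_dct (u_ : nat -> T -> R) u v : (forall n, measurable_fun [set: T] (u_ n)) ->
  measurable_fun [set: T] u ->
  (\forall x \ae P, u_ ^~ x @ \oo --> u x) -> rint v ->
  (\forall x \ae P, forall n, `|u_ n x| <= v x) ->
  rint u /\ \int[P]_x u_ n x @[n --> \oo] --> \int[P]_x u x.
Proof.
move=> mu_ mu h iv uv.
have iu_ n : rint (u_ n).
  have [] := @rint_dom (fun x => `|u_ n x|) v => //.
  - exact: measurableT_comp.
  - by apply: filterS uv.
  move=> /integrableP [_ hn] _; apply/integrableP; split; first exact/measurable_EFinP.
  by under eq_integral do rewrite /= -[`|u_ n _|]normr_id.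
have mE_ n : measurable_fun [set: T] (fun x => (u_ n x)%:E) by exact/measurable_EFinP.
have mE : measurable_fun [set: T] (fun x => (u x)%:E) by exact/measurable_EFinP.
have h' : \forall x \ae P, [set: T] x -> (u_ n x)%:E @[n --> \oo] --> (u x)%:E.
  by apply: filterS h => x hx _; apply/fine_cvgP; split; first exact: nearW.
have uv' : \forall x \ae P, forall n, [set: T] x -> (`|(u_ n x)%:E| <= (EFin \o v) x)%E.
  by apply: filterS uv => x hx n _ /=; rewrite lee_fin.
have [iu _ hc] := dominated_convergence measurableT mE_ mE h' iv uv'.
split=> //.
have {}iu : rint u by [].
by rewrite -(EFin_rint iu) in hc; exact: fine_cvg hc.
Qed.



(** Almost everywhere the limit is the lower limit, so Fatou's lemma applies. This is how limit
    functions below are shown to be integrable: a bound on the integrals from some rank on is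
    enough. *)
Lemma Rint_fatou (u_ : nat -> T -> R) u (M : R) : (forall n, rint (u_ n)) ->
  (forall n x, 0 <= u_ n x) -> measurable_fun [set: T] u -> (forall x, 0 <= u x) ->
  (\forall x \ae P, u_ ^~ x @ \oo --> u x) ->
  (\forall n \near \oo, \int[P]_x u_ n x <= M) -> rint u /\ \int[P]_x u x <= M.
Proof.
move=> iu_ u_0 mu u0 h hM.
have mE_ n : measurable_fun [set: T] (fun x => (u_ n x)%:E).
  exact/measurable_EFinP/rint_meas.
have leM : (\int[P]_x (u x)%:E <= M%:E)%E.
  rewrite (_ : \int[P]_x (u x)%:E = \int[P]_x limn_einf (fun n => (u_ n x)%:E))%E; last first.
    apply: ae_eq_integral => //.
    - exact/measurable_EFinP.
    - rewrite (_ : (fun _ => _) = (fun x => - limn_esup (fun n => - (u_ n x)%:E)))%E.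
        apply: measurableT_comp => //; apply: measurable_fun_limn_esup => n.
        by apply: measurableT_comp => //; exact: mE_.
      by apply/funext => x; rewrite /limn_einf.
    - apply: filterS h => x hx _; apply/esym.
      apply: (cvg_limn_einf_sup _).1; apply/fine_cvgP; split; first exact: nearW.
      exact: hx.
  apply: le_trans (fatou _ measurableT mE_ _) _.
    by move=> n x _; rewrite lee_fin.
  rewrite limn_einf_lim; apply: lime_le; first exact: is_cvg_einfs.
  apply: filterS hM => n hn; apply: ge_ereal_inf; exists (\int[P]_x (u_ n x)%:E)%E.
    by exists n => /=.
  by rewrite -EFin_rint// lee_fin.
have iu : rint u by apply: rint_ge0P => //; rewrite (le_lt_trans leM)// ltry.
by split=> //; rewrite -lee_fin EFin_rint.
Qed.

Lemma Rint_ge0 u : (forall x, 0 <= u x) -> 0 <= \int[P]_x u x.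
Proof. by move=> u0; apply: Rintegral_ge0. Qed.

Lemma Rint_eq0 u : rint u -> (forall x, 0 <= u x) -> \int[P]_x u x = 0 ->
  \forall x \ae P, u x = 0.
Proof.
move=> iu u0 h.
have mE : measurable_fun [set: T] (EFin \o u) by exact/measurable_EFinP/rint_meas.
have [H _] := @ae_eq_integral_abs _ _ _ P _ measurableT _ mE.
have /H : (\int[P]_x `|(EFin \o u) x| = 0)%E.
  by under eq_integral do rewrite gee0_abs ?lee_fin//; rewrite -EFin_rint// h.
by apply: filterS => x /(_ Logic.I) /= [].
Qed.

End real_integral.

(** * Complex integrals, L1 and L2 *)

Section complex_integral.
Context d (T : measurableType d) {R : realType} (P : probability T R).
Implicit Types f g h : T -> R[i].

(** Coordinatewise, so that [inner_product f h] is by conversion the [Cint] over the circle of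
    [f z * conjc (h z)]. *)
Definition Cint f : R[i] :=
  (\int[P]_x complex.Re (f x)) +i* (\int[P]_x complex.Im (f x)).

Definition cL1 f := measurable_fun [set: T] f /\ rint P (fun x => normc (f x)).
Definition cL2 f := measurable_fun [set: T] f /\ rint P (fun x => normc (f x) ^+ 2).

Definition n1 f : R := \int[P]_x normc (f x).
(** The squared norm of L2: the parallelogram law, Bessel's inequality and the limits below are all
    about squares, so no root is taken. *)
Definition n2 f : R := \int[P]_x (normc (f x) ^+ 2).

Lemma n1_ge0 f : 0 <= n1 f.
Proof. by apply: Rint_ge0 => x; exact: normc_ge0. Qed.

Lemma n2_ge0 f : 0 <= n2 f.
Proof. by apply: Rint_ge0 => x; exact: sqr_ge0. Qed.

Lemma cL1_dom f u : measurable_fun [set: T] f -> rint P u ->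
  (\forall x \ae P, normc (f x) <= u x) -> cL1 f /\ n1 f <= \int[P]_x u x.
Proof.
move=> mf iu fu; have [] := rint_dom (measurable_normc mf) _ iu fu => //.
by move=> x; exact: normc_ge0.
Qed.

Lemma cL2_dom f u : measurable_fun [set: T] f -> rint P u ->
  (\forall x \ae P, normc (f x) ^+ 2 <= u x) -> cL2 f /\ n2 f <= \int[P]_x u x.
Proof.
move=> mf iu fu; have [] := rint_dom (measurable_normc2 mf) _ iu fu => //.
by move=> x; exact: sqr_ge0.
Qed.

Lemma rint_absdom (u v : T -> R) : measurable_fun [set: T] u -> rint P v ->
  (forall x, `|u x| <= v x) -> rint P u.
Proof.
move=> mu iv uv; apply: le_integrable iv => //; first exact/measurable_EFinP.
by move=> x _ /=; rewrite lee_fin (le_trans (uv x))// ler_norm.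
Qed.

Lemma cL1_Re f : cL1 f -> rint P (fun x => complex.Re (f x)).
Proof.
move=> [mf i]; apply: rint_absdom i _; first exact: measurable_cRe.
by move=> x; exact: normr_Re.
Qed.

Lemma cL1_Im f : cL1 f -> rint P (fun x => complex.Im (f x)).
Proof.
move=> [mf i]; apply: rint_absdom i _; first exact: measurable_cIm.
by move=> x; exact: normr_Im.
Qed.

Lemma cL1D f g : cL1 f -> cL1 g -> cL1 (fun x => f x + g x).
Proof.
move=> [mf i] [mg j]; have [] := cL1_dom (measurable_cD mf mg) (rintD i j) _ => //.
by apply: aeW => x; exact: ler_normcD.
Qed.

Lemma cL1M f g (M : R) : cL1 f -> measurable_fun [set: T] g ->
  (\forall x \ae P, normc (g x) <= M) -> cL1 (fun x => f x * g x).
Proof.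
move=> [mf i] mg gM; have [] := cL1_dom (measurable_cM mf mg) (rintZ M i) _ => //.
by apply: filterS gM => x gM; rewrite normcM mulrC ler_wpM2r ?normc_ge0.
Qed.

Lemma cL1Z (c : R[i]) f : cL1 f -> cL1 (fun x => c * f x).
Proof.
move=> [mf i]; have [] := cL1_dom (measurable_cM (measurable_cst c) mf) (rintZ (normc c) i) _ => //.
by apply: aeW => x; rewrite normcM.
Qed.

Lemma cL1N f : cL1 f -> cL1 (fun x => - f x).
Proof.
move=> [mf i]; split; first exact: measurable_cN.
by under eq_fun do rewrite normcNc.
Qed.

Lemma cL1B f g : cL1 f -> cL1 g -> cL1 (fun x => f x - g x).
Proof. by move=> hf hg; apply: cL1D => //; exact: cL1N. Qed.

Lemma cL1_bounded f (M : R) : measurable_fun [set: T] f ->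
  (\forall x \ae P, normc (f x) <= M) -> cL1 f.
Proof. by move=> mf fM; have [] := cL1_dom mf (rint_cst P M) fM. Qed.

Lemma CintD f g : cL1 f -> cL1 g ->
  Cint (fun x => f x + g x) = Cint f + Cint g.
Proof.
move=> hf hg; apply: complex_eqP; rewrite /= ?cReD ?cImD /=.
- rewrite -RintD; [|exact: cL1_Re|exact: cL1_Re].
  by apply: eq_Rintegral => x _; rewrite cReD.
- rewrite -RintD; [|exact: cL1_Im|exact: cL1_Im].
  by apply: eq_Rintegral => x _; rewrite cImD.
Qed.

Lemma CintZ (c : R[i]) f : cL1 f -> Cint (fun x => c * f x) = c * Cint f.
Proof.
move=> hf; have hr := cL1_Re hf; have hi := cL1_Im hf.
apply: complex_eqP.
- rewrite cReM -!RintZ// -RintB; [|exact: rintZ|exact: rintZ].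
  by apply: eq_Rintegral => x _; rewrite cReM.
- rewrite cImM -!RintZ// -RintD; [|exact: rintZ|exact: rintZ].
  by apply: eq_Rintegral => x _; rewrite cImM.
Qed.

Lemma CintB f g : cL1 f -> cL1 g ->
  Cint (fun x => f x - g x) = Cint f - Cint g.
Proof.
move=> hf hg; rewrite -mulN1r -CintZ// -CintD//; last exact: cL1Z.
by congr Cint; apply/funext => x; rewrite mulN1r.
Qed.

Lemma Cint_conj f : cL1 f -> Cint (fun x => conjc (f x)) = conjc (Cint f).
Proof.
move=> hf; apply: complex_eqP => /=.
- by apply: eq_Rintegral => x _; case: (f x).
- rewrite -mulN1r -RintZ; last exact: cL1_Im.
  by apply: eq_Rintegral => x _; rewrite mulN1r; case: (f x).
Qed.

Lemma Cint_cst (c : R[i]) : Cint (fun=> c) = c.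
Proof. by rewrite /Cint !Rint_cst; case: c. Qed.

Lemma Cint_ae f g : measurable_fun [set: T] f -> measurable_fun [set: T] g ->
  f = g %[ae P] -> Cint f = Cint g.
Proof.
move=> mf mg fg; apply: complex_eqP => /=; apply: Rint_ae;
  do ?[exact: measurable_cRe|exact: measurable_cIm];
  by apply: filterS fg => x ->.
Qed.

(** The factor 2 comes from bounding the real and imaginary parts separately; it does no harm in the
    limits where the bound is used. *)
Lemma normc_Cint f : cL1 f -> normc (Cint f) <= 2 * n1 f.
Proof.
move=> hf; apply: le_trans (normc_ReIm _) _ => /=; rewrite mulr2n mulrDl !mul1r.
have le (u : T -> R) : rint P u -> (forall x, `|u x| <= normc (f x)) ->
    `|\int[P]_x u x| <= n1 f.
  move=> iu uf; apply: le_trans (le_normr_Rintegral measurableT iu) _.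
  apply: le_Rintegral => //; last exact: hf.2.
  exact: integrable_norm.
by apply: lerD; apply: le => [|x];
  do ?[exact: cL1_Re|exact: cL1_Im|exact: normr_Re|exact: normr_Im].
Qed.

Lemma Cint_sum (I : Type) (s : seq I) (F : I -> T -> R[i]) :
  (forall i, cL1 (F i)) -> cL1 (fun x => \sum_(i <- s) F i x) /\
  Cint (fun x => \sum_(i <- s) F i x) = \sum_(i <- s) Cint (F i).
Proof.
move=> h; elim: s => [|i s [ih1 ih2]].
- under eq_fun do rewrite big_nil; rewrite big_nil Cint_cst; split=> //.
  apply: (@cL1_bounded _ 0) => //.
  by apply: aeW => x; rewrite normc0.
- under eq_fun do rewrite big_cons; rewrite big_cons CintD// ih2.
  by split=> //; exact: cL1D.
Qed.

Lemma n1_cvg0_Cint (f_ : nat -> T -> R[i]) f : (forall n, cL1 (f_ n)) -> cL1 f ->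
  n1 (fun x => f_ n x - f x) @[n --> \oo] --> 0 -> Cint (f_ n) @[n --> \oo] --> Cint f.
Proof.
move=> hf_ hf h; apply/normc_cvgP.
have h2 : 2 * n1 (fun x => f_ n x - f x) @[n --> \oo] --> 0.
  by rewrite -[X in _ --> X](mulr0 2); apply: cvgMr.
apply: (squeeze_cvgr _ (cvg_cst 0) h2); apply: nearW => n; rewrite normc_ge0 andTb.
by rewrite -CintB//; apply: normc_Cint; exact: cL1B.
Qed.

Lemma Cint_dct (f_ : nat -> T -> R[i]) f v : (forall n, measurable_fun [set: T] (f_ n)) ->
  measurable_fun [set: T] f ->
  (\forall x \ae P, f_ ^~ x @ \oo --> f x) -> rint P v ->
  (\forall x \ae P, forall n, normc (f_ n x) <= v x) ->
  cL1 f /\ Cint (f_ n) @[n --> \oo] --> Cint f.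
Proof.
move=> mf_ mf h iv hv.
have hf_ n : cL1 (f_ n).
  by have [] := cL1_dom (mf_ n) iv _ => //; apply: filterS hv.
have h' : \forall x \ae P, normc (f_ n x) @[n --> \oo] --> normc (f x).
  by apply: filterS h => x; exact: cvg_normc.
have hv' : \forall x \ae P, forall n, `|normc (f_ n x)| <= v x.
  by apply: filterS hv => x hx n; rewrite ger0_norm ?normc_ge0.
have [iu _] := Rint_dct (fun n => measurable_normc (mf_ n)) (measurable_normc mf) h' iv hv'.
have hf : cL1 f by [].
have m0 : measurable_fun [set: T] (fun=> 0 : R) by exact: measurable_cst.
split=> //; apply: n1_cvg0_Cint => //.
have [] := @Rint_dct _ _ _ P (fun n x => normc (f_ n x - f x)) (fun=> 0)
  (fun x => v x + normc (f x)) _ m0 _ _ _.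
- by move=> n; apply: measurable_normc; exact: measurable_cB.
- by apply: filterS h => x /normc_cvgP.
- exact: rintD.
- apply: filterS hv => x hx n; rewrite ger0_norm ?normc_ge0//.
  by rewrite (le_trans (ler_normcB _ _))// lerD2r.
by rewrite Rint_cst.
Qed.


End complex_integral.

(** * Products and weak convergence of square-integrable functions *)

Section square_integrable.
Context d (T : measurableType d) {R : realType} (P : probability T R).
Implicit Types f g h : T -> R[i].
Local Notation cL1 := (cL1 P).
Local Notation cL2 := (cL2 P).
Local Notation n1 := (n1 P).
Local Notation n2 := (n2 P).
Local Notation Cint := (Cint P).

Lemma sqr_normcD (x y : R[i]) :
  normc (x + y) ^+ 2 <= 2 * normc x ^+ 2 + 2 * normc y ^+ 2.
Proof.
have := sqr_ge0 (normc x - normc y).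
have : normc (x + y) ^+ 2 <= (normc x + normc y) ^+ 2.
  by rewrite ler_sqr ?nnegrE ?addr_ge0 ?normc_ge0// ler_normcD.
nra.
Qed.

Lemma cL2_n2D f g : cL2 f -> cL2 g ->
  cL2 (fun x => f x + g x) /\ n2 (fun x => f x + g x) <= 2 * n2 f + 2 * n2 g.
Proof.
move=> [mf i] [mg j].
have k := rintD (rintZ 2 i) (rintZ 2 j).
have [] := cL2_dom (measurable_cD mf mg) k _.
  by apply: aeW => x; exact: sqr_normcD.
move=> hL2 le; split=> //; apply: le_trans le _.
by rewrite RintD ?RintZ//; exact: rintZ.
Qed.

Lemma cL2D f g : cL2 f -> cL2 g -> cL2 (fun x => f x + g x).
Proof. by move=> hf hg; case: (cL2_n2D hf hg). Qed.

Lemma cL2N f : cL2 f -> cL2 (fun x => - f x).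
Proof.
move=> [mf i]; split; first exact: measurable_cN.
by under eq_fun do rewrite normcNc.
Qed.

Lemma cL2B f g : cL2 f -> cL2 g -> cL2 (fun x => f x - g x).
Proof. by move=> hf hg; apply: cL2D => //; exact: cL2N. Qed.

Lemma cL2M f g (M : R) : cL2 f -> measurable_fun [set: T] g ->
  (\forall x \ae P, normc (g x) <= M) ->
  cL2 (fun x => f x * g x) /\ n2 (fun x => f x * g x) <= M ^+ 2 * n2 f.
Proof.
move=> [mf i] mg gM; have [] := cL2_dom (measurable_cM mf mg) (rintZ (M ^+ 2) i) _ => //.
  apply: filterS gM => x gM; rewrite normcM exprMn mulrC ler_wpM2r ?sqr_ge0//.
  by rewrite ler_sqr ?nnegrE ?normc_ge0// (le_trans (normc_ge0 _) gM).
by rewrite RintZ.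
Qed.

Lemma cL2Z (c : R[i]) f : cL2 f ->
  cL2 (fun x => c * f x) /\ n2 (fun x => c * f x) = normc c ^+ 2 * n2 f.
Proof.
move=> [mf i]; have E : (fun x => normc (c * f x) ^+ 2) = (fun x => normc c ^+ 2 * normc (f x) ^+ 2).
  by apply/funext => x; rewrite normcM exprMn.
split; first split.
- exact: measurable_cM.
- by rewrite E; exact: rintZ.
- by rewrite /n2 E RintZ.
Qed.

Lemma cL2_conj f : cL2 f -> cL2 (fun x => conjc (f x)).
Proof.
move=> [mf i]; split; first exact: measurable_cconj.
by under eq_fun do rewrite normc_conj.
Qed.

Lemma cL2_ae f g : measurable_fun [set: T] g -> f = g %[ae P] -> cL2 f -> cL2 g.
Proof.
move=> mg fg [mf i]; have [] := cL2_dom mg i _ => //.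
by apply: filterS fg => x ->.
Qed.

Lemma n2_ae f g : measurable_fun [set: T] f -> measurable_fun [set: T] g ->
  f = g %[ae P] -> n2 f = n2 g.
Proof.
move=> mf mg fg; apply: Rint_ae; do ?exact: measurable_normc2.
by apply: filterS fg => x ->.
Qed.

Lemma cL2_bounded f (M : R) : measurable_fun [set: T] f ->
  (\forall x \ae P, normc (f x) <= M) -> cL2 f.
Proof.
move=> mf fM; have [] := cL2_dom mf (rint_cst P (M ^+ 2)) _ => //.
apply: filterS fM => x fM.
by rewrite ler_sqr ?nnegrE ?normc_ge0// (le_trans (normc_ge0 _) fM).
Qed.

(** The square of [e * a - b] is nonnegative. With its free weight the inequality stands in for
    Cauchy-Schwarz: it bounds products by squared norms without roots. *)
Lemma amgm (e : R) (a b : R) : 0 < e -> 0 <= a -> 0 <= b ->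
  a * b <= e * a ^+ 2 + e^-1 * b ^+ 2.
Proof.
move=> e0 a0 b0; have e1 : 0 < e^-1 by rewrite invr_gt0.
have ee : e * e^-1 = 1 by rewrite divff// gt_eqF.
have : 0 <= e^-1 * (e * a - b) ^+ 2 by rewrite mulr_ge0 ?sqr_ge0// ltW.
have -> : e^-1 * (e * a - b) ^+ 2 =
   (e * e^-1) * (e * a ^+ 2) - 2 * (e * e^-1) * (a * b) + e^-1 * b ^+ 2 by ring.
rewrite ee mul1r mulr1.
have := mulr_ge0 (ltW e0) (sqr_ge0 a); have := mulr_ge0 (ltW e1) (sqr_ge0 b).
by have := mulr_ge0 a0 b0; lra.
Qed.

Lemma cL2_prod (e : R) f g : 0 < e -> cL2 f -> cL2 g ->
  cL1 (fun x => f x * g x) /\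
  n1 (fun x => f x * g x) <= e * n2 f + e^-1 * n2 g.
Proof.
move=> e0 [mf i] [mg j].
have [] := cL1_dom (measurable_cM mf mg) (rintD (rintZ e i) (rintZ e^-1 j)) _.
  by apply: aeW => x; rewrite normcM amgm ?normc_ge0.
by rewrite RintD ?RintZ//; exact: rintZ.
Qed.

Lemma cL2_cL1M f g : cL2 f -> cL2 g -> cL1 (fun x => f x * g x).
Proof. by move=> hf hg; case: (cL2_prod ltr01 hf hg). Qed.

Lemma cL2_cL1 f : cL2 f -> cL1 f.
Proof.
move=> hf; have h1 : cL2 (fun=> 1).
  by apply: (@cL2_bounded _ 1) => //; apply: aeW => x; rewrite normc1.
have := cL2_cL1M hf h1; congr (cL1 _).
by apply/funext => x; rewrite mulr1.
Qed.

Lemma n2_eq0 f : cL2 f -> n2 f = 0 -> f = (fun=> 0) %[ae P].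
Proof.
move=> [mf i] h; have : \forall x \ae P, normc (f x) ^+ 2 = 0.
  by apply: Rint_eq0 => // x; exact: sqr_ge0.
apply: filterS => x /eqP; rewrite sqrf_eq0 => /eqP hx _.
exact: eq0_normc.
Qed.

Lemma n2_cvg_n1M (f_ : nat -> T -> R[i]) g : (forall n, cL2 (f_ n)) -> cL2 g ->
  n2 (f_ n) @[n --> \oo] --> 0 -> n1 (fun x => f_ n x * g x) @[n --> \oo] --> 0.
Proof.
move=> hf hg h; apply/cvgrPdist_le => e e0.
(* This weight makes the share of [g] at most [e / 2] whatever [n]; the share of [f_ n] is then
   small for large [n]. The [+ 1] covers [n2 g = 0]. *)
pose k := e / 2 / (n2 g + 1).
have g1 : 0 < n2 g + 1 by rewrite ltr_wpDl ?n2_ge0.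
have k0 : 0 < k by rewrite !divr_gt0.
have e' : 0 < e / 2 * k by rewrite mulr_gt0// divr_gt0.
move/cvgrPdist_le : h => /(_ _ e'); apply: filterS => n.
rewrite sub0r normrN ger0_norm ?n2_ge0// => hn.
rewrite sub0r normrN ger0_norm ?n1_ge0//.
have ki : 0 < k^-1 by rewrite invr_gt0.
have [_ le] := cL2_prod ki (hf n) hg; apply: le_trans le _.
rewrite invrK (splitr e); apply: lerD.
  by rewrite ler_pdivrMl// mulrC.
rewrite /k -[leLHS]mulrA ler_piMr ?divr_ge0 ?ltW//.
by rewrite mulrC ltr_pdivrMr// mul1r ltrDl.
Qed.

Lemma n2_cvg_Cint (f_ : nat -> T -> R[i]) f g : (forall n, cL2 (f_ n)) -> cL2 f -> cL2 g ->
  n2 (fun x => f_ n x - f x) @[n --> \oo] --> 0 ->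
  Cint (fun x => f_ n x * g x) @[n --> \oo] --> Cint (fun x => f x * g x).
Proof.
move=> hf_ hf hg h; apply: n1_cvg0_Cint.
- by move=> n; exact: cL2_cL1M.
- exact: cL2_cL1M.
- have := @n2_cvg_n1M (fun n x => f_ n x - f x) g (fun n => cL2B (hf_ n) hf) hg h.
  by under eq_fun do under eq_fun do rewrite mulrBl.
Qed.

(** If the minimum is not the product itself, then [normc y < k * normc x], and the first summand
    alone is at least the product. *)
Lemma weak_split (k : R) (x y : R[i]) : 0 < k ->
  normc (x * y) <= k * normc x ^+ 2 + Num.min (normc x * normc y) (k^-1 * normc y ^+ 2).
Proof.
move=> k0; rewrite normcM.
have a0 := normc_ge0 x; have b0 := normc_ge0 y.
set a := normc x in a0 *; set b := normc y in b0 *.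
have ka : 0 <= k * a ^+ 2 by rewrite mulr_ge0 ?sqr_ge0// ltW.
have [_|lt] := leP (a * b) (k^-1 * b ^+ 2); first by rewrite lerDr.
have kb : 0 <= k^-1 * b ^+ 2 by rewrite mulr_ge0 ?sqr_ge0// invr_ge0 ltW.
suff : a * b <= k * a ^+ 2 by lra.
move: lt; rewrite ltr_pdivrMl// => lt.
have [b1|b1] := leP b (k * a); first by nra.
by nra.
Qed.

(* [|h| |f| <= e |h|^2 + min (|h| |f|, |f|^2 / e)]: the second summand tends to
   [0] by dominated convergence. *)
Lemma bounded_cvg_weak (h_ : nat -> T -> R[i]) f (M : R) :
  (forall n, cL2 (h_ n)) -> (forall n, n2 (h_ n) <= M) ->
  (\forall x \ae P, h_ ^~ x @ \oo --> (0 : R[i])) -> cL2 f ->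
  n1 (fun x => h_ n x * f x) @[n --> \oo] --> 0.
Proof.
move=> hL2 hM h0 hf; apply/cvgrPdist_le => e e0.
have M0 : 0 <= M by apply: le_trans (hM 0%N); exact: n2_ge0.
have M1 : 0 < M + 1 by rewrite ltr_wpDl.
pose k := e / 2 / (M + 1).
have k0 : 0 < k by rewrite !divr_gt0.
pose w n x := Num.min (normc (h_ n x) * normc (f x)) (k^-1 * normc (f x) ^+ 2).
have mw n : measurable_fun [set: T] (w n).
  apply: measurable_minr; first apply: measurable_funM.
  - exact: measurable_normc (hL2 n).1.
  - exact: measurable_normc hf.1.
  - by apply: measurable_funM => //; exact: measurable_normc2 hf.1.
have ki : 0 <= k^-1 by rewrite invr_ge0 ltW.
have w0 n x : 0 <= w n x by rewrite le_min !mulr_ge0 ?normc_ge0 ?sqr_ge0.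
have m0 : measurable_fun [set: T] (fun=> 0 : R) by exact: measurable_cst.
have iv := rintZ k^-1 hf.2.
have wcvg : \forall x \ae P, w ^~ x @ \oo --> (0 : R).
  apply: filterS h0 => x /normc_cvgP.
  under eq_fun do rewrite subr0.
  move=> hx.
  have hx2 : normc (h_ n x) * normc (f x) @[n --> \oo] --> (0 : R).
    by rewrite -[X in _ --> X](mul0r (normc (f x))); apply: cvgMl.
  apply: (squeeze_cvgr _ (cvg_cst 0) hx2); apply: nearW => n.
  by rewrite w0 ge_min lexx.
have wle : \forall x \ae P, forall n, `|w n x| <= k^-1 * normc (f x) ^+ 2.
  by apply: aeW => x n; rewrite ger0_norm// ge_min lexx orbT.
have [_] := Rint_dct mw m0 wcvg iv wle; rewrite Rint_cst => /cvgrPdist_le.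
have e2 : 0 < e / 2 by rewrite divr_gt0.
move=> /(_ _ e2); apply: filterS => n.
rewrite !sub0r !normrN (ger0_norm (Rint_ge0 _ (w0 n))) (ger0_norm (n1_ge0 _ _)) => hn.
have iw : rint P (w n).
  by have [] := rint_dom (mw n) (w0 n) iv (aeW _ (fun x => _)) => // x; rewrite ge_min lexx orbT.
have ih := rintZ k (hL2 n).2.
have [_ le] := cL1_dom (measurable_cM (hL2 n).1 hf.1) (rintD ih iw) (aeW _ (fun x =>
  weak_split (h_ n x) (f x) k0)).
apply: le_trans le _; rewrite (RintD ih iw) (RintZ k (hL2 n).2) (splitr e); apply: lerD => //.
rewrite (@le_trans _ _ (k * M))//; first by apply: ler_wpM2l; [exact: ltW|exact: hM].
rewrite /k -[leLHS]mulrA ler_piMr ?divr_ge0 ?ltW//.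
by rewrite mulrC ltr_pdivrMr// mul1r ltrDl.
Qed.


End square_integrable.

(** * Completeness of L2 *)

Section completeness.
Context d (T : measurableType d) {R : realType} (P : probability T R).
Implicit Types f g h : T -> R[i].
Local Notation cL2 := (cL2 P).
Local Notation n2 := (n2 P).
Local Notation Cint := (Cint P).

Lemma nneseries_lty_is_cvg (u : nat -> R) : (forall n, 0 <= u n) ->
  (\sum_(n <oo) (u n)%:E < +oo)%E -> cvgn (series u).
Proof.
move=> u0 h; apply: nondecreasing_is_cvgn.
  by apply: nondecreasing_series => n _ _; exact: u0.
exists (fine (\sum_(n <oo) (u n)%:E)) => _ [n _ <-].
rewrite -lee_fin fineK; last first.
  by rewrite ge0_fin_numE// nneseries_ge0// => k _ _; rewrite lee_fin.
rewrite /series /= -sumEFin.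
by apply: nneseries_lim_ge => k _; rewrite lee_fin.
Qed.

Lemma cvgn_of_abs_increments (u v : nat -> R) :
  (forall n, `|v n.+1 - v n| <= u n) -> cvgn (series u) -> cvgn v.
Proof.
move=> vu cu; have c : cvgn (series (fun n => v n.+1 - v n)).
  apply: normed_cvg; apply: series_le_cvg cu => n //=.
  exact: le_trans (vu n).
have -> : v = (fun n => v 0%N + series (fun n => v n.+1 - v n) n).
  by apply/funext => n; rewrite seriesEnat /= telescope_sumr// addrC subrK.
by apply: is_cvgD => //; exact: is_cvg_cst.
Qed.

Lemma series_half (n : nat) : \sum_(0 <= k < n) (2^-1 : R) ^+ k <= 2.
Proof.
have E : \sum_(0 <= k < n) (2^-1 : R) ^+ k = 2 - 2 * 2^-1 ^+ n.
  elim: n => [|n ih]; first by rewrite big_geq// expr0 mulr1 subrr.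
  by rewrite big_nat_recr//= ih exprS; field.
by rewrite E gerBl mulr_ge0// exprn_ge0// invr_ge0.
Qed.

(** The moduli of the increments have integrals of sum at most 4, so their sum is finite almost
    everywhere, and there the sequence converges by telescoping. *)
Lemma ae_fast_cauchy (f_ : nat -> T -> R[i]) : (forall n, cL2 (f_ n)) ->
  (forall n, n2 (fun x => f_ n.+1 x - f_ n x) <= (4^-1) ^+ n) ->
  exists f, measurable_fun [set: T] f /\ \forall x \ae P, f_ ^~ x @ \oo --> f x.
Proof.
move=> hL2 hn; pose D n x := normc (f_ n.+1 x - f_ n x).
have mD n : measurable_fun [set: T] (D n).
  by apply: measurable_normc; apply: measurable_cB; exact: (hL2 _).1.
have mDE n : measurable_fun [set: T] (fun x => (D n x)%:E) by exact/measurable_EFinP.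
have D0 n x : 0 <= D n x by exact: normc_ge0.
have D0E n x : (0 <= (D n x)%:E)%E by rewrite lee_fin.
pose S x := (\sum_(n <oo) (D n x)%:E)%E.
have mS : measurable_fun [set: T] S by apply: ge0_emeasurable_sum => //.
have intD n : (\int[P]_x (D n x)%:E <= (2^-1 ^+ n * 2)%:E)%E.
  have one : cL2 (fun=> 1).
    by apply: (@cL2_bounded _ _ _ _ _ 1) => //; apply: aeW => x; rewrite normc1.
  (* The weight [2 ^+ n] balances [4^-1 ^+ n] against the squared norm 1 of the constant function:
     both terms become at most [2^-1 ^+ n]. *)
  have p0 : 0 < 2 ^+ n :> R by rewrite exprn_gt0.
  have hB := cL2B (hL2 n.+1) (hL2 n).
  have [h1 le] := cL2_prod p0 hB one.
  have E : (fun x => (f_ n.+1 x - f_ n x) * 1) = (fun x => f_ n.+1 x - f_ n x).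
    by apply/funext => x; rewrite mulr1.
  rewrite E in h1 le; rewrite -(EFin_rint h1.2) lee_fin (le_trans le)//.
  rewrite mulr2n mulrDr mulr1 exprVn; apply: lerD.
    rewrite -ler_pdivlMl// (le_trans (hn n))// -exprVn -exprMn.
    by rewrite (_ : 4^-1 = 2^-1 * 2^-1 :> R)//; field.
  rewrite -[leRHS]mulr1 ler_pM2l ?invr_gt0//.
  have : n2 (fun=> 1) = 1 by rewrite /n2 normc1 expr1n Rint_cst.
  by move=> ->.
have intS : (\int[P]_x S x < +oo)%E.
  rewrite integral_nneseries//.
  apply: (@le_lt_trans _ _ 4%:E); last exact: ltry.
  apply: (@le_trans _ _ (\sum_(n <oo) (2^-1 ^+ n * 2)%:E)%E).
    by apply: lee_nneseries => n _; rewrite ?integral_ge0.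
  apply: lime_le; first by apply: is_cvg_nneseries => n _ _; rewrite lee_fin mulr_ge0// exprn_ge0// invr_ge0.
  apply: nearW => n; rewrite sumEFin lee_fin -mulr_suml.
  by have := series_half n; lra.
pose E := [set x | (S x < +oo)%E].
have mE : measurable E by rewrite -[E]setTI; exact: emeasurable_fun_infty_o.
have aeE : \forall x \ae P, E x.
  have iS : P.-integrable [set: T] S.
    apply/integrableP; split=> //; under eq_integral do rewrite gee0_abs ?nneseries_ge0//.
    by [].
  apply: filterS (integrable_ae measurableT iS) => x /(_ Logic.I).
  by rewrite ge0_fin_numE// nneseries_ge0.
have cE x : E x -> cvgn (fun n => complex.Re (f_ n x)) /\ cvgn (fun n => complex.Im (f_ n x)).
  move=> Ex; have := nneseries_lty_is_cvg (fun n => D0 n x) Ex.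
  by move=> cD; split; apply: (cvgn_of_abs_increments _ cD) => n /=;
   rewrite -?cReN -?cReD -?cImN -?cImD ?normr_Re ?normr_Im.
pose f x := if x \in E then
  limn (fun n => complex.Re (f_ n x)) +i* limn (fun n => complex.Im (f_ n x)) else 0.
(* Cutting off to the measurable set [E] makes the sequence converge at every point, as
   [measurable_ccvg] asks. *)
pose g_ n x := if x \in E then f_ n x else 0.
have gf x : g_ ^~ x @ \oo --> f x.
  rewrite /g_ /f; case: ifPn => [|_]; last exact: cvg_cst.
  by rewrite inE => /cE[c1 c2]; apply: cvgc_ReIm.
have mg n : measurable_fun [set: T] (g_ n).
  have -> : g_ n = (fun x => f_ n x * (\1_E x)%:C).
    by apply/funext => x; rewrite /g_ indicE; case: ifPn => _; rewrite ?mulr1 ?mulr0.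
  apply: measurable_cM; first exact: (hL2 n).1.
  by apply: measurable_realc; exact: measurable_indic.
exists f; split; first exact: measurable_ccvg mg gf.
apply: filterS aeE => x Ex; have := gf x; rewrite /g_ mem_set//.
Qed.

(** For fixed [m], Fatou's lemma passes to the limit in [f_ n - f_ m] and keeps the bound
    [4^-1 ^+ m]. A geometric rate is assumed rather than a bare Cauchy condition because the
    minimizing sequence below can be chosen that fast. *)
Lemma L2_complete (f_ : nat -> T -> R[i]) : (forall n, cL2 (f_ n)) ->
  (forall m n, (m <= n)%N -> n2 (fun x => f_ n x - f_ m x) <= (4^-1) ^+ m) ->
  exists f, cL2 f /\ n2 (fun x => f_ n x - f x) @[n --> \oo] --> 0.
Proof.
move=> hL2 hn; have [f [mf fcvg]] := ae_fast_cauchy hL2 (fun n => hn n n.+1 (leqnSn n)).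
have key m : cL2 (fun x => f x - f_ m x) /\ n2 (fun x => f x - f_ m x) <= (4^-1) ^+ m.
  have mB : measurable_fun [set: T] (fun x => f x - f_ m x).
    by apply: measurable_cB => //; exact: (hL2 m).1.
  have [] := @Rint_fatou _ _ _ P (fun n x => normc (f_ n x - f_ m x) ^+ 2)
    (fun x => normc (f x - f_ m x) ^+ 2) (4^-1 ^+ m).
  - by move=> n; exact: (cL2B (hL2 n) (hL2 m)).2.
  - by move=> n x; exact: sqr_ge0.
  - exact: measurable_normc2.
  - by move=> x; exact: sqr_ge0.
  - apply: filterS fcvg => x /normc_cvgP hx.
    have h : normc (f_ n x - f_ m x) @[n --> \oo] --> normc (f x - f_ m x).
      apply: cvg_normc; apply/normc_cvgP.
      by under eq_fun do rewrite opprB addrA subrK.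
    exact: (cvgM h h).
  - by exists m => // n /= mn; exact: hn.
  by [].
exists f; split.
  have := cL2D (key 0%N).1 (hL2 0%N); congr (cL2 _).
  by apply/funext => x; rewrite subrK.
apply: (squeeze_cvgr _ (cvg_cst 0) (@cvg_geometric R 1 4^-1 _)).
- apply: nearW => n; rewrite n2_ge0 /= mul1r.
  have -> : n2 (fun x => f_ n x - f x) = n2 (fun x => f x - f_ n x).
    by congr (Rintegral _ _ _); apply/funext => x; rewrite normcBC.
  exact: (key n).2.
- by rewrite ger0_norm ?invr_ge0// invf_lt1 ?ltr1n.
Qed.

Lemma sqr_normcB (x y : R[i]) : normc (x - y) ^+ 2 =
  normc x ^+ 2 - 2 * @complex.Re R (x * conjc y) + normc y ^+ 2.
Proof. by rewrite !normc_sqr cReM cReD cImD cReN cImN; case: x => a b; case: y => c e /=; ring. Qed.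

Lemma n2B f g : cL2 f -> cL2 g -> n2 (fun x => f x - g x) =
  n2 f - 2 * complex.Re (Cint (fun x => f x * conjc (g x))) + n2 g.
Proof.
move=> hf hg; have hfg := cL2_cL1M hf (cL2_conj hg).
rewrite /n2 /= -RintZ; last exact: cL1_Re.
rewrite -RintB; [|exact: hf.2|by apply: rintZ; exact: cL1_Re].
rewrite -RintD; [|apply: rintB; [exact: hf.2|by apply: rintZ; exact: cL1_Re]|exact: hg.2].
by apply: eq_Rintegral => x _; rewrite sqr_normcB.
Qed.

Lemma parallelogram f g : cL2 f -> cL2 g ->
  n2 (fun x => f x - g x) = 2 * n2 f + 2 * n2 g - 4 * n2 (fun x => 2^-1 * (f x + g x)).
Proof.
move=> hf hg; have hD := cL2D hf hg; have [_ ->] := cL2Z 2^-1 hD.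
have -> : normc (2^-1 : R[i]) = 2^-1.
  by rewrite normcV -[2]/(2%:R) -(rmorph_nat (real_complex R)) normc_real ger0_norm.
rewrite mulrA (_ : 4 * 2^-1 ^+ 2 = 1 :> R); last by field.
rewrite mul1r; have -> : n2 (fun x => f x + g x) = n2 (fun x => f x - (- g x)).
  by congr (Rintegral _ _ _); apply/funext => x; rewrite opprK.
have hN := cL2N hg; rewrite !n2B//.
have -> : n2 (fun x => - g x) = n2 g.
  by congr (Rintegral _ _ _); apply/funext => x; rewrite normcNc.
have -> : Cint (fun x => f x * conjc (- g x)) = - Cint (fun x => f x * conjc (g x)).
  rewrite -mulN1r -CintZ; last exact: cL2_cL1M (cL2_conj hg).
  by congr Cint; apply/funext => x; rewrite rmorphN mulrN mulN1r.
by rewrite cReN; ring.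
Qed.

End completeness.

(** * Nearest points and orthogonality *)

Section projection.
Context d (T : measurableType d) {R : realType} (P : probability T R).
Local Notation cL2 := (cL2 P).
Local Notation n2 := (n2 P).
Local Notation Cint := (Cint P).

(** The value [c = a n / (N + 1)] gives [normc (a n) ^+ 2 <= (N + 1) * e n]. In [L2_projection],
    [a n] is the inner product of the n-th error with [s], and the hypothesis says that a correction
    by [c * s] cannot bring the squared distance below the infimum, reached up to [e n]. *)
Lemma vanishing_of_quadratic (a : nat -> R[i]) (N : R) (e : nat -> R) : 0 <= N ->
  e @ \oo --> (0 : R) ->
  (forall n (c : R[i]), 2 * complex.Re (conjc c * a n) <= normc c ^+ 2 * N + e n) ->
  a @ \oo --> (0 : R[i]).
Proof.
move=> N0 he h; pose t := (N + 1)^-1.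
have N1 : 0 < N + 1 by rewrite ltr_wpDl.
have t0 : 0 < t by rewrite invr_gt0.
have le n : t * normc (a n) ^+ 2 <= e n.
  have := h n (t%:C * a n).
  have -> : conjc (t%:C * a n) * a n = (t * normc (a n) ^+ 2)%:C.
    by rewrite conjcM conjc_real -mulrA [conjc _ * _]mulrC mulc_conj -realcM.
  rewrite normcM normc_real (ger0_norm (ltW t0)) exprMn [complex.Re _]/= => hn.
  have q0 := sqr_ge0 (normc (a n)).
  have tN : t * N <= 1 by rewrite mulrC ler_pdivrMr// mul1r lerDl.
  have : t ^+ 2 * normc (a n) ^+ 2 * N <= t * normc (a n) ^+ 2.
    rewrite (_ : _ * N = (t * normc (a n) ^+ 2) * (t * N)); last by ring.
    by rewrite ler_piMr// mulr_ge0// ltW.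
  by lra.
apply/normc_cvgP; under eq_fun do rewrite subr0.
apply/cvgrPdist_lt => eps eps0.
have te : 0 < t * eps ^+ 2 by rewrite mulr_gt0// exprn_gt0.
move/cvgrPdist_lt : he => /(_ _ te); apply: filterS => n.
rewrite !sub0r !normrN (ger0_norm (normc_ge0 _)) => hn.
rewrite -ltr_sqr ?nnegrE ?normc_ge0 ?ltW// -(ltr_pM2l t0).
by apply: le_lt_trans (le n) _; apply: le_lt_trans (ler_norm _) hn.
Qed.

(** A minimizing sequence is Cauchy by the parallelogram law, and varying it along [s] gives
    orthogonality. [S] is not assumed closed, so [phi] need not lie in it; the approximating [s_]
    are returned as well, since they carry the algebraic structure of [S]. *)
Lemma L2_projection (S : set (T -> R[i])) (x : T -> R[i]) :
  S !=set0 -> S `<=` cL2 -> cL2 x ->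
  (forall s t, S s -> S t -> S (fun z => s z + t z)) ->
  (forall (c : R[i]) s, S s -> S (fun z => c * s z)) ->
  exists phi (s_ : nat -> T -> R[i]), [/\ cL2 phi, forall n, S (s_ n),
    n2 (fun z => s_ n z - phi z) @[n --> \oo] --> 0 &
    forall s, S s -> Cint (fun z => (x z - phi z) * conjc (s z)) = 0].
Proof.
move=> [s0 Ss0] SL2 xL2 SD SZ.
pose E := [set n2 (fun z => x z - s z) | s in S].
have hE : has_inf E.
  split; first by exists (n2 (fun z => x z - s0 z)), s0.
  by exists 0 => _ [s _ <-]; exact: n2_ge0.
have infE s : S s -> inf E <= n2 (fun z => x z - s z).
  by move=> Ss; apply: ge_inf; [exact: hE.2|exists s].
(* For [m <= n] the parallelogram law bounds the squared distance of two near-minimizers by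
   [2 * e m + 2 * e n <= 4 * e m]; hence the division by 4. *)
pose e n : R := 4^-1 ^+ n / 4.
have e0 n : 0 < e n by rewrite divr_gt0// exprn_gt0// invr_gt0.
have /choice[s_ hs_] : forall n, exists s, S s /\ n2 (fun z => x z - s z) < inf E + e n.
  by move=> n; have [_ [s Ss <-] h] := inf_adherent (e0 n) hE; exists s.
have sL2 n : cL2 (s_ n) by apply: SL2; exact: (hs_ n).1.
have cauchy m n : (m <= n)%N -> n2 (fun z => s_ n z - s_ m z) <= 4^-1 ^+ m.
  move=> mn; have -> : n2 (fun z => s_ n z - s_ m z) =
      n2 (fun z => (x z - s_ m z) - (x z - s_ n z)).
    by congr (Rintegral _ _ _); apply/funext => z; congr (normc _ ^+ 2); ring.
  rewrite parallelogram; [|exact: cL2B|exact: cL2B].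
  have := infE (fun z => 2^-1 * (s_ m z + s_ n z)).
  have -> : n2 (fun z => x z - 2^-1 * (s_ m z + s_ n z)) =
      n2 (fun z => 2^-1 * (x z - s_ m z + (x z - s_ n z))).
    by congr (Rintegral _ _ _); apply/funext => z; congr (normc _ ^+ 2); field.
  move=> /(_ (SZ _ _ (SD _ _ (hs_ m).1 (hs_ n).1))).
  have := (hs_ m).2; have := (hs_ n).2.
  have : e n <= e m.
    by rewrite ler_pM2r ?invr_gt0//; apply: ler_wiXn2l; rewrite ?invr_ge0// invf_le1// ler1n.
  have -> : 4^-1 ^+ m = 4 * e m by rewrite /e mulrC divfK.
  by lra.
have [phi [pL2 hphi]] := L2_complete sL2 cauchy.
exists phi, s_; split=> //; first by move=> n; exact: (hs_ n).1.
move=> s Ss; have sl2 := SL2 _ Ss.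
have ecvg : e @ \oo --> (0 : R).
  have g0 : geometric (1 : R) 4^-1 @ \oo --> (0 : R).
    by apply: cvg_geometric; rewrite ger0_norm ?invr_ge0// invf_lt1 ?ltr1n.
  have -> : e = (fun n => geometric 1 4^-1 n * 4^-1).
    by apply/funext => n; rewrite /geometric /= mul1r.
  rewrite -[X in _ --> X](mul0r (4^-1 : R)); apply: cvgM g0 _; exact: cvg_cst.
have a0 : Cint (fun z => (x z - s_ n z) * conjc (s z)) @[n --> \oo] --> (0 : R[i]).
  apply: (vanishing_of_quadratic (n2_ge0 P s) ecvg) => n c.
  have [hc nc] := cL2Z c sl2.
  have hxs := cL2B xL2 (sL2 n).
  have := infE _ (SD _ _ (hs_ n).1 (SZ c _ Ss)).
  have -> : n2 (fun z => x z - (s_ n z + c * s z)) =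
      n2 (fun z => (x z - s_ n z) - c * s z).
    by congr (Rintegral _ _ _); apply/funext => z; congr (normc _ ^+ 2); ring.
  rewrite n2B// nc.
  have -> : Cint (fun z => (x z - s_ n z) * conjc (c * s z)) =
     conjc c * Cint (fun z => (x z - s_ n z) * conjc (s z)).
    rewrite -CintZ; last exact: cL2_cL1M (cL2_conj sl2).
    by congr Cint; apply/funext => z; rewrite conjcM; ring.
  by have := (hs_ n).2; lra.
have := @n2_cvg_Cint _ _ _ P (fun n z => x z - s_ n z) (fun z => x z - phi z)
  (fun z => conjc (s z)) _ (cL2B xL2 pL2) (cL2_conj sl2).
move=> H; apply/esym; apply: (cvgc_unique a0); apply: H.
  by move=> n; exact: cL2B.
rewrite (_ : (fun n => _) = (fun n => n2 (fun z => s_ n z - phi z)))//.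
apply/funext => n; congr (Rintegral _ _ _); apply/funext => z.
by rewrite -normcNc; congr (normc _ ^+ 2); ring.
Qed.

End projection.

(** * The circle *)

Section circle_parametrization.
Context {R : realType}.
Local Notation expi := (@expi R).

Lemma normc_expi t : normc (expi t) = 1.
Proof.
by apply/eqP; rewrite -(@eqrXn2 _ 2) ?normc_ge0// normc_sqr /= cos2Dsin2 expr1n.
Qed.

Lemma expiD s t : expi (s + t) = expi s * expi t.
Proof.
by apply: complex_eqP; rewrite ?cReM ?cImM /= mulrDr ?cosD ?sinD// addrC.
Qed.

Lemma expiX n t : expi t ^+ n = expi (n%:R * t).
Proof.
elim: n => [|n ih].
  by rewrite expr0 mul0r /Defs.expi mulr0 cos0 sin0.
by rewrite exprS ih -expiD -natr1 mulrDl mul1r addrC.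
Qed.

Lemma conjc_expi t : conjc (expi t) = expi (- t).
Proof. by rewrite /Defs.expi /= mulrN cosN sinN. Qed.

(** [acos] gives the angle on the upper half of the circle; a negative imaginary part is reached by
    the reflection [t] to [1 - t]. *)
Lemma expi_surj (z : R[i]) : normc z = 1 -> exists2 t, 0 <= t <= 1 & expi t = z.
Proof.
move=> z1; have z2 : complex.Re z ^+ 2 + complex.Im z ^+ 2 = 1 by rewrite -normc_sqr z1 expr1n.
have Re1 : -1 <= complex.Re z <= 1 by rewrite -ler_norml -z1 normr_Re.
pose a := acos (complex.Re z).
have a0 : 0 <= a := acos_ge0 Re1.
have api : a <= pi := acos_lepi Re1.
have ca : cos a = complex.Re z by rewrite acosK// in_itv.
have sa : sin a ^+ 2 = complex.Im z ^+ 2.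
  by rewrite sin2cos2 ca -z2 addrC addKr.
have sa0 : 0 <= sin a by apply: sin_ge0_pi; rewrite a0.
have pi2 : 0 < 2 * pi :> R by rewrite mulr_gt0// pi_gt0.
have E b : 2 * pi * (b / (2 * pi)) = b :> R by rewrite mulrC divfK// gt_eqF.
have [i0|i0] := leP 0 (complex.Im z).
- exists (a / (2 * pi)).
    rewrite divr_ge0 ?(ltW pi2)//= ler_pdivrMr// mul1r.
    by have := pi_ge0 R; lra.
  apply: complex_eqP; rewrite /= E// .
  by apply/eqP; rewrite -(@eqrXn2 _ 2)// sa.
- exists (1 - a / (2 * pi)).
    have : 0 <= a / (2 * pi) by rewrite divr_ge0 ?(ltW pi2).
    have : a / (2 * pi) <= 1 by rewrite ler_pdivrMr// mul1r; have := pi_ge0 R; lra.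
    by lra.
  have e2 : 2 * pi * (1 - a / (2 * pi)) = - a + pi *+ 2.
    by rewrite mulrBr E mulr1 mulr_natl addrC.
  apply: complex_eqP; rewrite /= e2 ?cosD2pi ?sinD2pi ?cosN ?sinN//.
  apply/eqP; rewrite eqr_oppLR -(@eqrXn2 _ 2) ?sqrrN ?sa//.
  by rewrite oppr_ge0 ltW.
Qed.

Lemma sqr_expiB s t : normc (expi s - expi t) ^+ 2 = 4 * sin (pi * (s - t)) ^+ 2.
Proof.
rewrite sqr_normcB !normc_expi conjc_expi -expiD expr1n.
rewrite [complex.Re _]/= (_ : 2 * pi * (s - t) = (pi * (s - t)) *+ 2).
  by rewrite cos_mulr2n sin2cos2; ring.
rewrite -mulr_natr; ring.
Qed.

Lemma ler_cos (x y : R) : 0 <= x -> x <= y -> y <= pi -> cos y <= cos x.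
Proof.
move=> x0; rewrite le_eqVlt => /predU1P[->//|xy] ypi.
by rewrite ltW// ltr_cos// in_itv/= ?x0 ?ypi ?(le_trans x0 (ltW xy)) ?(le_trans (ltW xy)).
Qed.

Lemma sin_ge_cos1 (x : R) : 0 <= x <= 1 -> cos 1 * x <= sin x.
Proof.
move=> /andP[]; rewrite le_eqVlt => /predU1P[<-|x0 x1]; first by rewrite sin0 mulr0.
have [c] := @MVT _ sin cos 0 x x0 (fun y _ => is_derive_sin y)
  (continuous_subspaceT (@continuous_sin R)).
rewrite in_itv/= => /andP[c0 cx]; rewrite sin0 !subr0 => ->.
rewrite ler_pM2r//; apply: ler_cos => //; first exact: ltW.
  by rewrite ltW// (lt_le_trans cx).
by apply: le_trans (pi_ge2 R); rewrite ler1n.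
Qed.

(* From [sin y = 4 sin (y / 4) cos (y / 4) cos (y / 2)]. *)
Lemma sin_ge_linear (d : R) : 0 < d <= pi ->
  exists2 c, 0 < c & forall y, 0 <= y <= pi - d -> c * y <= sin y.
Proof.
move=> /andP[d0 dpi].
have s0 : 0 < sin (d / 2) by apply: sin_gt0_pi; have := pi_gt0 R; lra.
have c0 := cos1_gt0 R.
exists (cos 1 ^+ 2 * sin (d / 2)); first by rewrite mulr_gt0// exprn_gt0.
move=> y /andP[y0 yd].
have p2 := pihalf_lt2 R.
have y4 : 0 <= y / 4 <= 1 by lra.
have -> : sin y = 4 * sin (y / 4) * cos (y / 4) * cos (y / 2).
  rewrite {1}(_ : y = y / 2 + y / 2); last by field.
  rewrite sinD {1 4}(_ : y / 2 = y / 4 + y / 4); last by field.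
  rewrite sinD; ring.
have h1 := sin_ge_cos1 y4.
have h2 : cos 1 <= cos (y / 4).
  by apply: ler_cos; have := pi_ge2 R; lra.
have h3 : sin (d / 2) <= cos (y / 2).
  rewrite -cosBpihalf -cosN opprB; apply: ler_cos; have := pi_ge2 R; lra.
have -> : cos 1 ^+ 2 * sin (d / 2) * y = 4 * (cos 1 * (y / 4)) * cos 1 * sin (d / 2).
  by field.
have q : 0 <= cos 1 * (y / 4) by apply: mulr_ge0; [exact: ltW|case/andP: y4].
apply: ler_pM => //; [|exact: ltW|].
  by rewrite !mulr_ge0// ltW.
apply: ler_pM => //; [by rewrite mulr_ge0|exact: ltW|].
by rewrite ler_pM2l.
Qed.

(** The parameters 0 and 1 give the same point of the circle, so no linear lower bound can hold when
    [t] is an endpoint. For [t] inside, [|s - t|] stays at most [1 - k], away from the second zero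
    of [sin (pi * x)]. *)
Lemma expiB_ge t : 0 < t < 1 -> exists2 c, 0 < c <= 2 &
  forall s, 0 <= s <= 1 -> c * `|s - t| <= normc (expi s - expi t).
Proof.
move=> /andP[t0 t1]; pose k := Num.min t (1 - t).
have k0 : 0 < k by rewrite lt_min t0 subr_gt0.
have p0 := pi_gt0 R.
have kt : k <= t by rewrite ge_min lexx.
have kt1 : k <= 1 - t by rewrite ge_min lexx orbT.
have [|c c0 hc] := @sin_ge_linear (pi * k).
  rewrite mulr_gt0//= -[leRHS]mulr1 ler_pM2l//.
  by apply: le_trans kt _; exact: ltW.
(* The cap 2 is for [poisson_expi_le], where the constant also multiplies [1 - r] and the product is
   compared with twice a distance. *)
exists (Num.min c 2); first by rewrite lt_min c0 ltr0n /= ge_min lexx orbT.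
move=> s /andP[s0 s1].
have st : `|s - t| <= 1 - k by rewrite ler_norml; lra.
have := hc (pi * `|s - t|); rewrite mulr_ge0 ?(ltW p0)//=.
rewrite -{2}(mulr1 pi) -mulrBr ler_pM2l// => /(_ st) hs.
have h2 : `|sin (pi * (s - t))| = sin (pi * `|s - t|).
  have sp : 0 <= sin (pi * `|s - t|).
    by apply: le_trans hs; rewrite !mulr_ge0// ltW.
  move: sp; case: (ger0P (s - t)) => _; first by move=> ?; rewrite ger0_norm.
  by rewrite mulrN sinN => ?; rewrite -normrN ger0_norm.
rewrite -ler_sqr ?nnegrE ?normc_ge0//; last first.
  by rewrite mulr_ge0// le_min ltW// ler0n.
rewrite sqr_expiB -(real_normK (num_real (sin _))) h2.
have -> : 4 * sin (pi * `|s - t|) ^+ 2 = (2 * sin (pi * `|s - t|)) ^+ 2 :> R.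
  by rewrite exprMn; congr (_ * _); ring.
have h3 : c * `|s - t| <= c * (pi * `|s - t|).
  rewrite ler_pM2l// -[leLHS]mul1r ler_wpM2r//.
  by apply: le_trans (pi_ge2 R); rewrite ler1n.
have h4 : Num.min c 2 * `|s - t| <= c * `|s - t| by rewrite ler_wpM2r// ge_min lexx.
have h5 : 0 <= Num.min c 2 * `|s - t| by rewrite mulr_ge0// le_min ltW// ler0n.
rewrite ler_sqr ?nnegrE//; lra.
Qed.

End circle_parametrization.

(** * Transfer of integrals and null sets between the circle and the unit interval *)

Section restricted_integral.
Context d (T : measurableType d) {R : realType} (mu : {measure set T -> \bar R}).
Local Open Scope ereal_scope.

Lemma ge0_integral_mrestr (D : set T) (mD : measurable D) (f : T -> \bar R) :
  measurable_fun [set: T] f -> (forall x, 0 <= f x) ->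
  \int[mrestr mu mD]_x f x = \int[mu]_(x in D) f x.
Proof.
move=> mf f0; have mC := measurableC mD.
have D0 : mrestr mu mD (~` D) = 0 by rewrite /mrestr setICl measure0.
rewrite (ge0_negligible_integral mC measurableT mf _ D0)//.
rewrite setTD setCK; apply: eq_measure_integral => A mA AD.
exact: (congr1 mu (setIidl AD)).
Qed.

End restricted_integral.

Section circle_measure_facts.
Context {R : realType}.
Local Notation expi := (@expi R).
Local Notation circ := (@circle_measure R).
Local Notation leb := (@lebesgue_measure R).

Lemma ge0_integral_circle (f : R[i] -> \bar R) : measurable_fun [set: R[i]] f ->
  (forall z, 0 <= f z)%E ->
  (\int[circ]_z f z = \int[leb]_(t in `[0%R, 1%R]) f (expi t))%E.
Proof.
move=> mf f0; rewrite ge0_integral_pushforward//; last exact: measurable_expi.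
rewrite preimage_setT ge0_integral_mrestr//.
  by apply: measurableT_comp => //; exact: measurable_expi.
by move=> t; exact: f0.
Qed.

(** The change of variables is made for nonnegative functions, hence the split into positive and
    negative parts. *)
Lemma rint_circle (u : R[i] -> R) : rint circ u ->
  leb.-integrable `[0, 1] (fun t => (u (expi t))%:E) /\
  \int[circ]_z u z = \int[leb]_(t in `[0, 1]) u (expi t).
Proof.
move=> iu; have mu := rint_meas iu.
have mue : measurable_fun [set: R] (fun t => u (expi t)).
  by apply: measurableT_comp => //; exact: measurable_expi.
have iue : leb.-integrable `[0, 1] (fun t => (u (expi t))%:E).
  apply/integrableP; split; first by apply: measurable_funTS; exact/measurable_EFinP.
  case/integrableP : iu => _; rewrite ge0_integral_circle//.
  by do 2 apply: measurableT_comp => //; exact/measurable_EFinP.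
split=> //.
have ipos : rint circ (fun z => Num.max (u z) 0) by exact: (integrable_funrpos measurableT iu).
have ineg : rint circ (fun z => Num.max (- u z) 0) by exact: (integrable_funrneg measurableT iu).
have split_u (x : R) : x = Num.max x 0 - Num.max (- x) 0.
  by rewrite !maxEle oppr_le0; case: (lerP x 0) => h; case: (lerP 0 x) => h'; lra.
transitivity (\int[circ]_z Num.max (u z) 0 - \int[circ]_z Num.max (- u z) 0).
  by rewrite -RintB//; apply: eq_Rintegral => z _; exact: split_u.
have ge0 (v : R[i] -> R) : rint circ v -> (forall z, 0 <= v z) ->
    leb.-integrable `[0, 1] (fun t => (v (expi t))%:E) /\
    \int[circ]_z v z = \int[leb]_(t in `[0, 1]) v (expi t).
  move=> iv v0; have E : (\int[circ]_z (v z)%:E = \int[leb]_(t in `[0%R, 1%R]) (v (expi t))%:E)%E.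
    rewrite ge0_integral_circle//.
    by apply/measurable_EFinP; exact: rint_meas iv.
  split; last by rewrite /Rintegral E.
  apply/integrableP; split.
    apply: measurable_funTS; apply/measurable_EFinP.
    by apply: measurableT_comp; [exact: rint_meas iv|exact: measurable_expi].
  under eq_integral do rewrite gee0_abs ?lee_fin//.
  by rewrite -E; exact: integrable_lty.
have [i1 ->] := ge0 _ ipos (fun z => ltac:(by rewrite le_max lexx orbT)).
have [i2 ->] := ge0 _ ineg (fun z => ltac:(by rewrite le_max lexx orbT)).
rewrite -RintegralB//; apply: eq_Rintegral => t _; exact/esym/split_u.
Qed.

Lemma ae_normc_circle : \forall z \ae circ, normc z = 1.
Proof.
have mn : measurable_fun [set: R[i]] (@normc R) by exact: measurable_normc.
exists (@normc R @^-1` (~` [set 1])); split.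
- rewrite -[X in measurable X]setTI; apply: mn => //.
  exact: measurableC.
- rewrite /circle_measure /pushforward /=.
  rewrite (_ : expi @^-1` _ = set0) ?measure0//.
  by apply/seteqP; split => // t h; exfalso; apply: h; exact: normc_expi.
- by move=> z /= h; exact: h.
Qed.

(** A Borel inverse of [expi] on []0, 1[]: at [expi t] the quotient is the cotangent of [pi * t],
    that is [tan (pi / 2 - pi * t)]. *)
Definition cangle (z : R[i]) : R :=
  2^-1 - atan (complex.Im z / (1 - complex.Re z)) / pi.

Lemma expiK t : 0 < t < 1 -> cangle (expi t) = t.
Proof.
move=> /andP[t0 t1]; have p0 := pi_gt0 R.
have sn0 : 0 < sin (pi * t).
  by apply: sin_gt0_pi; rewrite mulr_gt0//= -[ltRHS]mulr1 ltr_pM2l.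
have E : 2 * pi * t = (pi * t) *+ 2 by rewrite mulr2n; ring.
have q : complex.Im (expi t) / (1 - complex.Re (expi t)) = tan (pi / 2 - pi * t).
  rewrite [complex.Im _]/= [complex.Re _]/= E /tan sinB cosB sin_pihalf cos_pihalf.
  rewrite [_ *+ 2]mulr2n sinD cosD.
  have h : cos (pi * t) * cos (pi * t) = 1 - sin (pi * t) * sin (pi * t).
    by have := cos2Dsin2 (pi * t); rewrite !expr2; lra.
  rewrite h !mul0r !mul1r subr0 add0r (_ : 1 - _ = 2 * (sin (pi * t) * sin (pi * t))); last by ring.
  by field; rewrite gt_eqF.
rewrite /cangle q tanK; last first.
  rewrite in_itv/=; have : 0 < pi * t by rewrite mulr_gt0.
  have : pi * t < pi by rewrite -[ltRHS]mulr1 ltr_pM2l.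
  by lra.
have : pi != 0 :> R by rewrite gt_eqF.
by generalize (@pi R) => p pn0; field.
Qed.

Lemma measurable_cangle : measurable_fun [set: R[i]] cangle.
Proof.
have mRe : measurable_fun [set: R[i]] (fun z : R[i] => complex.Re z) by exact: measurable_cRe.
have mIm : measurable_fun [set: R[i]] (fun z : R[i] => complex.Im z) by exact: measurable_cIm.
have c1 := measurable_cst (1 : R).
have mq : measurable_fun [set: R[i]] (fun z : R[i] => complex.Im z / (1 - complex.Re z)).
  by apply: measurable_funM => //; apply: measurable_funV; exact: measurable_funB.
apply: measurable_funB; first exact: measurable_cst.
apply: measurable_funM; last exact: measurable_cst.
apply: measurableT_comp mq; apply: continuous_measurable_fun; exact: continuous_atan.
Qed.

(** The image of a null set under [expi] is not visibly Borel, so the exceptional set is described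
    through the Borel inverse [cangle]. The angles 0 and 1, where [cangle] does not invert [expi],
    form a null set. *)
Lemma ae_lebesgue_circle (Q : R[i] -> Prop) :
  (\forall t \ae leb, 0 < t < 1 -> Q (expi t)) -> \forall z \ae circ, Q z.
Proof.
move=> [N [mN N0 hN]].
have mE : measurable_fun [set: R[i]] (fun z => normc (expi (cangle z) - z)).
  apply: measurable_normc; apply: measurable_cB => //.
  by apply: measurableT_comp; [exact: measurable_expi|exact: measurable_cangle].
pose G := [set z | normc (expi (cangle z) - z) = 0] `&` cangle @^-1` `]0, 1[ `&` cangle @^-1` (~` N).
have mG : measurable G.
  apply: measurableI; first apply: measurableI.
  - by rewrite -[X in measurable X]setTI; exact: (mE measurableT [set 0]).
  - by rewrite -[X in measurable X]setTI; apply: measurable_cangle.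
  - rewrite -[X in measurable X]setTI; apply: measurable_cangle => //.
    exact: measurableC.
exists (~` G); split; first exact: measurableC.
- rewrite /circle_measure /pushforward /mrestr.
  apply/eqP; rewrite eq_le measure_ge0 andbT.
  apply: (@le_trans _ _ (leb (N `|` [set 0] `|` [set 1]))).
    apply: le_measure; rewrite ?inE.
    + apply: measurableI => //; rewrite -[X in measurable X]setTI.
      by apply: measurable_expi => //; exact: measurableC.
    + by apply: measurableU => //; apply: measurableU.
    move=> t [/= nG]; rewrite in_itv/= => /andP[t0 t1].
    have [->|nt0] := eqVneq t 0; first by left; right.
    have [->|nt1] := eqVneq t 1; first by right.
    have t01 : 0 < t < 1 by rewrite !lt_neqAle eq_sym nt0 nt1 t0.
    left; left; apply: contrapT => nN; apply: nG; rewrite /G /= expiK// in_itv/= t01.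
    by rewrite subrr normc0.
  have l0 (x : R) : leb [set x] = 0%E by exact: lebesgue_measure_set1.
  have m0 : measurable [set 0 : R] by [].
  have m1 : measurable [set 1 : R] by [].
  have e1 := measureU0 (measurableU _ _ mN m0) m1 (l0 1).
  have e0 := measureU0 mN m0 (l0 0).
  by rewrite e1 e0 -N0.
- move=> z /= nQ [[/eq0_normc /eqP +] +] nN; rewrite subr_eq0 => /eqP zE; rewrite ?in_itv/= => z01.
  by apply: nN; apply: hN => /= /(_ z01); rewrite zE.
Qed.

Lemma expi1 : expi (1 : R) = 1.
Proof.
by rewrite /Defs.expi mulr1 mulr_natl cos2pi sin2pi.
Qed.

(** The antiderivatives of [cos (w * t)] and [sin (w * t)] take equal values at 0 and 1, because
    [expi 1 = 1]. *)
Lemma Cint_Xn n : (0 < n)%N -> Cint circ (fun z => z ^+ n) = 0.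
Proof.
move=> n0; pose w : R := 2 * pi * n%:R.
have w0 : 0 < w by rewrite !mulr_gt0 ?pi_gt0// ltr0n.
have [cw sw] : cos w = 1 /\ sin w = 0.
  have := expiX n (1 : R); rewrite expi1 expr1n mulr1 => /(congr1 (fun z : R[i] => (complex.Re z, complex.Im z))).
  by rewrite /w; case=> <- <-.
have bX : \forall z \ae circ, normc (z ^+ n) <= 1.
  by apply: filterS ae_normc_circle => z z1; rewrite normcX z1 expr1n.
have iX := cL1_bounded (measurable_cX n (@measurable_id _ _ [set: R[i]])) bX.
have eE t : expi t ^+ n = cos (w * t) +i* sin (w * t).
  by rewrite expiX /Defs.expi mulrA.
have dF (F f : R -> R) : (forall x : R, is_derive x (1 : R) F (f x)) -> continuous f -> F 1 = F 0 ->
    \int[leb]_(t in `[0, 1]) f t = 0.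
  move=> dF cf F10; rewrite /Rintegral (@continuous_FTC2 _ f F 0 1)//.
  - by rewrite F10 -EFinB subrr.
  - exact: continuous_subspaceT.
  - have cF x : {for x, continuous F}.
      by apply: differentiable_continuous; apply/derivable1_diffP; exact: (dF x).(@ex_derive _ _ _ _ _ _ _).
    split=> //.
    + exact: cvg_at_right_filter (cF 0).
    + exact: cvg_at_left_filter (cF 1).
  - by move=> x _; rewrite derive1E; apply: derive_val.
have dw x : is_derive x (1 : R) (fun t => w * t) w.
  apply: is_derive_eq; rewrite /GRing.scale/=. ring.
apply: complex_eqP => /=.
- have [_ ->] := rint_circle (cL1_Re iX).
  under eq_Rintegral do rewrite eE /=.
  apply: (dF (fun t => sin (w * t) / w)).
  + move=> x; apply: is_derive_eq.
    by rewrite /GRing.scale /=; field; rewrite gt_eqF.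
  + move=> x; apply: continuous_comp; first exact: mulrl_continuous.
    exact: continuous_cos.
  + by rewrite mulr1 mulr0 sin0 sw.
- have [_ ->] := rint_circle (cL1_Im iX).
  under eq_Rintegral do rewrite eE /=.
  apply: (dF (fun t => - cos (w * t) / w)).
  + move=> x; apply: is_derive_eq.
    by rewrite /GRing.scale /=; field; rewrite gt_eqF.
  + move=> x; apply: continuous_comp; first exact: mulrl_continuous.
    exact: continuous_sin.
  + by rewrite mulr1 mulr0 cos0 cw.
Qed.

End circle_measure_facts.

(** * The Poisson kernel and radial limits *)

Section kernel_estimate.
Context {R : realType}.
Local Notation leb := (@lebesgue_measure R).

(* On the ring [2 ^ (j - 1) e <= |s - t| < 2 ^ j e] the kernel is at most
   [4 / (4 ^ j e)]. *)
Lemma kernel_dyadic (e x : R) : 0 < e -> exists j : nat,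
  `|x| < 2 ^+ j * e /\ e / (e ^+ 2 + x ^+ 2) <= 4 / (4 ^+ j * e).
Proof.
move=> e0; have ex : exists j : nat, `|x| < 2 ^+ j * e.
  have := archi_boundP (divr_ge0 (normr_ge0 x) (ltW e0)).
  set n := Num.bound _ => hn; exists n; rewrite -ltr_pdivrMr//.
  by apply: lt_trans hn _; rewrite -natrX ltr_nat ltn_expl.
have q0 : 0 < e ^+ 2 + x ^+ 2 by rewrite ltr_pwDl ?sqr_ge0// exprn_gt0.
case: (ex_minnP ex) => -[|j] xj minj; [exists 0%N|exists j.+1]; split=> //.
- rewrite expr0 mul1r ler_pdivrMr// mulrAC ler_pdivlMr//.
  by have := sqr_ge0 e; have := sqr_ge0 x; rewrite !expr2; lra.
- have : 2 ^+ j * e <= `|x|.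
    by rewrite leNgt; apply/negP => /minj; rewrite ltnn.
  have p0 : 0 < 2 ^+ j :> R by rewrite exprn_gt0.
  rewrite -(real_normK (num_real x)) => h.
  have -> : 4 ^+ j.+1 = 4 * (2 ^+ j) ^+ 2 :> R.
    by rewrite exprS; congr (_ * _); rewrite -exprM mulnC exprM; congr (_ ^+ _); rewrite -natrX.
  rewrite ler_pdivrMr; last by rewrite real_normK ?num_real.
  rewrite mulrAC ler_pdivlMr; last by rewrite !mulr_gt0// exprn_gt0.
  have : (2 ^+ j * e) ^+ 2 <= `|x| ^+ 2.
    by rewrite ler_sqr ?nnegrE// mulr_ge0// ltW.
  by rewrite exprMn; have := sqr_ge0 e; nra.
Qed.

(** By [kernel_dyadic] the kernel is at most the sum over [j] of [4 / (4 ^+ j * e)] times the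
    indicator of the ball of radius [2 ^+ j * e]. The hypothesis makes the j-th term contribute at
    most [8 * eps * 2^-1 ^+ j], and the series sums to [16 * eps]. *)
Lemma kernel_average_bound (v : R -> R) (t eps e : R) :
  measurable_fun [set: R] v -> (forall s, 0 <= v s) -> 0 < e ->
  (forall rho, 0 < rho ->
    (\int[leb]_(s in ball t rho) (v s)%:E <= (2 * rho * eps)%:E)%E) ->
  (\int[leb]_s (v s * (e / (e ^+ 2 + (s - t) ^+ 2)))%:E <= (16 * eps)%:E)%E.
Proof.
move=> mv v0 e0 hv.
pose c j : R := 4 / (4 ^+ j * e).
have c0 j : 0 <= c j by rewrite divr_ge0// mulr_ge0 ?exprn_ge0// ltW.
pose B j : set R := ball t (2 ^+ j * e).
have mB j : measurable (B j) by exact: measurable_ball.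
pose w j s := (c j * v s * \1_(B j) s)%:E.
have mw j : measurable_fun [set: R] (w j).
  apply/measurable_EFinP; apply: measurable_funM; last exact: measurable_indic.
  by apply: measurable_funM => //; exact: measurable_cst.
have w0 j s : (0 <= w j s)%E.
  rewrite lee_fin; apply: mulr_ge0; first by apply: mulr_ge0.
  by rewrite indicE.
have mk : measurable_fun [set: R] (fun s => v s * (e / (e ^+ 2 + (s - t) ^+ 2))).
  apply: measurable_funM => //; apply: measurable_funM; first exact: measurable_cst.
  apply: measurable_funV; apply: measurable_funD; first exact: measurable_cst.
  by apply: measurable_funX; apply: measurable_funB => //; exact: measurable_cst.
apply: (@le_trans _ _ (\int[leb]_s (\sum_(j <oo) w j s))%E).
  apply: ge0_le_integral => //.
  - move=> s _; rewrite lee_fin; apply: mulr_ge0 => //; apply: divr_ge0; first exact: ltW.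
    by rewrite addr_ge0// sqr_ge0.
  - exact/measurable_EFinP.
  - by apply: ge0_emeasurable_sum => // k _; exact: mw.
  move=> s _; have [j [xj kj]] := kernel_dyadic (s - t) e0.
  apply: (@le_trans _ _ (w j s)).
    rewrite lee_fin indicE mem_set; last by rewrite /B /ball /= distrC.
    by rewrite mulr1 mulrC ler_wpM2r.
  apply: (@le_trans _ _ (\sum_(0 <= k < j.+1) w k s)%E); last first.
    by apply: nneseries_lim_ge => k _.
  by rewrite big_nat_recr//= leeDr// sume_ge0.
rewrite integral_nneseries//.
have wle j : (\int[leb]_s w j s <= (8 * eps * 2^-1 ^+ j)%:E)%E.
  have -> : (\int[leb]_s w j s = (c j)%:E * \int[leb]_(s in B j) (v s)%:E)%E.
    rewrite -ge0_integralZl//; last 4 first.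
    - exact: mB.
    - by apply/measurable_EFinP; exact: measurable_funTS.
    - by move=> s _; rewrite lee_fin.
    - by rewrite lee_fin.
    rewrite [RHS]integral_mkcond; apply: eq_integral => s _.
    rewrite /w patchE indicE; case: ifPn => _; last by rewrite mulr0.
    by rewrite mulr1 EFinM.
  have e2 : 0 < 2 ^+ j * e by rewrite mulr_gt0// exprn_gt0.
  apply: (@le_trans _ _ ((c j)%:E * (2 * (2 ^+ j * e) * eps)%:E)%E).
    by apply: lee_wpmul2l; [rewrite lee_fin|exact: hv].
  rewrite -EFinM lee_fin /c (_ : 4 ^+ j = 2 ^+ j * 2 ^+ j :> R); last first.
    by rewrite -exprMn -natrM.
  rewrite exprVn le_eqVlt; apply/orP; left; apply/eqP.
  have p0 : 2 ^+ j != 0 :> R by rewrite expf_neq0.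
  have en0 : e != 0 by rewrite gt_eqF.
  by move: (2 ^+ j) p0 => p p0; field; rewrite ?p0 ?en0.
apply: (@le_trans _ _ (\sum_(j <oo) (8 * eps * 2^-1 ^+ j)%:E)%E).
  by apply: lee_nneseries => // j _ _; exact: integral_ge0.
have eps0 : 0 <= eps.
  have := hv 1 ltr01; rewrite mulr1 => h.
  have : (0 <= (2 * eps)%:E)%E by apply: le_trans h; apply: integral_ge0 => s _; rewrite lee_fin.
  by rewrite lee_fin; lra.
apply: lime_le.
  apply: is_cvg_nneseries => n _ _; rewrite lee_fin.
  by apply: mulr_ge0; [apply: mulr_ge0|rewrite exprn_ge0// invr_ge0].
apply: nearW => n; rewrite sumEFin lee_fin -mulr_sumr.
have := @series_half R n; have : 0 <= 8 * eps by rewrite mulr_ge0.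
by move=> h1 h2; apply: le_trans (ler_wpM2l h1 h2) _; lra.
Qed.

End kernel_estimate.

(** * The Poisson kernel and its expansion in powers *)

Section poisson_kernel.
Context {R : realType}.
Implicit Types u : R[i].

(** With [u = a * conjc w] and [w] on the circle, this is the Poisson kernel of the disc for the
    interior point [a] and the boundary point [w]. *)
Definition poisson u : R := (1 - normc u ^+ 2) / normc (1 - u) ^+ 2.

Lemma poisson_ge0 u : normc u <= 1 -> 0 <= poisson u.
Proof.
move=> u1; rewrite divr_ge0 ?sqr_ge0// subr_ge0.
by rewrite exprn_ile1 ?normc_ge0.
Qed.

Lemma normc_sub1 u : 1 - normc u <= normc (1 - u).
Proof. by rewrite -(@normc1 R); exact: le_trans (ler_norm _) (normcB_dist _ _). Qed.

Lemma poisson_le u : normc u < 1 -> poisson u <= 2 / (1 - normc u).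
Proof.
move=> u1; have h := normc_sub1 u; have u0 := normc_ge0 u.
have d0 : 0 < 1 - normc u by rewrite subr_gt0.
have d1 : 0 < normc (1 - u) by exact: lt_le_trans h.
rewrite /poisson ler_pdivrMr ?exprn_gt0// mulrAC ler_pdivlMr//.
have : (1 - normc u) ^+ 2 <= normc (1 - u) ^+ 2 by rewrite ler_sqr ?nnegrE// ltW.
by nra.
Qed.

(** Partial sum of the expansion of the kernel, kept as powers of [u] and of [conjc u] rather than
    as a real part, so that its integrals are moments. *)
Definition poisson_sum (N : nat) u : R[i] :=
  1 + \sum_(j < N) (u ^+ j.+1 + conjc u ^+ j.+1).

Lemma normc_sum (N : nat) (F : nat -> R[i]) :
  normc (\sum_(j < N) F j) <= \sum_(j < N) normc (F j).
Proof.
elim: N => [|N ih]; first by rewrite !big_ord0 normc0.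
by rewrite !big_ord_recr /= (le_trans (ler_normcD _ _))// lerD2r.
Qed.

Lemma geometric_sum_le (r : R) (N : nat) : 0 <= r < 1 ->
  \sum_(j < N) r ^+ j.+1 <= (1 - r)^-1.
Proof.
move=> /andP[r0 r1]; have d0 : 0 < 1 - r by rewrite subr_gt0.
have E : (1 - r) * \sum_(j < N) r ^+ j.+1 = r - r ^+ N.+1.
  elim: N => [|N ih]; first by rewrite big_ord0 mulr0 expr1 subrr.
  by rewrite big_ord_recr /= mulrDr ih !exprS; ring.
rewrite -(ler_pM2l d0) E divff ?gt_eqF//.
have : 0 <= r ^+ N.+1 by rewrite exprn_ge0.
by lra.
Qed.

Lemma normc_poisson_sum (N : nat) u (r : R) : normc u <= r -> r < 1 ->
  normc (poisson_sum N u) <= 1 + 2 / (1 - r).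
Proof.
move=> ur r1; have r0 : 0 <= r := le_trans (normc_ge0 u) ur.
rewrite /poisson_sum (le_trans (ler_normcD _ _))// normc1 lerD2l.
rewrite (le_trans (normc_sum _ (fun j => u ^+ j.+1 + conjc u ^+ j.+1)))//.
apply: (@le_trans _ _ (2 * \sum_(j < N) r ^+ j.+1)); last first.
  by apply: ler_wpM2l => //; apply: geometric_sum_le; rewrite r0.
rewrite mulr_sumr; apply: ler_sum => j _.
have h : normc u ^+ j.+1 <= r ^+ j.+1 by apply: lerXn2r; rewrite ?nnegrE ?normc_ge0.
rewrite (le_trans (ler_normcD _ _))// !normcX normc_conj.
by rewrite mulr2n mulrDl mul1r lerD.
Qed.

(** The geometric sums in closed form, with denominators cleared so that the identity holds for
    every [u], including 1. *)
Lemma poisson_sumE (N : nat) u : (1 - u) * (1 - conjc u) * poisson_sum N u =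
  1 - u * conjc u - u ^+ N.+1 * (1 - conjc u) - conjc u ^+ N.+1 * (1 - u).
Proof.
rewrite /poisson_sum; elim: N => [|N ih]; first by rewrite big_ord0 !expr1; ring.
by rewrite big_ord_recr /= addrA mulrDr ih !exprS; ring.
Qed.

Lemma cvg_poisson_sum u : normc u < 1 ->
  poisson_sum N u @[N --> \oo] --> (poisson u)%:C.
Proof.
move=> u1; have u0 := normc_ge0 u.
have d1 : 0 < normc (1 - u) by apply: lt_le_trans (normc_sub1 u); rewrite subr_gt0.
have n0 : 1 - u != 0 by rewrite -normc_eq0 gt_eqF.
have n0' : 1 - conjc u != 0.
  by rewrite -normc_eq0 -normc_conj conjcB conjcK conjc1 gt_eqF.
have q0 : (1 - u) * (1 - conjc u) = (normc (1 - u) ^+ 2)%:C.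
  by rewrite -mulc_conj conjcB conjc1.
have PE : (poisson u)%:C = (1 - u * conjc u) / ((1 - u) * (1 - conjc u)).
  by rewrite q0 mulc_conj /poisson realcM realcV realcB.
have DE N : poisson_sum N u - (poisson u)%:C =
    - (u ^+ N.+1 / (1 - u) + conjc u ^+ N.+1 / (1 - conjc u)).
  have nn : (1 - u) * (1 - conjc u) != 0 by rewrite mulf_neq0.
  apply: (mulfI nn); rewrite mulrBr poisson_sumE PE.
  by field; rewrite n0 n0'.
apply/normc_cvgP.
have hb N : normc (poisson_sum N u - (poisson u)%:C) <= 2 * normc u / normc (1 - u) * normc u ^+ N.
  have e : normc (1 - conjc u) = normc (1 - u).
    by rewrite -normc_conj conjcB conjcK conjc1.
  rewrite DE normcNc (le_trans (ler_normcD _ _))// !normcM !normcV !normcX normc_conj e exprS.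
  by rewrite le_eqVlt; apply/orP; left; apply/eqP; ring.
have g0 : geometric (2 * normc u / normc (1 - u)) (normc u) @ \oo --> (0 : R).
  by apply: cvg_geometric; rewrite ger0_norm.
apply: (squeeze_cvgr _ (cvg_cst 0) g0); apply: nearW => N.
by rewrite normc_ge0 hb.
Qed.

Lemma measurable_poisson d (T : measurableType d) (v : T -> R[i]) :
  measurable_fun [set: T] v -> measurable_fun [set: T] (fun x => poisson (v x)).
Proof.
move=> mv; have c1 := measurable_cst (1 : R).
apply: measurable_funM.
  by apply: measurable_funB; [exact: measurable_cst|exact: measurable_normc2].
apply: measurable_funV; apply: measurable_normc2.
by apply: measurable_cB => //; exact: measurable_cst.
Qed.

Lemma measurable_poisson_sum d (T : measurableType d) (v : T -> R[i]) N :
  measurable_fun [set: T] v -> measurable_fun [set: T] (fun x => poisson_sum N (v x)).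
Proof.
move=> mv; rewrite /poisson_sum; elim: N => [|N ih].
  by under eq_fun do rewrite big_ord0; exact: measurable_cst.
under eq_fun do rewrite big_ord_recr addrA.
apply: measurable_cD => //; apply: measurable_cD; apply: measurable_cX => //.
exact: measurable_cconj.
Qed.

End poisson_kernel.

(** * Poisson integrals as limits of sums of moments *)

Section poisson_integral.
Context d (T : measurableType d) {R : realType} (P : probability T R).
Implicit Types f v : T -> R[i].

Lemma cvg_Cint_poisson_sum f v (r : R) : cL1 P f -> measurable_fun [set: T] v ->
  (\forall x \ae P, normc (v x) <= r) -> r < 1 ->
  Cint P (fun x => f x * poisson_sum N (v x)) @[N --> \oo] -->
  Cint P (fun x => f x * (poisson (v x))%:C).
Proof.
move=> hf mv vr r1.
have [] := @Cint_dct _ _ _ P (fun N x => f x * poisson_sum N (v x))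
  (fun x => f x * (poisson (v x))%:C) (fun x => (1 + 2 / (1 - r)) * normc (f x)) => //.
- by move=> N; apply: measurable_cM; [exact: hf.1|exact: measurable_poisson_sum].
- apply: measurable_cM; first exact: hf.1.
  by apply: measurable_realc; exact: measurable_poisson.
- apply: filterS vr => x vr.
  have /cvg_poisson_sum /normc_cvgP h : normc (v x) < 1 by exact: le_lt_trans r1.
  apply/normc_cvgP; rewrite (_ : (fun N => _) =
    (fun N => normc (f x) * normc (poisson_sum N (v x) - (poisson (v x))%:C))).
    by rewrite -(mulr0 (normc (f x))); apply: cvgM h; exact: cvg_cst.
  by apply/funext => N; rewrite -mulrBr normcM.
- by apply: rintZ; exact: hf.2.
- apply: filterS vr => x vr N; rewrite normcM mulrC ler_wpM2r ?normc_ge0//.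
  exact: normc_poisson_sum.
Qed.

Lemma Cint_poisson_sum f v N :
  (forall j, cL1 P (fun x => f x * v x ^+ j)) ->
  (forall j, cL1 P (fun x => f x * conjc (v x) ^+ j)) ->
  Cint P (fun x => f x * poisson_sum N (v x)) = Cint P f +
  \sum_(j < N) (Cint P (fun x => f x * v x ^+ j.+1) + Cint P (fun x => f x * conjc (v x) ^+ j.+1)).
Proof.
move=> h1 h2; have hf : cL1 P f.
  by have := h1 0%N; congr (cL1 _ _); apply/funext => x; rewrite expr0 mulr1.
suff : cL1 P (fun x => f x * poisson_sum N (v x)) /\
  Cint P (fun x => f x * poisson_sum N (v x)) = Cint P f +
  \sum_(j < N) (Cint P (fun x => f x * v x ^+ j.+1) + Cint P (fun x => f x * conjc (v x) ^+ j.+1)).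
  by case.
rewrite /poisson_sum; elim: N => [|N [ih1 ih2]].
  by under eq_fun do rewrite big_ord0 addr0 mulr1; rewrite big_ord0 addr0.
have E : (fun x => f x * (1 + \sum_(j < N.+1) (v x ^+ j.+1 + conjc (v x) ^+ j.+1))) =
  (fun x => f x * (1 + \sum_(j < N) (v x ^+ j.+1 + conjc (v x) ^+ j.+1)) +
   (f x * v x ^+ N.+1 + f x * conjc (v x) ^+ N.+1)).
  by apply/funext => x; rewrite big_ord_recr /= addrA mulrDr [in X in _ + X]mulrDr.
rewrite E; have hN := cL1D (h1 N.+1) (h2 N.+1); split; first exact: cL1D.
by rewrite (CintD ih1 hN) ih2 (CintD (h1 N.+1) (h2 N.+1)) big_ord_recr /= [RHS]addrA.
Qed.

(* If the nonnegative moments of [v] are the powers of [a], then [v] integrates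
   the Poisson kernel, a sum of powers and conjugate powers, as [a] does. *)
Lemma Cint_poisson_moments v (a b : R[i]) : measurable_fun [set: T] v ->
  (\forall x \ae P, normc (v x) <= 1) ->
  (forall n, Cint P (fun x => v x ^+ n.+1) = a ^+ n.+1) ->
  normc a <= 1 -> normc b < 1 ->
  Cint P (fun x => (poisson (b * v x))%:C) = (poisson (b * a))%:C.
Proof.
move=> mv v1 va a1 b1.
have mbv : measurable_fun [set: T] (fun x => b * v x).
  by apply: measurable_cM => //; exact: measurable_cst.
have bv : \forall x \ae P, normc (b * v x) <= normc b.
  by apply: filterS v1 => x v1; rewrite normcM ler_piMr ?normc_ge0.
have ba : normc (b * a) < 1 by rewrite normcM (le_lt_trans _ b1)// ler_piMr ?normc_ge0.
have hone : cL1 P (fun=> 1).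
  by apply: (@cL1_bounded _ _ _ _ _ 1) => //; apply: aeW => x; rewrite normc1.
have bX (w : T -> R[i]) j : measurable_fun [set: T] w ->
    (\forall x \ae P, normc (w x) <= 1) -> cL1 P (fun x => 1 * w x ^+ j).
  move=> mw w1; apply: (@cL1_bounded _ _ _ _ _ 1).
    by apply: measurable_cM; [exact: measurable_cst|exact: measurable_cX].
  by apply: filterS w1 => x w1; rewrite mul1r normcX exprn_ile1 ?normc_ge0.
have bv1 : \forall x \ae P, normc (b * v x) <= 1.
  by apply: filterS bv => x; move=> /le_trans; apply; exact: ltW.
have lim1 := cvg_Cint_poisson_sum hone mbv bv b1.
have lim2 := cvg_poisson_sum ba.
have E N : Cint P (fun x => 1 * poisson_sum N (b * v x)) = poisson_sum N (b * a).
  rewrite Cint_poisson_sum; last 2 first.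
  - by move=> j; apply: bX.
  - move=> j; apply: (bX (fun x => conjc (b * v x))); first exact: measurable_cconj.
    by apply: filterS bv1 => x; rewrite normc_conj.
  rewrite Cint_cst; congr (_ + _); apply: eq_bigr => j _.
  have h : Cint P (fun x => 1 * (b * v x) ^+ j.+1) = (b * a) ^+ j.+1.
    rewrite [RHS]exprMn -va -CintZ; last first.
      by have := bX v j.+1 mv v1; congr (cL1 _ _); apply/funext => x; rewrite mul1r.
    by congr (Cint _ _); apply/funext => x; rewrite mul1r exprMn.
  rewrite h; congr (_ + _); rewrite -conjcX -h -Cint_conj; last exact: bX.
  by congr (Cint _ _); apply/funext => x; rewrite !mul1r conjcX.
rewrite (_ : (fun N => _) = (fun N => poisson_sum N (b * a))) in lim1; last first.
  by apply/funext => N; exact: E.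
rewrite (_ : (fun x => (poisson (b * v x))%:C) = (fun x => 1 * (poisson (b * v x))%:C)).
  exact: cvgc_unique lim1 lim2.
by apply/funext => x; rewrite mul1r.
Qed.

(** In the expansion of the kernel the powers of [conjc b] come multiplied by the moments assumed to
    vanish, so the Poisson integral is a power series in [b]: this is the source of analyticity. *)
Lemma cvg_taylor_poisson f v (b : R[i]) : cL1 P f -> measurable_fun [set: T] v ->
  (\forall x \ae P, normc (v x) <= 1) ->
  (forall n, Cint P (fun x => f x * v x ^+ n.+1) = 0) -> normc b < 1 ->
  \sum_(j < N) Cint P (fun x => f x * conjc (v x) ^+ j) * b ^+ j @[N --> \oo] -->
  Cint P (fun x => f x * (poisson (b * conjc (v x)))%:C).
Proof.
move=> hf mv v1 v0 b1.
have mcv := measurable_cconj mv.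
have cv1 : \forall x \ae P, normc (conjc (v x)) <= 1.
  by apply: filterS v1 => x; rewrite normc_conj.
have mbv : measurable_fun [set: T] (fun x => b * conjc (v x)).
  by apply: measurable_cM => //; exact: measurable_cst.
have bv : \forall x \ae P, normc (b * conjc (v x)) <= normc b.
  by apply: filterS cv1 => x v1x; rewrite normcM ler_piMr ?normc_ge0.
have fX (w : T -> R[i]) j : measurable_fun [set: T] w ->
    (\forall x \ae P, normc (w x) <= 1) -> cL1 P (fun x => f x * w x ^+ j).
  move=> mw w1; apply: (@cL1M _ _ _ _ _ _ 1) => //; first exact: measurable_cX.
  by apply: filterS w1 => x w1; rewrite normcX exprn_ile1 ?normc_ge0.
have bv1 : \forall x \ae P, normc (b * conjc (v x)) <= 1.
  by apply: filterS bv => x; move=> /le_trans; apply; exact: ltW.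
have lim1 := cvg_Cint_poisson_sum hf mbv bv b1.
have E N : Cint P (fun x => f x * poisson_sum N (b * conjc (v x))) =
    \sum_(j < N.+1) Cint P (fun x => f x * conjc (v x) ^+ j) * b ^+ j.
  rewrite Cint_poisson_sum; last 2 first.
  - by move=> j; apply: fX.
  - move=> j; apply: (fX (fun x => conjc (b * conjc (v x)))); first exact: measurable_cconj.
    by apply: filterS bv1 => x; rewrite normc_conj.
  rewrite big_ord_recl expr0 mulr1; congr (_ + _).
    by congr (Cint _ _); apply/funext => x; rewrite expr0 mulr1.
  apply: eq_bigr => j _.
  have -> : Cint P (fun x => f x * conjc (b * conjc (v x)) ^+ j.+1) = 0.
    rewrite -(mulr0 (conjc b ^+ j.+1)) -(v0 j) -CintZ; last exact: fX.
    by congr (Cint _ _); apply/funext => x; rewrite conjcM conjcK exprMn; ring.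
  rewrite addr0 mulrC -CintZ; last exact: fX.
  by congr (Cint _ _); apply/funext => x; rewrite exprMn; ring.
(* The N-th Poisson sum corresponds to [N.+1] Taylor terms, because of its constant term. *)
rewrite -(cvg_shiftS (fun N => \sum_(j < N) Cint P (fun x => f x * conjc (v x) ^+ j) * b ^+ j)).
by rewrite (_ : (fun N => _) = (fun N => Cint P (fun x => f x * poisson_sum N (b * conjc (v x)))));
  [exact: lim1|apply/funext => N; rewrite /= E].
Qed.


End poisson_integral.

(** * Radial limits of Poisson integrals at Lebesgue points *)

Section fatou_theorem.
Context {R : realType}.
Local Notation expi := (@expi R).
Local Notation circ := (@circle_measure R).
Local Notation leb := (@lebesgue_measure R).

Lemma normc_sub1_unit (w z : R[i]) : normc w = 1 -> normc (1 - z * conjc w) = normc (w - z).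
Proof.
move=> w1; have -> : w - z = w * (1 - z * conjc w).
  by rewrite mulrBr mulr1 mulrCA mulc_conj w1 expr1n mulr1.
by rewrite normcM w1 mul1r.
Qed.

(** With [e = 1 - r], [x = s - t] and [D] the distance from [expi s] to [r%:C * expi t], both
    [e <= D] and [c * |x| <= 2 * D] hold, so [c ^+ 2 * (e ^+ 2 + x ^+ 2) <= 8 * D ^+ 2]. The
    numerator is at most [2 * e], whence the 16. *)
Lemma poisson_expi_le (t : R) : 0 < t < 1 -> exists2 C, 0 < C &
  forall r s, 0 <= r < 1 -> 0 <= s <= 1 ->
  poisson (r%:C * expi t * conjc (expi s)) <= C * ((1 - r) / ((1 - r) ^+ 2 + (s - t) ^+ 2)).
Proof.
move=> /expiB_ge[c /andP[c0 c2] hc]; exists (16 / c ^+ 2).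
  by rewrite divr_gt0// exprn_gt0.
move=> r s /andP[r0 r1] /hc hs.
set e := 1 - r; have e0 : 0 < e by rewrite subr_gt0.
rewrite /poisson !normcM normc_conj !normc_expi !mulr1 normc_real ger0_norm//.
rewrite normc_sub1_unit ?normc_expi//.
set D := normc _; set x := s - t in hs *.
have De : e <= D.
  rewrite /D /e -{1}(normc_expi s) -[X in _ - X <= _](ger0_norm r0) -normc_real.
  rewrite -[X in _ - X <= _]mulr1 -(normc_expi t) -normcM.
  exact: le_trans (ler_norm _) (normcB_dist _ _).
have D0 : 0 < D by exact: lt_le_trans De.
have Dx : c * `|x| <= 2 * D.
  apply: le_trans hs _; apply: le_trans (ler_normc_dist _ (r%:C * expi t) _) _.
  rewrite mulr2n mulrDl mul1r lerD2l; apply: le_trans De.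
  rewrite -{2}(mul1r (expi t)) -mulrBl normcM normc_expi mulr1.
  rewrite -[1]/(1%:C) -realcB normc_real ler0_norm; first by rewrite opprB.
  by rewrite subr_le0 ltW.
have q0 : 0 < e ^+ 2 + x ^+ 2 by rewrite ltr_pwDl ?sqr_ge0// exprn_gt0.
have key : c ^+ 2 * (e ^+ 2 + x ^+ 2) <= 8 * D ^+ 2.
  have h1 : (c * e) ^+ 2 <= (2 * D) ^+ 2.
    by rewrite ler_sqr ?nnegrE ?mulr_ge0 ?(ltW c0) ?(ltW e0) ?(ltW D0)// ler_pM// ltW.
  have h2 : (c * `|x|) ^+ 2 <= (2 * D) ^+ 2.
    by rewrite ler_sqr ?nnegrE ?mulr_ge0 ?(ltW c0) ?(ltW D0).
  have nx : `|x| ^+ 2 = x ^+ 2 by rewrite real_normK ?num_real.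
  by move: h1 h2; rewrite !exprMn nx; lra.
have r2 : 1 - r ^+ 2 <= 2 * e by rewrite /e; have := sqr_ge0 (1 - r); rewrite sqrrB expr1n; lra.
rewrite ler_pdivrMr ?exprn_gt0//; apply: le_trans r2 _.
have -> : 16 / c ^+ 2 * (e / (e ^+ 2 + x ^+ 2)) * D ^+ 2 =
    2 * e * ((8 * D ^+ 2) / (c ^+ 2 * (e ^+ 2 + x ^+ 2))).
  by field; rewrite (gt_eqF c0) (gt_eqF q0).
rewrite ler_peMr ?mulr_ge0 ?(ltW e0)//.
by rewrite ler_pdivlMr ?mul1r// mulr_gt0// exprn_gt0.
Qed.

Lemma lebesgue_pt_ball (U : R -> R) (t eps : R) : lebesgue_pt U t -> 0 < eps ->
  exists2 del, 0 < del & forall rho, 0 < rho -> rho < del ->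
    (\int[leb]_(s in ball t rho) (`|U s - U t|)%:E <= (2 * rho * eps)%:E)%E.
Proof.
move=> h e0.
have /h [del /= del0 hdel] : ereal_nbhs 0%E (fun x : \bar R => (x < eps%:E)%E).
  by apply: open_ereal_lt'; rewrite lte_fin.
exists del => // rho rho0 rhod.
have := hdel rho; rewrite /= sub0r normrN gtr0_norm// => /(_ rhod rho0).
rewrite /davg /iavg lebesgue_measure_ball ?(ltW rho0)// => /ltW.
have r2 : 0 < rho *+ 2 by rewrite mulrn_wgt0.
rewrite inver (gt_eqF r2) => hle.
have := lee_wpmul2l (_ : (0 <= (rho *+ 2)%:E)%E) hle.
rewrite lee_fin (ltW r2) => /(_ isT).
rewrite muleA -EFinM divff ?gt_eqF// mul1e -EFinM mulr_natl => /le_trans; apply.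
by rewrite lee_fin.
Qed.

Lemma Cint_poisson_circle (b : R[i]) : normc b < 1 ->
  Cint circ (fun w => (poisson (b * conjc w))%:C) = 1.
Proof.
move=> b1; rewrite (@Cint_poisson_moments _ _ _ circ (fun w => conjc w) 0 b) ?normc0//.
- by rewrite mulr0 /poisson normc0 subr0 normc1 expr0n /= expr1n subr0 divr1.
- by apply: measurable_cconj; exact: measurable_id.
- by apply: filterS ae_normc_circle => z z1; rewrite normc_conj z1.
- move=> n; rewrite expr0n /=.
  transitivity (Cint circ (fun z => conjc (z ^+ n.+1))).
    by congr (Cint _ _); apply/funext => z; rewrite conjcX.
  rewrite Cint_conj ?Cint_Xn ?conjc0//.
  apply: (@cL1_bounded _ _ _ _ _ 1); first by apply: measurable_cX; exact: measurable_id.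
  by apply: filterS ae_normc_circle => z z1; rewrite normcX z1 expr1n.
Qed.


(** Near [t] the error is controlled by averages of [|U s - U t|], which are small at a Lebesgue
    point; away from [t] the kernel tends to 0 with [1 - r]. *)
Lemma fatou_at_lebesgue_pt (u : R[i] -> R) (U : R -> R) (t : R) : rint circ u ->
  measurable_fun [set: R] U -> (forall s, 0 <= s <= 1 -> U s = u (expi s)) ->
  lebesgue_pt U t -> 0 < t < 1 ->
  \int[circ]_w (u w * poisson (r%:C * expi t * conjc w)) @[r --> (1 : R)^'-] --> u (expi t).
Proof.
move=> iu mU UE lpt t01; have [C C0 hC] := poisson_expi_le t01.
apply/cvgrPdist_le => eps eps0.
(* 16 is the constant of [kernel_average_bound] and [C] that of [poisson_expi_le]: the near part
   will be at most [eps / 2]. *)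
pose e1 := eps / 2 / (16 * C).
have e10 : 0 < e1 by rewrite !divr_gt0// mulr_gt0.
have [del' del'0 hdel'] := lebesgue_pt_ball lpt e10.
pose del := del' / 2.
have del0 : 0 < del by rewrite divr_gt0.
have deld : del < del' by rewrite ltr_pdivrMr// mulr_natr mulr2n ltrDl.
pose z := expi t.
have Ut : U t = u z by apply: UE; case/andP: t01 => t0 t1; rewrite !ltW.
pose v s := `|U s - U t|.
have v0 s : 0 <= v s by exact: normr_ge0.
have mv : measurable_fun [set: R] v.
  by apply: measurableT_comp => //; apply: measurable_funB => //; exact: measurable_cst.
have mBd : measurable (ball t del : set R) by exact: measurable_ball.
(* Averages of [v] are small only at small radii, while the dyadic bound uses all radii; after
   truncation to [ball t del] they are small at every radius. *)
pose V1 s := v s * \1_(ball t del) s.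
have V10 s : 0 <= V1 s by apply: mulr_ge0 => //; rewrite indicE.
have mV1 : measurable_fun [set: R] V1.
  by apply: measurable_funM => //; exact: measurable_indic.
have V1v s : V1 s <= v s by rewrite /V1 indicE ler_piMr// lern1; case: (_ \in _).
have V1int rho : 0 < rho ->
    (\int[leb]_(s in ball t rho) (V1 s)%:E <= (2 * rho * e1)%:E)%E.
  move=> rho0; have mB : measurable (ball t rho : set R) by exact: measurable_ball.
  have [rd|dr] := leP rho del.
    apply: le_trans (hdel' rho rho0 (le_lt_trans rd deld)).
    apply: ge0_le_integral => //;
      do ?[by apply/measurable_EFinP; exact: measurable_funTS|by move=> s _; rewrite lee_fin].
  apply: (@le_trans _ _ (\int[leb]_s (V1 s)%:E)%E).
    by apply: ge0_subset_integral => //;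
      do ?[exact/measurable_EFinP|by move=> s _; rewrite lee_fin].
  have -> : (\int[leb]_s (V1 s)%:E = \int[leb]_(s in ball t del) (v s)%:E)%E.
    rewrite [RHS]integral_mkcond; apply: eq_integral => s _.
    by rewrite /V1 patchE indicE; case: ifPn => _; rewrite ?mulr1 ?mulr0.
  apply: le_trans (hdel' del del0 deld) _.
  by rewrite lee_fin ler_pM2r// ler_pM2l// ltW.
pose D w := `|u w - u z|.
have Dge w : 0 <= D w by exact: normr_ge0.
have iD : rint circ D.
  by have := integrable_norm (rintB iu (rint_cst circ (u z))).
pose N := \int[circ]_w D w.
have N0 : 0 <= N by apply: Rint_ge0 => w; exact: normr_ge0.
(* The first bound keeps [r] nonnegative, the second makes the far part at most [eps / 2]. *)
pose eta := Num.min 1 (eps / 2 / (C / del ^+ 2 * (N + 1))).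
have d2 : 0 < C / del ^+ 2 by rewrite divr_gt0// exprn_gt0.
have N1 : 0 < N + 1 by rewrite ltr_wpDl.
have eta0 : 0 < eta by rewrite lt_min ltr01 !divr_gt0// mulr_gt0.
exists eta => //= r; rewrite /ball_ /=.
move=> reta r1; have e0 : 0 < 1 - r by rewrite subr_gt0.
rewrite (gtr0_norm e0) lt_min in reta; case/andP: reta => re1 re2.
have r01 : 0 <= r < 1 by rewrite r1 andbT; move: re1; lra.
have r0 : 0 <= r by case/andP: r01.
pose p w := poisson (r%:C * z * conjc w).
have mp : measurable_fun [set: R[i]] p.
  apply: measurable_poisson; apply: measurable_cM; first exact: measurable_cst.
  by apply: measurable_cconj; exact: measurable_id.
have nr w : normc w = 1 -> normc (r%:C * z * conjc w) = r.
  by move=> w1; rewrite !normcM normc_conj w1 normc_expi !mulr1 normc_real ger0_norm.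
have p0 w : normc w = 1 -> 0 <= p w.
  by move=> w1; apply: poisson_ge0; rewrite nr// ltW.
have pb : \forall w \ae circ, `|p w| <= 2 / (1 - r).
  apply: filterS ae_normc_circle => w w1; rewrite ger0_norm; last exact: p0.
  have := @poisson_le _ (r%:C * z * conjc w); rewrite nr//; exact.
have rintp (h : R[i] -> R) : rint circ h -> rint circ (fun w => h w * p w).
  move=> ih; have mh := rint_meas ih.
  have mhp : measurable_fun [set: R[i]] (fun w => h w * p w) by exact: measurable_funM.
  have [] := @rint_dom _ _ _ circ (fun w => `|h w * p w|) (fun w => (2 / (1 - r)) * `|h w|).
  - exact: measurableT_comp.
  - by move=> w; exact: normr_ge0.
  - by apply: rintZ; exact: integrable_norm.
  - by apply: filterS pb => w hw; rewrite normrM mulrC ler_wpM2r.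
  move=> ia _; exact: rint_absdom mhp ia (fun w => lexx _).
have ip1 : \int[circ]_w p w = 1.
  have n1 : normc (r%:C * z) < 1.
    by rewrite normcM normc_expi mulr1 normc_real ger0_norm.
  have := Cint_poisson_circle n1; by move=> /(congr1 (fun x : R[i] => complex.Re x)).
have iuz := rintp _ (rint_cst circ (u z)).
have iup := rintp _ iu.
(* The kernel has mean 1, so the constant [u z] can be brought under the integral. *)
have -> : u z - \int[circ]_w (u w * p w) = \int[circ]_w ((u z - u w) * p w).
  rewrite -{1}(mulr1 (u z)) -ip1 -RintZ; last first.
    by have := rintp _ (rint_cst circ 1); under eq_fun do rewrite mul1r.
  by rewrite -RintB//; apply: eq_Rintegral => w _; rewrite mulrBl.
have iB : rint circ (fun w => (u z - u w) * p w).
  by apply: rintp; apply: rintB => //; exact: rint_cst.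
apply: le_trans (le_normr_Rintegral measurableT iB) _.
have iDp := rintp _ iD.
have -> : \int[circ]_w `|(u z - u w) * p w| = \int[circ]_w (D w * `|p w|).
  by apply: eq_Rintegral => w _; rewrite normrM distrC.
have iDp' : rint circ (fun w => D w * `|p w|).
  have := integrable_norm iDp; congr (_.-integrable _ _); apply/funext => w /=.
  by rewrite normrM normr_id.
rewrite -lee_fin EFin_rint//.
rewrite ge0_integral_circle; last 2 first.
- by apply/measurable_EFinP; exact: rint_meas iDp'.
- by move=> w; rewrite lee_fin mulr_ge0.
pose k s := (1 - r) / ((1 - r) ^+ 2 + (s - t) ^+ 2).
have k0 s : 0 <= k s by rewrite divr_ge0 ?(ltW e0)// addr_ge0 ?sqr_ge0.
have mk : measurable_fun [set: R] k.
  apply: measurable_funM; first exact: measurable_cst.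
  apply: measurable_funV; apply: measurable_funD; first exact: measurable_cst.
  by apply: measurable_funX; apply: measurable_funB => //; exact: measurable_cst.
have mDe : measurable_fun [set: R] (fun s => D (expi s)).
  apply: measurableT_comp; last exact: measurable_expi.
  exact: rint_meas iD.
pose c2 := C * ((1 - r) / del ^+ 2).
have c20 : 0 <= c2 by rewrite mulr_ge0 ?divr_ge0 ?(ltW e0) ?(ltW C0)// exprn_ge0// ltW.
have point s : `[0, 1]%classic s -> D (expi s) * `|p (expi s)| <= C * (V1 s * k s) + c2 * D (expi s).
  rewrite /= in_itv /= => s01.
  have vE : v s = D (expi s) by rewrite /v /D UE// Ut.
  rewrite (ger0_norm (p0 _ (normc_expi s))).
  have h := hC r s r01 s01.
  have D0 : 0 <= D (expi s) by exact: normr_ge0.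
  have [inb|outb] := pselect (ball t del s).
    rewrite /V1 indicE mem_set// mulr1 vE.
    apply: (@le_trans _ _ (D (expi s) * (C * k s))); first exact: ler_wpM2l.
    by rewrite mulrCA lerDl mulr_ge0.
  apply: (@le_trans _ _ (c2 * D (expi s))); last first.
    by rewrite lerDr mulr_ge0 ?(ltW C0)// mulr_ge0.
  rewrite mulrC ler_wpM2r//; apply: le_trans h _; rewrite ler_pM2l// ler_pM2l//.
  have ds : del <= `|s - t|.
    by rewrite leNgt; apply/negP => hlt; apply: outb; rewrite /ball /= distrC.
  rewrite lef_pV2 ?posrE ?exprn_gt0//; last by rewrite ltr_pwDl ?sqr_ge0// exprn_gt0.
  rewrite -[(s - t) ^+ 2]real_normK ?num_real//.
  apply: (@le_trans _ _ (`|s - t| ^+ 2)); last by rewrite lerDr sqr_ge0.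
  by rewrite ler_sqr ?nnegrE// ltW.
have mI : measurable `[0, 1 : R]%classic by exact: measurable_itv.
have mVk : measurable_fun [set: R] (fun s => C * (V1 s * k s)).
  by apply: measurable_funM; [exact: measurable_cst|exact: measurable_funM].
have mcD : measurable_fun [set: R] (fun s => c2 * D (expi s)).
  by apply: measurable_funM => //; exact: measurable_cst.
apply: (@le_trans _ _ (\int[leb]_(s in `[0%R, 1%R]) ((C * (V1 s * k s))%:E + (c2 * D (expi s))%:E))%E).
  apply: ge0_le_integral => //.
  - by move=> s _; rewrite lee_fin mulr_ge0.
  - apply: measurable_funTS; apply/measurable_EFinP; apply: measurable_funM => //.
    by do 2 apply: measurableT_comp => //; exact: measurable_expi.
  - by apply: measurable_funTS; apply: emeasurable_funD; exact/measurable_EFinP.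
rewrite ge0_integralD//; last 4 first.
- by move=> s _; rewrite lee_fin mulr_ge0 ?(ltW C0)// mulr_ge0.
- by apply: measurable_funTS; exact/measurable_EFinP.
- by move=> s _; rewrite lee_fin mulr_ge0.
- by apply: measurable_funTS; exact/measurable_EFinP.
rewrite (splitr eps) EFinD; apply: leeD.
- apply: (@le_trans _ _ (\int[leb]_s (C%:E * (V1 s * k s)%:E))%E).
    apply: ge0_subset_integral => //.
    + by apply: measurable_funTS; exact/measurable_EFinP.
    + by move=> s _; rewrite lee_fin mulr_ge0 ?(ltW C0)// mulr_ge0.
  rewrite ge0_integralZl//; last 3 first.
  + by apply/measurable_EFinP; exact: measurable_funM.
  + by move=> s _; rewrite lee_fin mulr_ge0.
  + by rewrite lee_fin ltW.
  apply: (@le_trans _ _ (C%:E * (16 * e1)%:E)%E).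
    apply: lee_wpmul2l; first by rewrite lee_fin ltW.
    exact: kernel_average_bound.
  rewrite -EFinM lee_fin /e1 le_eqVlt; apply/orP; left; apply/eqP; field.
  by rewrite gt_eqF.
- have -> : (\int[leb]_(s in `[0%R, 1%R]) (c2 * D (expi s))%:E = c2%:E * N%:E)%E.
    rewrite /N EFin_rint// ge0_integral_circle; last 2 first.
    + by apply/measurable_EFinP; exact: rint_meas iD.
    + by move=> w; rewrite lee_fin.
    rewrite -ge0_integralZl//.
    + by apply: measurable_funTS; exact/measurable_EFinP.
    + by move=> s _; rewrite lee_fin.
  rewrite -EFinM lee_fin /c2.
  have h1 : (1 - r) * (C / del ^+ 2 * (N + 1)) <= eps / 2.
    rewrite -ler_pdivlMr; [exact: ltW|exact: mulr_gt0].
  have -> : C * ((1 - r) / del ^+ 2) * N = (1 - r) * (C / del ^+ 2 * N) by ring.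
  apply: le_trans h1; rewrite ler_pM2l// ler_pM2l// lerDl//.
Qed.

End fatou_theorem.

(** * Radial limits almost everywhere and uniqueness of Fourier coefficients *)

Section fatou_complex.
Context {R : realType}.
Local Notation expi := (@expi R).
Local Notation circ := (@circle_measure R).

(** The differentiation theorem is about the line: [u] is read through angles and put to 0 outside
    [[0, 1]], which makes it locally integrable. *)
Lemma fatou_real (u : R[i] -> R) : rint circ u -> \forall z \ae circ,
  \int[circ]_w (u w * poisson (r%:C * z * conjc w)) @[r --> (1 : R)^'-] --> u z.
Proof.
move=> iu; have [iue _] := rint_circle iu.
have mI : measurable `[0, 1 : R]%classic by exact: measurable_itv.
pose U := (fun s => u (expi s)) \_ `[0, 1 : R]%classic.
have mU : measurable_fun [set: R] U.
  apply/(measurable_restrictT _ mI); apply: measurable_funTS.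
  by apply: measurableT_comp; [exact: rint_meas iu|exact: measurable_expi].
have UE s : 0 <= s <= 1 -> U s = u (expi s).
  by move=> s01; rewrite /U patchE mem_set//= in_itv.
have := lebesgue_differentiation (integrable_locally_restrict mI iue).
move=> [N [mN N0 hN]]; apply: ae_lebesgue_circle; exists N; split=> // t /= ht.
apply: hN => /= lpt; apply: ht => t01; exact: fatou_at_lebesgue_pt lpt t01.
Qed.

Lemma fatou_theorem (f : R[i] -> R[i]) : cL1 circ f -> \forall z \ae circ,
  Cint circ (fun w => f w * (poisson (r%:C * z * conjc w))%:C) @[r --> (1 : R)^'-] --> f z.
Proof.
move=> hf; have := fatou_real (cL1_Re hf); have := fatou_real (cL1_Im hf).
apply: filterS2 => z hi hr; apply: cvgc_ReIm.
- rewrite (_ : (fun r => _) =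
    (fun r => \int[circ]_w (complex.Re (f w) * poisson (r%:C * z * conjc w))))//.
  apply/funext => r; rewrite /Cint [LHS]/=; apply: eq_Rintegral => w _.
  by rewrite cReM /= mulr0 subr0.
- rewrite (_ : (fun r => _) =
    (fun r => \int[circ]_w (complex.Im (f w) * poisson (r%:C * z * conjc w))))//.
  apply/funext => r; rewrite /Cint [LHS]/=; apply: eq_Rintegral => w _.
  by rewrite cImM /= mulr0 add0r.
Qed.

Lemma cL1_Xn (f : R[i] -> R[i]) n : cL1 circ f -> cL1 circ (fun z => f z * z ^+ n).
Proof.
move=> hf; apply: (@cL1M _ _ _ _ _ _ 1) => //.
  by apply: measurable_cX; exact: measurable_id.
by apply: filterS ae_normc_circle => z z1; rewrite normcX z1 expr1n.
Qed.

Lemma cL1_conjXn (f : R[i] -> R[i]) n : cL1 circ f -> cL1 circ (fun z => f z * conjc z ^+ n).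
Proof.
move=> hf; apply: (@cL1M _ _ _ _ _ _ 1) => //.
  by apply: measurable_cX; apply: measurable_cconj; exact: measurable_id.
by apply: filterS ae_normc_circle => z z1; rewrite normcX normc_conj z1 expr1n.
Qed.

Lemma taylor_poisson (f : R[i] -> R[i]) (b : R[i]) : cL1 circ f ->
  (forall n, Cint circ (fun z => f z * z ^+ n.+1) = 0) -> normc b < 1 ->
  \sum_(j < N) Cint circ (fun z => f z * conjc z ^+ j) * b ^+ j @[N --> \oo] -->
  Cint circ (fun z => f z * (poisson (b * conjc z))%:C).
Proof.
move=> hf f0 b1; apply: (@cvg_taylor_poisson _ _ _ circ f id) => //.
by apply: filterS ae_normc_circle => z ->.
Qed.

(** Every Poisson integral of [f] reduces to its constant term, and the radial limits give back [f].
    Only integrability is assumed, because the lemma is applied to a squared modulus. *)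
Lemma fourier_cst (f : R[i] -> R[i]) : cL1 circ f ->
  (forall n, Cint circ (fun z => f z * z ^+ n.+1) = 0) ->
  (forall n, Cint circ (fun z => f z * conjc z ^+ n.+1) = 0) ->
  f = cst (Cint circ f) %[ae circ].
Proof.
move=> hf f0 f0'; have := fatou_theorem hf; have := @ae_normc_circle R.
apply: filterS2 => z z1 hz _ /=.
have E r : 0 <= r < 1 ->
    Cint circ (fun w => f w * (poisson (r%:C * z * conjc w))%:C) = Cint circ f.
  move=> /andP[r0 r1]; have b1 : normc (r%:C * z) < 1.
    by rewrite normcM z1 mulr1 normc_real ger0_norm.
  apply/esym; apply: cvgc_unique (taylor_poisson hf f0 b1).
  rewrite -(cvg_shiftS (fun N => \sum_(j < N) Cint circ (fun z => f z * conjc z ^+ j) * (r%:C * z) ^+ j)).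
  rewrite (_ : (fun N => _) = (fun=> Cint circ f)); first exact: cvg_cst.
  apply/funext => N; rewrite /= big_ord_recl expr0 mulr1 big1 ?addr0.
    by congr (Cint _ _); apply/funext => w; rewrite expr0 mulr1.
  by move=> j _; rewrite f0' mul0r.
apply: cvgc_unique hz _; apply: cvg_near_cst.
near=> r; apply: E; apply/andP; split; near: r.
- exact: nbhs_left_ge.
- exact: nbhs_left_lt.
Unshelve. all: by end_near. Qed.

End fatou_complex.

(** * The Hardy space *)

Section dominated_maps.
Context {R : realType}.
Local Notation circ := (@circle_measure R).

(** Composition with such a [v] is bounded on L2 and preserves almost-everywhere statements. The
    notion covers the identity and inner functions alike, so that [H2_dual] serves both for [H2]
    itself and for compositions. *)
Definition dominated_map (v : R[i] -> R[i]) (C : R) :=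
  [/\ measurable_fun [set: R[i]] v, 0 <= C &
  forall A, measurable A -> (circ (v @^-1` A) <= C%:E * circ A)%E].

Lemma dominated_id : dominated_map id 1.
Proof.
split=> //.
by move=> A mA; rewrite mul1e.
Qed.

Lemma dominated_ae v C (Q : R[i] -> Prop) : dominated_map v C ->
  (\forall z \ae circ, Q z) -> \forall z \ae circ, Q (v z).
Proof.
move=> [mv C0 hv] [N [mN N0 hN]]; exists (v @^-1` N); split.
- by rewrite -[X in measurable X]setTI; exact: mv.
- by apply/eqP; rewrite eq_le measure_ge0 andbT (le_trans (hv _ mN))// N0 mule0.
- by move=> z /= nQ; apply: hN.
Qed.

Lemma dominated_integral v C (u : R[i] -> R) : dominated_map v C ->
  measurable_fun [set: R[i]] u -> (forall z, 0 <= u z) ->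
  (\int[circ]_z (u (v z))%:E <= C%:E * \int[circ]_z (u z)%:E)%E.
Proof.
move=> [mv C0 hv] mu u0.
have mE : measurable_fun [set: R[i]] (fun z => (u z)%:E) by exact/measurable_EFinP.
pose phi : {mfun _ >-> _} := HB.pack v (isMeasurableFun.Build _ _ _ _ _ mv).
have <- : (\int[pushforward circ phi]_z (u z)%:E = \int[circ]_z (u (v z))%:E)%E.
  by rewrite ge0_integral_pushforward// => z _; rewrite lee_fin.
have <- : (\int[mscale (NngNum C0) circ]_z (u z)%:E = C%:E * \int[circ]_z (u z)%:E)%E.
  by rewrite ge0_integral_mscale//; move=> z _; rewrite lee_fin.
by apply: ge0_le_measure_integral => // A mA; exact: hv.
Qed.

Lemma dominated_cL2 v C (f : R[i] -> R[i]) : dominated_map v C -> cL2 circ f ->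
  cL2 circ (fun z => f (v z)) /\ n2 circ (fun z => f (v z)) <= C * n2 circ f.
Proof.
move=> dv [mf i]; have [mv C0 _] := dv.
have mfv : measurable_fun [set: R[i]] (fun z => f (v z)) by exact: measurableT_comp.
have le := dominated_integral dv (measurable_normc2 mf) (fun z => sqr_ge0 _).
rewrite -(EFin_rint i) -EFinM in le.
have h : cL2 circ (fun z => f (v z)).
  split=> //; apply: rint_ge0P; first exact: measurable_normc2.
    by move=> z; exact: sqr_ge0.
  by apply: le_lt_trans le _; rewrite ltry.
by split=> //; rewrite -lee_fin (EFin_rint h.2).
Qed.

End dominated_maps.

(** * From the disc to the circle: approximation and duality *)

Section hardy_space_duality.
Context {R : realType}.
Local Notation circ := (@circle_measure R).

Lemma measurable_unit_circle : measurable (@unit_circle R).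
Proof.
rewrite -[X in measurable X]setTI.
have := measurable_normc (@measurable_id _ _ [set: R[i]]).
by move=> /(_ measurableT [set 1] (measurable_set1 1)).
Qed.

(** The series converges at the intermediate radius [rho], so its terms there are bounded, and at
    radius [r] they decay geometrically, uniformly in [z]. The bound provides the domination in
    [H2_dual]. *)
Lemma analytic_sums_bounded (a : nat -> R[i]) (F : R[i] -> R[i]) (r : R) :
  (forall z, unit_disc z -> (fun n => \sum_(j < n) a j * z ^+ j) @ \oo --> F z) ->
  0 <= r < 1 -> exists K, forall N z, normc z = 1 ->
  normc (\sum_(j < N) a j * (r%:C * z) ^+ j) <= K.
Proof.
move=> ha /andP[r0 r1]; pose rho := (1 + r) / 2.
have rho0 : 0 < rho by rewrite /rho; lra.
have rho1 : rho < 1 by rewrite /rho; lra.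
have rrho : r < rho by rewrite /rho; lra.
have /ha/normc_cvgP hs : unit_disc rho%:C by rewrite /unit_disc/= normc_real gtr0_norm.
have [B hB] : exists B, forall n, normc (\sum_(j < n) a j * rho%:C ^+ j - F rho%:C) <= B.
  have /cvg_seq_bounded := cvgP _ hs.
  move=> [M [_ hM]]; exists (M + 1) => n; have := hM (M + 1).
  rewrite ltrDl ltr01 => /(_ isT n Logic.I); exact: le_trans (ler_norm _).
have aB n : normc (a n) * rho ^+ n <= 2 * B.
  have -> : normc (a n) * rho ^+ n = normc (a n * rho%:C ^+ n).
    by rewrite normcM normcX normc_real gtr0_norm.
  have -> : a n * rho%:C ^+ n = (\sum_(j < n.+1) a j * rho%:C ^+ j - F rho%:C) -
     (\sum_(j < n) a j * rho%:C ^+ j - F rho%:C).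
    by rewrite big_ord_recr /=; ring.
  rewrite (le_trans (ler_normcB _ _))//; have := hB n; have := hB n.+1; lra.
pose q := r / rho.
have q0 : 0 <= q by rewrite divr_ge0// ltW.
have q1 : q < 1 by rewrite ltr_pdivrMr// mul1r.
have B0 : 0 <= B by apply: le_trans (hB 0%N); exact: normc_ge0.
exists (2 * B * (1 + (1 - q)^-1)) => N z z1.
have le j : normc (a j * (r%:C * z) ^+ j) <= 2 * B * q ^+ j.
  rewrite normcM normcX normcM z1 mulr1 normc_real ger0_norm//.
  have -> : r ^+ j = rho ^+ j * q ^+ j by rewrite -exprMn /q mulrC divfK// gt_eqF.
  by rewrite mulrA ler_wpM2r// exprn_ge0.
apply: le_trans (normc_sum _ (fun j => a j * (r%:C * z) ^+ j)) _.
apply: (@le_trans _ _ (\sum_(j < N) 2 * B * q ^+ j)); first by apply: ler_sum => j _; exact: le.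
rewrite -mulr_sumr ler_wpM2l ?mulr_ge0//.
have h := @geometric_sum_le _ q N; rewrite q0 q1 in h.
have {}h := h isT; case: N h => [|N] h.
  by rewrite big_ord0 addr_ge0// invr_ge0 subr_ge0 ltW.
rewrite big_ord_recl expr0 lerD2l; apply: le_trans h.
by rewrite big_ord_recr /= lerDl exprn_ge0.
Qed.

(** The convergence theorems for integrals are about sequences; the shift by 2 puts all these radii
    inside []0, 1[]. *)
Lemma radial_sequence (F : R[i] -> R[i]) (z l : R[i]) :
  F (r%:C * z) @[r --> (1 : R)^'-] --> l ->
  F ((1 - n.+2%:R^-1)%:C * z) @[n --> \oo] --> l.
Proof.
move=> h; have c : (fun n : nat => 1 - (n.+2%:R : R)^-1) @ \oo --> (1 : R)^'-.
  move=> Q [e /= e0 he]; have := near_infty_natSinv_lt (PosNum e0).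
  apply: filterS => n /= hn; apply: he; rewrite /ball_ /=.
    rewrite subKr ger0_norm ?invr_ge0//; apply: le_lt_trans hn.
    by rewrite lef_pV2 ?posrE ?ltr0n// ler_nat.
  by rewrite ltrBlDr ltrDl invr_gt0 ltr0n.
exact: cvg_comp c h.
Qed.

(** [F] is arbitrary off the disc, so measurability can be claimed only for [z] on the circle; 0 is
    put elsewhere, and the cut-off partial sums then converge at every point. *)
Lemma measurable_analytic_circle (F : R[i] -> R[i]) (r : R) : analytic_on_disc F ->
  0 <= r < 1 ->
  measurable_fun [set: R[i]] (fun z => if normc z == 1 then F (r%:C * z) else 0).
Proof.
move=> [a ha] /andP[r0 r1].
pose h_ N (z : R[i]) : R[i] :=
  (\sum_(j < N) a j * (r%:C * z) ^+ j) * (\1_(@unit_circle R) z : R)%:C.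
apply: (measurable_ccvg (h := h_)) => [N|z]; rewrite /h_.
- apply: measurable_cM; last first.
    by apply: measurable_realc; apply: measurable_indic; exact: measurable_unit_circle.
  elim: N => [|N ih]; first by under eq_fun do rewrite big_ord0; exact: measurable_cst.
  under eq_fun do rewrite big_ord_recr /=; apply: measurable_cD => //.
  apply: measurable_cM; first exact: measurable_cst.
  apply: measurable_cX; apply: measurable_cM; first exact: measurable_cst.
  exact: measurable_id.
- rewrite indicE; have [z1|z1] := eqVneq (normc z) 1.
    rewrite mem_set//= (_ : (fun N => _) = (fun N => \sum_(j < N) a j * (r%:C * z) ^+ j)).
      by apply: ha; rewrite /unit_disc /= normcM z1 mulr1 normc_real ger0_norm.
    by apply/funext => N; rewrite mulr1.
  rewrite memNset; last by move/eqP: z1.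
  rewrite (_ : (fun N => _) = (fun=> 0)); first exact: cvg_cst.
  by apply/funext => N; rewrite mulr0.
Qed.

(* [w_ n] is the disc function on the circle of radius [1 - 1 / (n + 2)]. *)
Lemma H2_approx (w : R[i] -> R[i]) : H2 w -> exists (M : R) (w_ : nat -> R[i] -> R[i])
    (c : nat -> nat -> R[i]) (K : nat -> R),
  [/\ measurable_fun [set: R[i]] w,
      forall n, cL2 circ (w_ n) /\ n2 circ (w_ n) <= M,
      \forall z \ae circ, w_ ^~ z @ \oo --> w z &
      forall n z, normc z = 1 ->
        (fun N => \sum_(j < N) c n j * z ^+ j) @ \oo --> w_ n z /\
        forall N, normc (\sum_(j < N) c n j * z ^+ j) <= K n].
Proof.
move=> [F [anF [M hM]] [mw radial]]; have [a ha] := anF.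
pose r n : R := 1 - n.+2%:R^-1.
have r01 n : 0 <= r n < 1.
  by rewrite /r subr_ge0 invf_le1 ?ler1n// ltrBlDr ltrDl invr_gt0 ltr0n.
have /choice[K hK] n := analytic_sums_bounded ha (r01 n).
pose w_ n z := if normc z == 1 then F ((r n)%:C * z) else 0.
pose c n j := a j * (r n)%:C ^+ j.
have sE n N z : \sum_(j < N) c n j * z ^+ j = \sum_(j < N) a j * ((r n)%:C * z) ^+ j.
  by apply: eq_bigr => j _; rewrite /c exprMn mulrA.
have wcvg n z : normc z = 1 -> (fun N => \sum_(j < N) c n j * z ^+ j) @ \oo --> w_ n z.
  move=> z1; rewrite /w_ z1 eqxx.
  rewrite (_ : (fun N => _) = (fun N => \sum_(j < N) a j * ((r n)%:C * z) ^+ j)).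
    have /andP[r0 r1] := r01 n.
    by apply: ha; rewrite /unit_disc /= normcM z1 mulr1 normc_real ger0_norm.
  by apply/funext => N; exact: sE.
have mw_ n : measurable_fun [set: R[i]] (w_ n) by exact: measurable_analytic_circle (r01 n).
have hL2 n : (\int[circ]_z (normc (w_ n z) ^+ 2)%:E <= M%:E)%E.
  apply: le_trans (hM _ (r01 n)); rewrite [leRHS]integral_mkcond.
  rewrite le_eqVlt; apply/orP; left; apply/eqP; apply: eq_integral => z _.
  rewrite patchE /w_; have [z1|z1] := eqVneq (normc z) 1.
    by rewrite mem_set.
  by rewrite memNset ?normc0 ?expr0n//; move/eqP: z1.
exists M, w_, c, K; split=> //.
- move=> n; have i : rint circ (fun z => normc (w_ n z) ^+ 2).
    apply: rint_ge0P; first exact: measurable_normc2.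
      by move=> z; exact: sqr_ge0.
    by apply: le_lt_trans (hL2 n) _; rewrite ltry.
  by split; [split|rewrite -lee_fin (EFin_rint i)].
- have := @ae_normc_circle R; apply: filterS2 radial => z hz z1.
  rewrite (_ : w_ ^~ z = (fun n => F ((r n)%:C * z))).
    exact: radial_sequence hz.
  by apply/funext => n; rewrite /w_ z1 eqxx.
- by move=> n z z1; split; [exact: wcvg|move=> N; rewrite sE; exact: hK].
Qed.

(** Fatou's lemma, from the uniform bound on the means over circles of radius less than 1. *)
Lemma H2_cL2 (w : R[i] -> R[i]) : H2 w -> cL2 circ w.
Proof.
move=> /H2_approx [M [w_ [c [K [mw hw ww _]]]]].
have [] := @Rint_fatou _ _ _ circ (fun n z => normc (w_ n z) ^+ 2)
  (fun z => normc (w z) ^+ 2) M _ _ _ _ _ _ => //.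
- by move=> n; exact: (hw n).1.2.
- by move=> n z; exact: sqr_ge0.
- exact: measurable_normc2.
- by move=> z; exact: sqr_ge0.
- apply: filterS ww => z /cvg_normc h.
  exact: (cvgM h h).
- by apply: nearW => n; exact: (hw n).2.
Qed.

(* The polynomials are only known to converge boundedly to [w_ n], and [w_ n]
   weakly to [w]. *)
Lemma H2_dual (w g v : R[i] -> R[i]) (C : R) : H2 w -> dominated_map v C ->
  (\forall z \ae circ, normc (v z) = 1) -> cL2 circ g ->
  (forall j, Cint circ (fun z => g z * v z ^+ j) = 0) ->
  Cint circ (fun z => g z * w (v z)) = 0.
Proof.
move=> wH2 dv v1 hg g0; have wL2 := H2_cL2 wH2.
have [M [w_ [c [K [mw hw ww wpoly]]]]] := H2_approx wH2.
have [mv C0 _] := dv.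
have [wvL2 _] := dominated_cL2 dv wL2.
have gvX j : cL1 circ (fun z => g z * v z ^+ j).
  apply: (@cL1M _ _ _ _ _ _ 1); [exact: cL2_cL1|exact: measurable_cX|].
  by apply: filterS v1 => z z1; rewrite normcX z1 expr1n.
(* At a fixed radius the Taylor polynomials are uniformly bounded on the circle, so dominated
   convergence applies. *)
have step n : Cint circ (fun z => g z * w_ n (v z)) = 0.
  have mwn : measurable_fun [set: R[i]] (fun z => w_ n (v z)).
    by apply: measurableT_comp => //; exact: (hw n).1.1.
  have E N : (fun z => g z * (\sum_(j < N) c n j * v z ^+ j)) =
      (fun z => \sum_(j < N) c n j * (g z * v z ^+ j)).
    by apply/funext => z; rewrite mulr_sumr; apply: eq_bigr => j _; ring.
  have S N : cL1 circ (fun z => g z * (\sum_(j < N) c n j * v z ^+ j)) /\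
     Cint circ (fun z => g z * (\sum_(j < N) c n j * v z ^+ j)) = 0.
    rewrite E; have [h1 h2] := @Cint_sum _ _ _ circ _ (index_enum 'I_N)
      (fun j z => c n j * (g z * v z ^+ j)) (fun j => cL1Z _ (gvX j)).
    split=> //; rewrite h2 big1// => j _.
    by rewrite CintZ// g0 mulr0.
  have mS N : measurable_fun [set: R[i]] (fun z => g z * (\sum_(j < N) c n j * v z ^+ j)).
    exact: (S N).1.1.
  have mgw : measurable_fun [set: R[i]] (fun z => g z * w_ n (v z)).
    by apply: measurable_cM => //; exact: hg.1.
  have cvgS : \forall z \ae circ,
      (fun N => g z * (\sum_(j < N) c n j * v z ^+ j)) @ \oo --> g z * w_ n (v z).
    apply: filterS v1 => z z1.
    have [hc _] := wpoly n _ z1.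
    have h : normc (\sum_(j < N) c n j * v z ^+ j - w_ n (v z)) @[N --> \oo] --> (0 : R).
      by apply/normc_cvgP.
    apply/normc_cvgP.
    rewrite (_ : (fun N => _) =
      (fun N => normc (g z) * normc (\sum_(j < N) c n j * v z ^+ j - w_ n (v z)))).
      by rewrite -(mulr0 (normc (g z))); apply: cvgM h; exact: cvg_cst.
    by apply/funext => N; rewrite -mulrBr normcM.
  have ig := rintZ (K n) (cL2_cL1 hg).2.
  have Sle : \forall z \ae circ, forall N,
      normc (g z * (\sum_(j < N) c n j * v z ^+ j)) <= K n * normc (g z).
    apply: filterS v1 => z z1 N; have [_ h] := wpoly n _ z1.
    by rewrite normcM mulrC ler_wpM2r ?normc_ge0.
  have [_ h] := Cint_dct mS mgw cvgS ig Sle.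
  apply: cvgc_unique h _.
  by rewrite (_ : (fun N => _) = (fun=> 0)); [exact: cvg_cst|apply/funext => N; exact: (S N).2].
have hwn n : cL2 circ (fun z => w_ n (v z) - w (v z)).
  by apply: cL2B => //; exact: (dominated_cL2 dv (hw n).1).1.
(* The bound on squared norms: [C] is the price of composing with [v], and each factor 2 that of
   taking a difference. *)
have weak := @bounded_cvg_weak _ _ _ circ (fun n z => w_ n (v z) - w (v z)) g
  (2 * (C * M) + 2 * (C * n2 circ w)) hwn _ _ hg.
have lim : Cint circ (fun z => g z * w_ n (v z)) @[n --> \oo] --> Cint circ (fun z => g z * w (v z)).
  apply: n1_cvg0_Cint.
  - by move=> n; apply: cL2_cL1M => //; exact: (dominated_cL2 dv (hw n).1).1.
  - exact: cL2_cL1M.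
  rewrite (_ : (fun n => _) = (fun n => n1 circ (fun z => (w_ n (v z) - w (v z)) * g z))).
    apply: weak.
    + move=> n; have [w1 w2] := dominated_cL2 dv (hw n).1.
      have [_ le] := cL2_n2D w1 (cL2N wvL2); apply: le_trans le _.
      apply: lerD; apply: ler_wpM2l => //.
        by apply: le_trans w2 _; apply: ler_wpM2l => //; exact: (hw n).2.
      have -> : n2 circ (fun z => - w (v z)) = n2 circ (fun z => w (v z)).
        by congr (Rintegral _ _ _); apply/funext => z; rewrite normcNc.
      exact: (dominated_cL2 dv wL2).2.
    + apply: filterS (dominated_ae dv ww) => z /normc_cvgP hz.
      by apply/normc_cvgP; under eq_fun do rewrite subr0.
  apply/funext => n; congr (Rintegral _ _ _); apply/funext => z.
  by congr normc; ring.
apply: cvgc_unique lim _.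
by rewrite (_ : (fun n => _) = (fun=> 0)); [exact: cvg_cst|apply/funext => n; exact: step].
Qed.

End hardy_space_duality.

(** * From Fourier coefficients back to the disc *)

Section fourier_characterization.
Context {R : realType}.
Local Notation circ := (@circle_measure R).
Implicit Types (c : nat -> R[i]).

Lemma conjc_sum N (F : nat -> R[i]) :
  conjc (\sum_(j < N) F j) = \sum_(j < N) conjc (F j) :> R[i].
Proof.
elim: N => [|N ih]; first by rewrite !big_ord0 conjc0.
by rewrite !big_ord_recr /= conjcD ih.
Qed.

Lemma realc_sum N (F : nat -> R) :
  (\sum_(j < N) F j)%:C = \sum_(j < N) (F j)%:C :> R[i].
Proof.
elim: N => [|N ih]; first by rewrite !big_ord0.
by rewrite !big_ord_recr /= realcD ih.
Qed.

Lemma measurable_poly_sum c N :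
  measurable_fun [set: R[i]] (fun z : R[i] => \sum_(j < N) c j * z ^+ j).
Proof.
elim: N => [|N ih]; first by under eq_fun do rewrite big_ord0; exact: measurable_cst.
under eq_fun do rewrite big_ord_recr /=; apply: measurable_cD => //.
apply: measurable_cM; first exact: measurable_cst.
by apply: measurable_cX; exact: measurable_id.
Qed.

Lemma cL2_poly_sum c N : cL2 circ (fun z : R[i] => \sum_(j < N) c j * z ^+ j).
Proof.
apply: (@cL2_bounded _ _ _ _ _ (\sum_(j < N) normc (c j))); first exact: measurable_poly_sum.
apply: filterS ae_normc_circle => z z1.
apply: le_trans (normc_sum _ (fun j => c j * z ^+ j)) _.
by apply: ler_sum => j _; rewrite normcM normcX z1 expr1n mulr1.
Qed.

Lemma cL1_monomials i j : cL1 circ (fun z => z ^+ i * conjc z ^+ j).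
Proof.
apply: cL1_conjXn; apply: (@cL1_bounded _ _ _ _ _ 1).
  by apply: measurable_cX; exact: measurable_id.
by apply: filterS ae_normc_circle => z z1; rewrite normcX z1 expr1n.
Qed.

Lemma Cint_monomials i j : Cint circ (fun z => z ^+ i * conjc z ^+ j) = (i == j)%:R.
Proof.
have gt m n : (n < m)%N -> Cint circ (fun z => z ^+ m * conjc z ^+ n) = 0.
  move=> nm; rewrite -(@Cint_Xn R (m - n)) ?subn_gt0//; apply: Cint_ae.
  - by apply: (cL1_monomials m n).1.
  - by apply: measurable_cX; exact: measurable_id.
  - apply: filterS ae_normc_circle => z z1 _.
    rewrite -{1}(subnK (ltnW nm)) exprD -mulrA -exprMn mulc_conj z1.
    by rewrite expr1n expr1n mulr1.
have [->|ij] := eqVneq i j.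
  rewrite -(@Cint_cst _ _ _ circ (1 : R[i])); apply: Cint_ae.
  - exact: (cL1_monomials j j).1.
  - exact: measurable_cst.
  - apply: filterS ae_normc_circle => z z1 _.
    by rewrite -exprMn mulc_conj z1 !expr1n.
move: ij; rewrite neq_ltn => /orP[ij|ji]; last exact: gt.
rewrite -[RHS]conjc0 -(gt _ _ ij) -Cint_conj; last exact: cL1_monomials.
by congr (Cint _ _); apply/funext => z; rewrite conjcM !conjcX conjcK mulrC.
Qed.

Lemma n2_poly_sum c N :
  n2 circ (fun z : R[i] => \sum_(j < N) c j * z ^+ j) = \sum_(j < N) normc (c j) ^+ 2.
Proof.
elim: N => [|N ih].
  rewrite big_ord0 /n2; under eq_Rintegral do rewrite big_ord0 normc0 expr0n /=.
  by rewrite Rint_cst.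
have hm : cL2 circ (fun z => - (c N * z ^+ N)).
  apply: cL2N; apply: (cL2Z _ _).1.
  apply: (@cL2_bounded _ _ _ _ _ 1); first by apply: measurable_cX; exact: measurable_id.
  by apply: filterS ae_normc_circle => z z1; rewrite normcX z1 expr1n.
have -> : n2 circ (fun z : R[i] => \sum_(j < N.+1) c j * z ^+ j) =
    n2 circ (fun z : R[i] => (\sum_(j < N) c j * z ^+ j) - (- (c N * z ^+ N))).
  by congr (Rintegral _ _ _); apply/funext => z; rewrite big_ord_recr /= opprK.
rewrite n2B//; last exact: cL2_poly_sum.
have -> : Cint circ (fun z => (\sum_(j < N) c j * z ^+ j) * conjc (- (c N * z ^+ N))) = 0.
  have [_ E] := @Cint_sum _ _ _ circ _ (index_enum 'I_N)
    (fun j z => (- (c j * conjc (c N))) * (z ^+ j * conjc z ^+ N))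
    (fun j => cL1Z _ (cL1_monomials j N)).
  have E' : (fun z => (\sum_(j < N) c j * z ^+ j) * conjc (- (c N * z ^+ N))) =
      (fun z => \sum_(j < N) (- (c j * conjc (c N))) * (z ^+ j * conjc z ^+ N)).
    apply/funext => z; rewrite mulr_suml; apply: eq_bigr => j _.
    by rewrite conjcN conjcM conjcX; ring.
  rewrite E' E big1// => j _; rewrite CintZ; last exact: cL1_monomials.
  by rewrite Cint_monomials (ltn_eqF (ltn_ord j)) mulr0.
have -> : n2 circ (fun z => - (c N * z ^+ N)) = normc (c N) ^+ 2.
  rewrite -(Rint_cst circ (normc (c N) ^+ 2)); apply: Rint_ae.
  - exact: measurable_normc2 hm.1.
  - exact: measurable_cst.
  - apply: filterS ae_normc_circle => z z1.
    by rewrite normcNc normcM normcX z1 expr1n mulr1.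
by rewrite ih big_ord_recr /= mulr0 subr0.
Qed.

(** The squared distance from [f] to its Fourier polynomial is nonnegative. *)
Lemma bessel (f : R[i] -> R[i]) N : cL2 circ f ->
  \sum_(j < N) normc (Cint circ (fun z => f z * conjc z ^+ j)) ^+ 2 <= n2 circ f.
Proof.
move=> hf; pose a j := Cint circ (fun z => f z * conjc z ^+ j).
have := n2_ge0 circ (fun z => f z - \sum_(j < N) a j * z ^+ j).
rewrite n2B//; last exact: cL2_poly_sum.
rewrite n2_poly_sum; have -> : Cint circ (fun z => f z * conjc (\sum_(j < N) a j * z ^+ j)) =
    (\sum_(j < N) normc (a j) ^+ 2)%:C.
  have [_ E] := @Cint_sum _ _ _ circ _ (index_enum 'I_N)
    (fun j z => conjc (a j) * (f z * conjc z ^+ j))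
    (fun j => cL1Z _ (cL1_conjXn j (cL2_cL1 hf))).
  have E' : (fun z => f z * conjc (\sum_(j < N) a j * z ^+ j)) =
      (fun z => \sum_(j < N) conjc (a j) * (f z * conjc z ^+ j)).
    apply/funext => z; rewrite (conjc_sum _ (fun j => a j * z ^+ j)) mulr_sumr; apply: eq_bigr => j _.
    by rewrite conjcM conjcX; ring.
  rewrite E' E (realc_sum _ (fun j => normc (a j) ^+ 2)); apply: eq_bigr => j _.
  rewrite CintZ; last by apply: cL1_conjXn; exact: cL2_cL1.
  by rewrite mulrC mulc_conj.
rewrite [complex.Re _]/= /a; lra.
Qed.

(** The extension to the disc is the Poisson integral of [f]. It is a power series because the
    coefficients of negative index vanish, its radial limits are [f] by Fatou's theorem, and its
    means over circles are at most [n2 circ f] by Bessel's inequality. *)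
Lemma H2_of_fourier (f : R[i] -> R[i]) : cL2 circ f ->
  (forall n, Cint circ (fun z => f z * z ^+ n.+1) = 0) -> H2 f.
Proof.
move=> hf f0; have f1 := cL2_cL1 hf.
pose F b := Cint circ (fun z => f z * (poisson (b * conjc z))%:C).
pose a j := Cint circ (fun z => f z * conjc z ^+ j).
have hF b : normc b < 1 -> (fun N => \sum_(j < N) a j * b ^+ j) @ \oo --> F b.
  exact: taylor_poisson.
exists F; last by split; [exact: hf.1|exact: fatou_theorem].
split; first by exists a => z hz; exact: hF.
exists (n2 circ f) => r /andP[r0 r1].
pose c j := a j * r%:C ^+ j.
have sE N z : \sum_(j < N) c j * z ^+ j = \sum_(j < N) a j * (r%:C * z) ^+ j.
  by apply: eq_bigr => j _; rewrite /c exprMn mulrA.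
pose h_ N (z : R[i]) : R[i] :=
  (\sum_(j < N) c j * z ^+ j) * (\1_(@unit_circle R) z : R)%:C.
pose h z := F (r%:C * z) * (\1_(@unit_circle R) z : R)%:C.
have mD := measurable_unit_circle.
have mh_ N : measurable_fun [set: R[i]] (h_ N).
  apply: measurable_cM; first exact: measurable_poly_sum.
  by apply: measurable_realc; exact: measurable_indic.
have hh z : h_ ^~ z @ \oo --> h z.
  rewrite /h_ /h indicE; have [z1|z1] := eqVneq (normc z) 1.
    rewrite mem_set//= mulr1.
    rewrite (_ : (fun N => _) = (fun N => \sum_(j < N) a j * (r%:C * z) ^+ j)).
      by apply: hF; rewrite normcM z1 mulr1 normc_real ger0_norm.
    by apply/funext => N; rewrite mulr1 sE.
  rewrite memNset; last by move/eqP: z1.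
  rewrite mulr0 (_ : (fun N => _) = (fun=> 0)); first exact: cvg_cst.
  by apply/funext => N; rewrite mulr0.
have mh : measurable_fun [set: R[i]] h by exact: measurable_ccvg mh_ hh.
have h_le N : cL2 circ (h_ N) /\ n2 circ (h_ N) <= n2 circ f.
  have [] := cL2_dom (mh_ N) (cL2_poly_sum c N).2 _.
    apply: aeW => z; rewrite /h_ normcM ler_sqr ?nnegrE ?mulr_ge0 ?normc_ge0//.
    rewrite ler_piMr ?normc_ge0// normc_real indicE.
    by case: (_ \in _); rewrite ?normr1 ?normr0.
  move=> h1 h2; split=> //; apply: le_trans h2 _.
  rewrite -/(n2 _ _) n2_poly_sum; apply: le_trans (bessel N hf).
  apply: ler_sum => j _; rewrite /c normcM ler_sqr ?nnegrE ?mulr_ge0 ?normc_ge0//.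
  rewrite ler_piMr ?normc_ge0// normcX normc_real ger0_norm//.
  by rewrite exprn_ile1// ltW.
have [] := @Rint_fatou _ _ _ circ (fun N z => normc (h_ N z) ^+ 2)
  (fun z => normc (h z) ^+ 2) (n2 circ f) _ _ _ _ _ _.
- by move=> N; exact: (h_le N).1.2.
- by move=> N z; exact: sqr_ge0.
- exact: measurable_normc2.
- by move=> z; exact: sqr_ge0.
- apply: aeW => z; have hn : normc (h_ n z) @[n --> \oo] --> normc (h z).
    exact: cvg_normc (hh z).
  exact: (cvgM hn hn).
- by apply: nearW => N; exact: (h_le N).2.
move=> ih ihle; rewrite integral_mkcond.
rewrite (_ : (\int[circ]_z _)%E = (\int[circ]_z (normc (h z) ^+ 2)%:E)%E).
  by rewrite -(EFin_rint ih) lee_fin.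
apply: eq_integral => z _; rewrite patchE /h indicE; case: ifPn => _.
  by rewrite mulr1.
by rewrite mulr0 normc0 expr0n.
Qed.

End fourier_characterization.

(** * Sums, products and limits in [H2] *)

Section hardy_space_algebra.
Context {R : realType}.
Local Notation circ := (@circle_measure R).
Implicit Types f g w : R[i] -> R[i].

Lemma measurable_Xn n : measurable_fun [set: R[i]] (fun z : R[i] => z ^+ n).
Proof. by apply: measurable_cX; exact: measurable_id. Qed.

Lemma ae_normcX n : \forall z \ae circ, normc (z ^+ n) <= 1.
Proof. by apply: filterS ae_normc_circle => z z1; rewrite normcX z1 expr1n. Qed.

Lemma cL2_Xn f n : cL2 circ f -> cL2 circ (fun z => f z * z ^+ n).
Proof. by move=> hf; case: (cL2M hf (measurable_Xn n) (ae_normcX n)). Qed.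

Lemma cL2_X n : cL2 circ (fun z => z ^+ n).
Proof. exact: cL2_bounded (measurable_Xn n) (ae_normcX n). Qed.

Lemma H2_orth g w : H2 w -> cL2 circ g -> (forall j, Cint circ (fun z => g z * z ^+ j) = 0) ->
  Cint circ (fun z => g z * w z) = 0.
Proof.
move=> hw hg g0; apply: (H2_dual hw dominated_id _ hg g0).
exact: ae_normc_circle.
Qed.

(** Duality against [z ^+ n.+1], whose products with all powers of [z] have mean 0. *)
Lemma H2_fourier0 f n : H2 f -> Cint circ (fun z => f z * z ^+ n.+1) = 0.
Proof.
move=> hf; have := H2_orth hf (cL2_X n.+1); under eq_fun do rewrite mulrC.
apply=> j; under eq_fun do rewrite -exprD; rewrite addSn; exact: Cint_Xn.
Qed.

(** A product of two functions of [H2] is only known to be integrable, so duality is used on each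
    factor in turn: for [w] against [f z * z ^+ n.+1], whose own moments vanish by [H2_fourier0]. *)
Lemma H2M_fourier0 f w n : H2 f -> H2 w ->
  Cint circ (fun z => f z * w z * z ^+ n.+1) = 0.
Proof.
move=> hf hw; have := H2_orth hw (cL2_Xn n.+1 (H2_cL2 hf)).
rewrite (_ : (fun z => f z * z ^+ n.+1 * w z) = (fun z => f z * w z * z ^+ n.+1)).
  apply=> j; under eq_fun do rewrite -mulrA -exprD; rewrite addSn; exact: H2_fourier0.
by apply/funext => z; ring.
Qed.

Lemma H2_meas f : H2 f -> measurable_fun [set: R[i]] f.
Proof. by case=> F _ []. Qed.

Lemma H2_ae f g : measurable_fun [set: R[i]] g -> f = g %[ae circ] -> H2 f -> H2 g.
Proof.
move=> mg fg hf; apply: H2_of_fourier; first exact: cL2_ae mg fg (H2_cL2 hf).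
move=> n; rewrite -(H2_fourier0 n hf); apply: Cint_ae.
- by apply: measurable_cM => //; exact: measurable_Xn.
- by apply: measurable_cM; [exact: H2_meas|exact: measurable_Xn].
- by apply: filterS fg => z fg zT; rewrite -fg.
Qed.

Lemma H2M f b : H2 f -> H2 b -> Linf b -> H2 (fun z => f z * b z).
Proof.
move=> hf hb [mb [M bM]]; apply: H2_of_fourier; first by case: (cL2M (H2_cL2 hf) mb bM).
by move=> n; exact: H2M_fourier0.
Qed.

Lemma H2D f g : H2 f -> H2 g -> H2 (fun z => f z + g z).
Proof.
move=> hf hg; have f2 := H2_cL2 hf; have g2 := H2_cL2 hg.
apply: H2_of_fourier; first exact: cL2D.
move=> n; under eq_fun do rewrite mulrDl.
by rewrite CintD ?H2_fourier0 ?addr0//; apply: cL1_Xn; exact: cL2_cL1.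
Qed.

Lemma H2Z (c : R[i]) f : H2 f -> H2 (fun z => c * f z).
Proof.
move=> hf; have f2 := H2_cL2 hf.
apply: H2_of_fourier; first by case: (cL2Z c f2).
move=> n; under eq_fun do rewrite -mulrA.
by rewrite CintZ ?H2_fourier0 ?mulr0//; apply: cL1_Xn; exact: cL2_cL1.
Qed.

Lemma H2_X n : H2 (fun z : R[i] => z ^+ n).
Proof.
apply: H2_of_fourier; first exact: cL2_X.
by move=> m; under eq_fun do rewrite -exprD; rewrite addnS; exact: Cint_Xn.
Qed.

Lemma H2_cst (c : R[i]) : H2 (fun=> c).
Proof.
have := H2Z c (H2_X 0); congr H2; apply/funext => z.
by rewrite expr0 mulr1.
Qed.

Lemma Linf_cst (c : R[i]) : Linf (fun=> c).
Proof. by split; [exact: measurable_cst|exists (normc c); apply: aeW => z]. Qed.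

Lemma Linf_X n : Linf (fun z : R[i] => z ^+ n).
Proof. by split; [exact: measurable_Xn|exists 1; exact: ae_normcX]. Qed.

Lemma LinfM f g : Linf f -> Linf g -> Linf (fun z => f z * g z).
Proof.
move=> [mf [M fM]] [mg [N gN]]; split; first exact: measurable_cM.
exists (M * N); apply: filterS2 fM gN => z h1 h2.
by rewrite normcM ler_pM ?normc_ge0.
Qed.

Lemma LinfD f g : Linf f -> Linf g -> Linf (fun z => f z + g z).
Proof.
move=> [mf [M fM]] [mg [N gN]]; split; first exact: measurable_cD.
exists (M + N); apply: filterS2 fM gN => z h1 h2.
by rewrite (le_trans (ler_normcD _ _))// lerD.
Qed.

Lemma Linf_conj f : Linf f -> Linf (fun z => conjc (f z)).
Proof.
move=> [mf [M fM]]; split; first exact: measurable_cconj.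
by exists M; apply: filterS fM => z; rewrite normc_conj.
Qed.

Lemma cL2_Linf f g : cL2 circ f -> Linf g -> cL2 circ (fun z => f z * g z).
Proof. by move=> hf [mg [M gM]]; case: (cL2M hf mg gM). Qed.

Lemma H2_cvg (f_ : nat -> R[i] -> R[i]) f : (forall n, H2 (f_ n)) -> cL2 circ f ->
  n2 circ (fun z => f_ n z - f z) @[n --> \oo] --> 0 -> H2 f.
Proof.
move=> hf_ hf lim; apply: H2_of_fourier => // n.
have := n2_cvg_Cint (fun k => H2_cL2 (hf_ k)) hf (cL2_X n.+1) lim.
move=> h; apply: cvgc_unique h _.
rewrite (_ : (fun k => _) = (fun=> 0)); first exact: cvg_cst.
by apply/funext => k; exact: H2_fourier0.
Qed.

(* [Cint circ f] is the value at the origin of the extension of [f]. *)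
Lemma Cint_H2M f w : H2 f -> H2 w -> Cint circ (fun z => f z * w z) = Cint circ f * Cint circ w.
Proof.
move=> hf hw; have f2 := H2_cL2 hf; have w2 := H2_cL2 hw.
have g2 : cL2 circ (fun z => f z - Cint circ f) by apply: cL2B => //; exact: H2_cL2 (H2_cst _).
have := H2_orth hw g2; under eq_fun do rewrite mulrBl.
have h1 : cL1 circ (fun z => f z * w z) by exact: cL2_cL1M.
have h2 : cL1 circ (fun z => Cint circ f * w z) by apply: cL1Z; exact: cL2_cL1.
rewrite CintB// CintZ; last exact: cL2_cL1.
move=> h; apply/eqP; rewrite -subr_eq0; apply/eqP; apply: h => -[|j].
  under eq_fun do rewrite expr0 mulr1.
  by rewrite CintB ?Cint_cst ?subrr//; [exact: cL2_cL1|exact: cL2_cL1 (H2_cL2 (H2_cst _))].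
exact: H2_fourier0 (H2D hf (H2_cst (- Cint circ f))).
Qed.

Lemma Hinf_H2 f : Hinf f -> H2 f /\ Linf f.
Proof.
move=> [F [aF [M hM]] [mf radial]]; split.
  exists F; last by [].
  split=> //; exists (M ^+ 2) => r r01; have /andP[r0 r1] := r01.
  have M0 : 0 <= M by apply: le_trans (hM 0 _); rewrite ?normc_ge0// /unit_disc /= normc0.
  have mF := measurable_normc2 (measurable_analytic_circle aF r01).
  have FM z : normc (if normc z == 1 then F (r%:C * z) else 0) ^+ 2 <= M ^+ 2.
    rewrite ler_sqr ?nnegrE ?normc_ge0//; case: ifPn => [/eqP z1|_]; last by rewrite normc0.
    by apply: hM; rewrite /unit_disc /= normcM z1 mulr1 normc_real ger0_norm.
  have [i le] := rint_dom mF (fun z => sqr_ge0 _) (rint_cst circ (M ^+ 2)) (aeW _ FM).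
  rewrite Rint_cst -lee_fin (EFin_rint i) in le; apply: le_trans le.
  rewrite integral_mkcond le_eqVlt; apply/orP; left; apply/eqP; apply: eq_integral => z _.
  rewrite patchE; have [z1|z1] := eqVneq (normc z) 1; first by rewrite mem_set.
  by rewrite memNset ?normc0 ?expr0n//; move/eqP: z1.
split=> //; exists M; have := @ae_normc_circle R; apply: filterS2 radial => z hz z1.
have h : normc (F ((1 - n.+2%:R^-1)%:C * z)) @[n --> \oo] --> normc (f z).
  exact: cvg_normc (radial_sequence hz).
rewrite -(cvg_lim (@Rhausdorff R) h).
apply: limr_le; first exact: cvgP h.
apply: nearW => n; apply: hM.
rewrite /unit_disc /= normcM z1 mulr1 normc_real.
have n0 : 0 < n.+2%:R^-1 :> R by rewrite invr_gt0 ltr0n.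
have n1 : n.+2%:R^-1 <= 1 :> R by rewrite invf_le1 ?ler1n ?ltr0n.
by rewrite ger0_norm ?subr_ge0// ltrBlDr ltrDl.
Qed.

End hardy_space_algebra.

(** * Inner functions and composition *)

Section inner_functions.
Context {R : realType}.
Local Notation expi := (@expi R).
Local Notation circ := (@circle_measure R).
Local Notation leb := (@lebesgue_measure R).
Implicit Types psi : R[i] -> R[i].

Lemma inner_H2 psi : inner psi -> H2 psi /\ Linf psi.
Proof. by case=> /Hinf_H2. Qed.

Lemma ae_le_of_eq (psi : R[i] -> R[i]) : (\forall z \ae circ, normc (psi z) = 1) ->
  \forall z \ae circ, normc (psi z) <= 1.
Proof. by apply: filterS => z ->. Qed.

Lemma H2X psi n : H2 psi -> Linf psi -> H2 (fun z => psi z ^+ n) /\ Linf (fun z => psi z ^+ n).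
Proof.
move=> h2 hinf; elim: n => [|n [ih1 ih2]].
  by under eq_fun do rewrite expr0; split; [exact: H2_cst|exact: Linf_cst].
under eq_fun do rewrite exprS.
by split; [exact: H2M|exact: LinfM].
Qed.

Lemma Cint_H2X psi n : H2 psi -> Linf psi ->
  Cint circ (fun z => psi z ^+ n) = Cint circ psi ^+ n.
Proof.
move=> h2 hinf; elim: n => [|n ih].
  by under eq_fun do rewrite expr0; rewrite Cint_cst.
under eq_fun do rewrite exprS.
by rewrite (Cint_H2M h2 (H2X n h2 hinf).1) ih exprS.
Qed.

(** The squared distance from [psi] to its mean [a] is [1 - normc a ^+ 2]; were [normc a] at least
    1, it would vanish and [psi] be constant. This plays the part of the maximum principle. *)
Lemma unimodular_mean_lt1 psi : H2 psi -> (\forall z \ae circ, normc (psi z) = 1) ->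
  nonconstant psi -> normc (Cint circ psi) < 1.
Proof.
move=> h2 p1 nc; have p2 := H2_cL2 h2.
set a := Cint circ psi; have ha : cL2 circ (fun=> a) by exact: H2_cL2 (H2_cst a).
have nE : n2 circ (fun z => psi z - a) = 1 - normc a ^+ 2.
  rewrite (n2B p2 ha).
  have -> : Cint circ (fun z => psi z * conjc a) = (normc a ^+ 2)%:C.
    by under eq_fun do rewrite mulrC; rewrite (CintZ _ (cL2_cL1 p2)) mulrC mulc_conj.
  have -> : n2 circ (fun=> a) = normc a ^+ 2 by rewrite /n2 Rint_cst.
  have -> : n2 circ psi = 1.
    rewrite -(Rint_cst circ 1); apply: Rint_ae.
    - exact: measurable_normc2 p2.1.
    - exact: measurable_cst.
    - by apply: filterS p1 => z ->; rewrite expr1n.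
  by rewrite [complex.Re _]/=; ring.
have h0 := n2_ge0 circ (fun z => psi z - a).
rewrite ltNge; apply/negP => a1; apply: nc; exists a.
have n0 : n2 circ (fun z => psi z - a) = 0.
  apply/eqP; rewrite eq_le h0 andbT nE subr_le0.
  by rewrite -{1}(expr1n _ 2) ler_sqr ?nnegrE ?normc_ge0.
have := n2_eq0 (cL2B p2 ha) n0; apply: filterS => z hz zT.
by have := hz zT; move=> /eqP; rewrite subr_eq0 => /eqP.
Qed.

(** The mean is multiplicative on [H2], so the moments of [psi] are the powers of its mean, and the
    mean of the kernel is the kernel at [b] times that mean. The bound does not depend on [b]: it
    becomes the constant of [inner_dominated]. *)
Lemma poisson_mean_le psi (b : R[i]) : H2 psi -> Linf psi ->
  (\forall z \ae circ, normc (psi z) = 1) -> normc (Cint circ psi) < 1 -> normc b < 1 ->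
  rint circ (fun z => poisson (b * psi z)) /\
  \int[circ]_z poisson (b * psi z) <= 2 / (1 - normc (Cint circ psi)).
Proof.
move=> h2 hinf p1 a1 b1; have p1' := ae_le_of_eq p1.
have mpsi : measurable_fun [set: R[i]] psi := hinf.1.
have mb : measurable_fun [set: R[i]] (fun z => b * psi z).
  by apply: measurable_cM => //; exact: measurable_cst.
have rp : rint circ (fun z => poisson (b * psi z)).
  have d0 : 0 < 1 - normc b by rewrite subr_gt0.
  have mp := measurable_poisson mb.
  have [] := @rint_dom _ _ _ circ (fun z => `|poisson (b * psi z)|) (fun=> 2 / (1 - normc b)).
  - exact: measurableT_comp.
  - by move=> z; exact: normr_ge0.
  - exact: rint_cst.
  - apply: filterS p1 => z z1.
    have nb : normc (b * psi z) = normc b by rewrite normcM z1 mulr1.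
    rewrite ger0_norm; last by apply: poisson_ge0; rewrite nb ltW.
    by rewrite -nb; apply: poisson_le; rewrite nb.
  by move=> ia _; exact: rint_absdom mp ia (fun w => lexx _).
split=> //.
have := Cint_poisson_moments hinf.1 p1' (fun n => Cint_H2X n.+1 h2 hinf) (ltW a1) b1.
move=> /(congr1 (fun x : R[i] => complex.Re x)) /= ->.
have ba : normc (b * Cint circ psi) <= normc (Cint circ psi).
  by rewrite normcM ler_piMl ?normc_ge0// ltW.
apply: le_trans (poisson_le (le_lt_trans ba a1)) _.
rewrite ler_pM2l// lef_pV2 ?posrE ?subr_gt0//; last exact: le_lt_trans a1.
by rewrite lerD2l lerN2.
Qed.

(** Where [psi z = 1] the kernel at [(1 - e)%:C * psi z] is at least [e^-1], while its mean is at
    most [C]; that set has measure at most [C * e] for every small [e]. The point 1 matters because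
    its angles are the endpoints 0 and 1, which the kernel estimates exclude. *)
Lemma ae_inner_neq1 psi : H2 psi -> Linf psi -> (\forall z \ae circ, normc (psi z) = 1) ->
  normc (Cint circ psi) < 1 -> \forall z \ae circ, psi z != 1.
Proof.
move=> h2 hinf p1 a1; set C := 2 / (1 - normc (Cint circ psi)).
have C0 : 0 < C by rewrite divr_gt0// subr_gt0.
pose N := [set z | psi z = 1].
have mN : measurable N.
  have mB := measurable_normc (measurable_cB hinf.1 (measurable_cst (1 : R[i]))).
  have := mB measurableT [set 0] (measurable_set1 0); rewrite setTI.
  congr measurable; apply/seteqP; split => z /=; rewrite /N /=.
    by move=> /eq0_normc /eqP; rewrite subr_eq0 => /eqP.
  by move=> ->; rewrite subrr normc0.
pose p := \int[circ]_z (\1_N z : R).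
have iN : rint circ (fun z => \1_N z : R) by exact: integrable_indic.
have N0 z : 0 <= (\1_N z : R) by rewrite indicE.
have p0 : 0 <= p by apply: Rint_ge0.
have key e : 0 < e -> e <= 1 -> p <= C * e.
  move=> e0 e1; have e1' : 0 <= 1 - e by rewrite subr_ge0.
  have nr : normc (1 - e)%:C < 1 :> R by rewrite normc_real ger0_norm// ltrBlDr ltrDl.
  have [ip le] := poisson_mean_le h2 hinf p1 a1 nr.
  have mu : measurable_fun [set: R[i]] (fun z => e^-1 * (\1_N z : R)).
    by apply: measurable_funM; [exact: measurable_cst|exact: measurable_indic].
  have u0 z : 0 <= e^-1 * (\1_N z : R) by rewrite mulr_ge0// invr_ge0 ltW.
  have ule : \forall z \ae circ, e^-1 * (\1_N z : R) <= poisson ((1 - e)%:C * psi z).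
    apply: filterS p1 => z z1.
    have nb : normc ((1 - e)%:C * psi z) < 1 by rewrite normcM z1 mulr1.
    rewrite indicE; have [zN|zN] := pselect (N z); last first.
      by rewrite memNset// mulr0; apply: poisson_ge0; exact: ltW.
    rewrite mem_set// mulr1 (_ : psi z = 1)// mulr1 /poisson.
    have -> : 1 - (1 - e)%:C = e%:C :> R[i] by rewrite realcB; ring.
    rewrite !normc_real (ger0_norm e1') (gtr0_norm e0) ler_pdivlMr ?exprn_gt0//.
    rewrite expr2 mulrA mulVf ?gt_eqF// mul1r sqrrB expr1n.
    have : e * e <= e by rewrite ler_piMr// ltW.
    by rewrite expr2; lra.
  have [_] := rint_dom mu u0 ip ule; rewrite RintZ// -/p => h.
  have := le_trans h le; rewrite -/C ler_pdivrMl// mulrC.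
  by [].
have pe : p = 0.
  apply/eqP; rewrite eq_le p0 andbT leNgt; apply/negP => pp.
  pose e := Num.min 1 (p / (2 * C)).
  have e0 : 0 < e by rewrite lt_min ltr01 divr_gt0// mulr_gt0.
  have e1 : e <= 1 by rewrite ge_min lexx.
  have e2 : e <= p / (2 * C) by rewrite ge_min lexx orbT.
  have := key e e0 e1; apply/negP; rewrite -ltNge.
  have : C * e <= C * (p / (2 * C)) by rewrite ler_pM2l.
  have -> : C * (p / (2 * C)) = p / 2 by field; rewrite gt_eqF.
  by lra.
have := Rint_eq0 iN N0 pe; apply: filterS => z /eqP.
rewrite indicE pnatr_eq0 eqb0 => zN; apply/eqP => z1; move/negP: zN; apply.
by rewrite inE.
Qed.

(** The kernel has total mass 1, and off a ball of radius [del] around [t] it is at most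
    [C * (1 - r) / del ^+ 2]. *)
Lemma poisson_mass_open (t : R) (V : set R) : 0 < t < 1 -> measurable V -> nbhs t V ->
  exists2 K, 0 <= K & forall r, 0 <= r < 1 ->
  ((1 - K * (1 - r))%:E <= \int[leb]_(s in `[0%R, 1%R])
     (`|poisson (r%:C * expi t * conjc (expi s))| * \1_V s)%:E)%E.
Proof.
move=> t01 mV [del /= del0 hdel]; have [C C0 hC] := poisson_expi_le t01.
exists (C / del ^+ 2); first by rewrite divr_ge0 ?sqr_ge0// ltW.
move=> r r01; have /andP[r0 r1] := r01; have e0 : 0 < 1 - r by rewrite subr_gt0.
pose q w := `|poisson (r%:C * expi t * conjc w)|.
have mp : measurable_fun [set: R[i]] (fun w => poisson (r%:C * expi t * conjc w)).
  apply: measurable_poisson; apply: measurable_cM; first exact: measurable_cst.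
  by apply: measurable_cconj; exact: measurable_id.
have mq : measurable_fun [set: R[i]] q by exact: measurableT_comp.
have q0 w : 0 <= q w by exact: normr_ge0.
have nr w : normc w = 1 -> normc (r%:C * expi t * conjc w) = r.
  by move=> w1; rewrite !normcM normc_conj w1 normc_expi !mulr1 normc_real ger0_norm.
have qE w : normc w = 1 -> q w = poisson (r%:C * expi t * conjc w).
  by move=> w1; rewrite /q ger0_norm//; apply: poisson_ge0; rewrite nr// ltW.
have iq : rint circ q.
  have [] := rint_dom mq q0 (rint_cst circ (2 / (1 - r))) _ => //.
  apply: filterS ae_normc_circle => w w1; rewrite qE//.
  have := @poisson_le _ (r%:C * expi t * conjc w); rewrite nr//; exact.
have q1 : \int[circ]_w q w = 1.
  have n1 : normc (r%:C * expi t) < 1.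
    by rewrite normcM normc_expi mulr1 normc_real ger0_norm.
  have := Cint_poisson_circle n1; move=> /(congr1 (fun x : R[i] => complex.Re x)) /= <-.
  apply: Rint_ae => //.
  by apply: filterS ae_normc_circle => w; exact: qE.
have {}q1 : (\int[leb]_(s in `[0%R, 1%R]) (q (expi s))%:E = 1%:E)%E.
  have mqE : measurable_fun [set: R[i]] (fun w => (q w)%:E) by exact/measurable_EFinP.
  have <- := ge0_integral_circle mqE (fun w => q0 w).
  by rewrite -(EFin_rint iq) q1.
pose c := C / del ^+ 2 * (1 - r).
have c0 : 0 <= c by rewrite mulr_ge0 ?divr_ge0 ?sqr_ge0 ?(ltW C0)// ltW.
have point s : `[0, 1]%classic s -> q (expi s) <= q (expi s) * \1_V s + c.
  rewrite /= in_itv /= => s01; rewrite indicE.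
  have [sV|sV] := pselect (V s); first by rewrite mem_set// mulr1 lerDl.
  rewrite memNset// mulr0 add0r qE ?normc_expi//; apply: le_trans (hC r s r01 s01) _.
  rewrite /c -mulrA ler_pM2l// mulrC ler_pM2r//.
  have ds : del <= `|s - t|.
    by rewrite leNgt; apply/negP => hlt; apply: sV; apply: hdel; rewrite /ball_ /= distrC.
  rewrite lef_pV2 ?posrE ?exprn_gt0//; last by rewrite ltr_pwDl ?sqr_ge0// exprn_gt0.
  rewrite -[(s - t) ^+ 2]real_normK ?num_real//.
  apply: (@le_trans _ _ (`|s - t| ^+ 2)); last by rewrite lerDr sqr_ge0.
  by rewrite ler_sqr ?nnegrE// ltW.
have mI : measurable (`[0, 1]%classic : set R) by exact: measurable_itv.
have mqe : measurable_fun [set: R] (fun s => q (expi s)).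
  by apply: measurableT_comp => //; exact: measurable_expi.
have mqV : measurable_fun [set: R] (fun s => q (expi s) * \1_V s).
  by apply: measurable_funM => //; exact: measurable_indic.
have mqVE : measurable_fun (`[0, 1]%classic : set R) (fun s => (q (expi s) * \1_V s)%:E).
  by apply: measurable_funTS; exact/measurable_EFinP.
have qV0 s : 0 <= q (expi s) * \1_V s :> R by rewrite mulr_ge0// indicE.
have le1 : (1%:E <= \int[leb]_(s in `[0%R, 1%R]) ((q (expi s) * \1_V s)%:E + c%:E))%E.
  rewrite -[X in (X <= _)%E]q1; apply: ge0_le_integral => //.
  - by move=> s _; rewrite lee_fin.
  - by apply: measurable_funTS; exact/measurable_EFinP.
  - by apply: emeasurable_funD => //; exact: measurable_cst.
rewrite ge0_integralD// in le1; last by move=> s _; rewrite lee_fin.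
rewrite integral_cst// in le1.
have l1 : leb (`[0%R, 1%R]%classic : set R) = 1%E.
  by rewrite lebesgue_measure_itv/= lte_fin ltr01 oppr0 adde0.
move: le1; rewrite [X in (_ * X)%E](_ : _ = 1%E)// mule1.
rewrite EFinB; move=> le1; rewrite leeBlDr//.
Qed.

(* By outer regularity it suffices to bound [psi^-1 A] by the measure of an open
   [V] containing the angles of [A]. The Poisson mass of [V] at [psi z] tends to
   [1] there, and its mean over [z] is at most [C |V|]. *)
Lemma inner_dominated psi : inner psi -> nonconstant psi -> exists C, dominated_map psi C.
Proof.
move=> ipsi nc; have [h2 hinf] := inner_H2 ipsi; have [_ p1] := ipsi.
have a1 := unimodular_mean_lt1 h2 p1 nc.
have pn1 := ae_inner_neq1 h2 hinf p1 a1.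
set C := 2 / (1 - normc (Cint circ psi)).
have C0 : 0 < C by rewrite divr_gt0// subr_gt0.
have mpsi : measurable_fun [set: R[i]] psi := hinf.1.
exists C; split=> //; first exact: ltW.
move=> A mA; apply/lee_addgt0Pr => e e0.
have mI : measurable (`[0, 1]%classic : set R) by exact: measurable_itv.
pose A' : set R := expi @^-1` A `&` `[0, 1].
have mA' : measurable A'.
  apply: measurableI => //; rewrite -[X in measurable X]setTI.
  by apply: measurable_expi.
have A'E : circ A = leb A' by [].
have A'oo : (leb A' < +oo)%E.
  rewrite -A'E; apply: le_lt_trans (probability_le1 circ mA) _; exact: ltry.
(* The excess of the open set over [A'] will be multiplied by [C], which gives back [e]. *)
have eC : 0 < e / C by rewrite divr_gt0.
have [U [oU A'U Ue]] := lebesgue_regularity_outer mA' A'oo eC.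
have mU : measurable U by exact: open_measurable.
pose V : set R := U `&` `]0, 1[.
have mV : measurable V by apply: measurableI => //; exact: measurable_itv.
have lV : (leb V <= leb A' + (e / C)%:E)%E.
  apply: (@le_trans _ _ (leb U)); first by apply: le_measure; rewrite ?inE//; exact: subIsetl.
  have := measureU2 leb mA' (measurableD mU mA'); rewrite setDUK// => /le_trans; apply.
  by apply: leeD => //; exact: ltW.
have mpre : measurable (psi @^-1` A).
  by rewrite -[X in measurable X]setTI; exact: mpsi.
suff key : (circ (psi @^-1` A) <= C%:E * leb V)%E.
  apply: le_trans key _; apply: (@le_trans _ _ (C%:E * (leb A' + (e / C)%:E))%E).
    by apply: lee_wpmul2l => //; rewrite lee_fin ltW.
  have ec0 : (0 <= (e / C)%:E)%E by rewrite lee_fin ltW.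
  rewrite (ge0_muleDr _ (measure_ge0 leb A') ec0) -EFinM A'E.
  by rewrite [C * _]mulrC divfK ?gt_eqF.
pose r n : R := 1 - n.+2%:R^-1.
have r01 n : 0 <= r n < 1.
  by rewrite /r subr_ge0 invf_le1 ?ler1n// ltrBlDr ltrDl invr_gt0 ltr0n.
pose D := psi @^-1` (@unit_circle R).
have mD : measurable D.
  by rewrite -[X in measurable X]setTI; apply: mpsi => //; exact: measurable_unit_circle.
(* The kernel may be negative on the null set where [psi] is not unimodular; the absolute value
   makes the integrand nonnegative everywhere, as Tonelli's theorem asks. *)
pose q n (x : R[i]) (s : R) := `|poisson ((r n)%:C * psi x * conjc (expi s))|.
pose f n (xs : R[i] * R) := (q n xs.1 xs.2 * \1_V xs.2)%:E.
have V0 s : 0 <= (\1_V s : R) by rewrite indicE.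
have q0 n x s : 0 <= q n x s by exact: normr_ge0.
have f0 n xs : (0 <= f n xs)%E by rewrite lee_fin mulr_ge0.
have m1 : measurable_fun [set: R[i] * R] (fun xs : R[i] * R => psi xs.1).
  by apply: measurableT_comp.
have m2 : measurable_fun [set: R[i] * R] (fun xs : R[i] * R => expi xs.2).
  by apply: measurableT_comp => //; exact: measurable_expi.
have m3 : measurable_fun [set: R[i] * R] (fun xs : R[i] * R => \1_V xs.2 : R).
  by apply: measurableT_comp => //; exact: measurable_indic.
have mf n : measurable_fun [set: R[i] * R] (f n).
  apply/measurable_EFinP; apply: measurable_funM => //.
  apply: measurableT_comp => //; apply: measurable_poisson; apply: measurable_cM.
    by apply: measurable_cM => //; exact: measurable_cst.
  exact: measurable_cconj.
pose G n x := (\int[leb]_s f n (x, s))%E.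
have G0 n x : (0 <= G n x)%E by apply: integral_ge0 => s _; exact: f0.
have mG n : measurable_fun [set: R[i]] (G n).
  exact: (measurable_fun_fubini_tonelli_F (m2 := leb) _ (mf n) (f0 n)).
(* Exchanging the integrals leaves, for each angle [s], a mean over [x] that [poisson_mean_le]
   bounds by [C]. *)
have intG n : (\int[circ]_x G n x <= C%:E * leb V)%E.
  rewrite /G (fubini_tonelli (m1 := circ) (m2 := leb) _ (mf n) (f0 n)).
  apply: (@le_trans _ _ (\int[leb]_s (C * \1_V s)%:E)%E); last first.
    under eq_integral do rewrite EFinM; rewrite ge0_integralZl//.
    - by rewrite integral_indic// setIT.
    - by apply/measurable_EFinP; exact: measurable_indic.
    - by rewrite lee_fin ltW.
  apply: ge0_le_integral => //.
  - by move=> s _; apply: integral_ge0 => x _; exact: f0.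
  - exact: (measurable_fun_fubini_tonelli_G (m1 := circ) _ (mf n) (f0 n)).
  - by apply/measurable_EFinP; apply: measurable_funM; [exact: measurable_cst|exact: measurable_indic].
  move=> s _; rewrite /f /=.
  pose b := (r n)%:C * conjc (expi s).
  have /andP[r0 r1] := r01 n.
  have b1 : normc b < 1 by rewrite normcM normc_conj normc_expi mulr1 normc_real ger0_norm.
  have [ip le] := poisson_mean_le h2 hinf p1 a1 b1.
  have qb x : poisson ((r n)%:C * psi x * conjc (expi s)) = poisson (b * psi x).
    by rewrite /b mulrAC.
  have iq : rint circ (fun x => q n x s).
    by have := integrable_norm ip; congr (_.-integrable _ _); apply/funext => x /=; rewrite /q qb.
  have qle : \int[circ]_x q n x s <= C.
    apply: le_trans le; rewrite le_eqVlt; apply/orP; left; apply/eqP; apply: Rint_ae.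
    - exact: rint_meas iq.
    - exact: rint_meas ip.
    - apply: filterS p1 => x x1; rewrite /q qb ger0_norm//; apply: poisson_ge0.
      by rewrite normcM x1 mulr1 ltW.
  under eq_integral do rewrite mulrC EFinM.
  have mqs : measurable_fun [set: R[i]] (fun x => (q n x s)%:E).
    by apply/measurable_EFinP; exact: rint_meas iq.
  have V0s : (0 <= (\1_V s : R)%:E)%E by rewrite lee_fin.
  rewrite (@ge0_integralZl _ _ R circ setT measurableT _ mqs _ (fun x _ => q0 n x s) V0s).
  rewrite -(EFin_rint iq) -EFinM lee_fin mulrC.
  by apply: ler_wpM2r.
(* Fatou's lemma in [n]: at almost every [x] with [psi x] in [A], the lower limit of [G n x] is at
   least 1. *)
apply: (@le_trans _ _ (\int[circ]_x limn_einf (G ^~ x))%E); last first.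
  apply: le_trans (fatou circ measurableT mG (fun n x _ => G0 n x)) _.
  rewrite limn_einf_lim; apply: lime_le; first exact: is_cvg_einfs.
  apply: nearW => n; apply: ge_ereal_inf; exists (\int[circ]_x G n x)%E => //.
  by exists n => /=.
have -> : (circ (psi @^-1` A) = \int[circ]_x (\1_(psi @^-1` A) x)%:E)%E.
  by rewrite integral_indic// setIT.
have G0' x : (0 <= limn_einf (G ^~ x))%E.
  rewrite limn_einf_lim; apply: lime_ge; first exact: is_cvg_einfs.
  by apply: nearW => n; apply: le_ereal_inf_tmp => _ [m /= _ <-]; exact: G0.
apply: ae_ge0_le_integral => //.
- by apply/measurable_EFinP; exact: measurable_indic.
- rewrite (_ : (fun _ => _) = (fun x => - limn_esup (fun n => - G n x)))%E.
    apply: measurableT_comp => //; apply: measurable_fun_limn_esup => n.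
    exact: measurableT_comp.
  by apply/funext => x; rewrite /limn_einf.
apply: filterS2 p1 pn1 => x x1 xn1 _; rewrite indicE.
have [xA|xA] := pselect ((psi @^-1` A) x); last by rewrite memNset.
rewrite mem_set//.
have [t /andP[t0 t1] tE] := expi_surj x1.
have tn0 : t != 0.
  apply/eqP => t0'; move/eqP: xn1; apply; rewrite -tE t0'.
  by have := expiX 0 (1 : R); rewrite mul0r expr0.
have tn1 : t != 1.
  by apply/eqP => t1'; move/eqP: xn1; apply; rewrite -tE t1' expi1.
have t01 : 0 < t < 1 by rewrite !lt_neqAle eq_sym tn0 tn1 t0.
have tV : nbhs t V.
  apply: open_nbhs_nbhs; split; first by apply: openI => //; exact: itv_open.
  split; last by rewrite /= in_itv.
  by apply: A'U; split; [rewrite /= tE|rewrite /= in_itv /= t0].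
have [K K0 hK] := poisson_mass_open t01 mV tV.
have GK n : ((1 - K * n.+2%:R^-1)%:E <= G n x)%E.
  have := hK (r n) (r01 n); rewrite {1}/r subKr => h; apply: le_trans h _.
  rewrite /G /f /q /= -tE; apply: ge0_subset_integral => //.
    apply/measurable_EFinP; apply: measurable_funM; last exact: measurable_indic.
    apply: measurableT_comp => //; apply: measurable_poisson.
    apply: measurable_cM; first exact: measurable_cst.
    exact: (measurable_cconj (@measurable_expi R)).
apply/lee_addgt0Pr => eps eps0.
rewrite -leeBlDr// limn_einf_lim; apply: lime_ge; first exact: is_cvg_einfs.
have [N hN] : exists N : nat, forall m, (N <= m)%N -> K * m.+2%:R^-1 <= eps.
  have := archi_boundP (divr_ge0 K0 (ltW eps0)); set N := Num.bound _ => hN.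
  exists N => m Nm; rewrite ler_pdivrMr ?ltr0n// mulrC -ler_pdivrMr//.
  apply: le_trans (ltW hN) _; rewrite ler_nat (leq_trans Nm)//.
  exact: (leq_trans (leqnSn _) (leqnSn _)).
exists N => // n /= Nn; apply: le_ereal_inf_tmp => _ [m /= nm <-].
apply: le_trans (GK m); rewrite -EFinB lee_fin lerD2l lerN2.
exact: hN (leq_trans Nn nm).
Qed.

End inner_functions.

(** * Composition with inner functions, and Toeplitz kernels in terms of [H2] *)

Section composition_and_toeplitz_kernels.
Context {R : realType}.
Local Notation circ := (@circle_measure R).
Implicit Types f g psi : R[i] -> R[i].

Lemma Linf_comp g psi : Linf g -> inner psi -> nonconstant psi ->
  Linf (fun z => g (psi z)).
Proof.
move=> [mg [M gM]] ip nc; have [C dC] := inner_dominated ip nc.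
split; first by apply: measurableT_comp => //; case: dC.
by exists M; exact: dominated_ae dC gM.
Qed.

(** By [H2_dual] with [v = psi] it is enough that the powers of [psi] have no coefficient of
    negative index, and these powers lie in [H2]. *)
Lemma H2_comp f psi : H2 f -> inner psi -> nonconstant psi -> H2 (fun z => f (psi z)).
Proof.
move=> hf ip nc; have [C dC] := inner_dominated ip nc; have [h2 hinf] := inner_H2 ip.
have [fv _] := dominated_cL2 dC (H2_cL2 hf).
apply: H2_of_fourier => // n.
have orth j : Cint circ (fun z => z ^+ n.+1 * psi z ^+ j) = 0.
  have [hj _] := H2X j h2 hinf; rewrite -(H2_fourier0 n hj).
  by congr (Cint circ _); apply/funext => z; rewrite mulrC.
rewrite -[RHS](H2_dual hf dC ip.2 (cL2_X n.+1) orth).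
by congr (Cint circ _); apply/funext => z; rewrite mulrC.
Qed.

Lemma ae_conj_unimodular I : (\forall z \ae circ, normc (I z) = 1 :> R) ->
  \forall z \ae circ, I z * conjc (I z) = 1.
Proof. by apply: filterS => z z1; rewrite mulc_conj z1 expr1n. Qed.

Lemma cL2_L2 f : cL2 circ f -> L2 f.
Proof. by move=> [mf i]; split=> //; rewrite -(EFin_rint i) ltry. Qed.

(** The equation [T_g f = 0] says that [g f] has no coefficient of index [n >= 0]. Its conjugate
    then has none of index [n <= 0], and multiplication by [conjc z] turns the forbidden indices
    into [n < 0]. *)
Lemma toeplitz_kerP g f : Linf g ->
  toeplitz_ker g f <-> H2 f /\ H2 (fun z => conjc (z * (g z * f z))).
Proof.
move=> hg.
have shift : H2 f -> forall n, Cint circ (fun z => conjc (z * (g z * f z)) * z ^+ n.+1) =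
    Cint circ (fun z => conjc (g z * f z) * z ^+ n).
  move=> hf n; have mu : measurable_fun setT (fun z => conjc (g z * f z)).
    by apply: measurable_cconj; apply: measurable_cM; [exact: hg.1|exact: H2_meas].
  have mz : measurable_fun [set: R[i]] (fun z : R[i] => z) by exact: measurable_id.
  apply: Cint_ae.
  - apply: measurable_cM; last exact: measurable_Xn.
    by apply: measurable_cconj; apply: measurable_cM => //; apply: measurable_cM;
      [exact: hg.1|exact: H2_meas].
  - by apply: measurable_cM => //; exact: measurable_Xn.
  - apply: filterS (ae_conj_unimodular (I := id) ae_normc_circle) => z z1 _.
    rewrite conjcM exprS -[RHS]mul1r -z1; ring.
have gf2 : H2 f -> cL2 circ (fun z => g z * f z).
  move=> hf; have := cL2_Linf (H2_cL2 hf) hg; congr cL2.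
  by apply/funext => z; rewrite mulrC.
have H0 : H2 (cst 0 : R[i] -> R[i]) by exact: H2_cst.
split=> -[hf].
- case=> _ _ orth; split; first exact: hf.
  apply: H2_of_fourier.
    apply: cL2_conj; have := cL2_Xn 1 (gf2 hf); congr cL2.
    by apply/funext => z; rewrite expr1 mulrC.
  move=> n; rewrite shift//; have := orth _ (H2_X n).
  move=> /(congr1 conjc); rewrite -[inner_product _ _]/(Cint circ _).
  rewrite -Cint_conj; last first.
    under eq_fun do rewrite subr0.
    by apply: cL2_cL1M; [exact: gf2|apply: cL2_conj; exact: cL2_X].
  rewrite conjc0 => <-; congr (Cint circ _); apply/funext => z.
  by rewrite subr0 [RHS]conjcM conjcK.
- move=> hF; split; first exact: hf.
  split; [exact: cL2_L2 (gf2 hf)|exact: H0|].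
  move=> h hh; rewrite -[inner_product _ _]/(Cint circ _).
  apply: (can_inj (@conjcK R)); rewrite conjc0 -Cint_conj; last first.
    under eq_fun do rewrite subr0.
    by apply: cL2_cL1M; [exact: gf2|apply: cL2_conj; exact: H2_cL2].
  rewrite -[RHS](H2_orth hh (cL2_conj (gf2 hf)) _).
    by congr (Cint circ _); apply/funext => z; rewrite subr0 [LHS]conjcM conjcK.
  by move=> j; rewrite -(shift hf); exact: H2_fourier0 hF.
Qed.

End composition_and_toeplitz_kernels.

(** * Cyclic vectors and maximal vectors *)

Section cyclic_vectors.
Context {R : realType}.
Local Notation circ := (@circle_measure R).
Implicit Types g k p b I phi : R[i] -> R[i].

(** A squared modulus is real, so its coefficients of positive and of negative index vanish
    together. *)
Lemma sqr_normc_cst_mean phi : cL2 circ phi ->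
  (forall n, Cint circ (fun z => phi z * conjc (phi z) * z ^+ n.+1) = 0) ->
  \forall z \ae circ, normc (phi z) ^+ 2 = n2 circ phi.
Proof.
move=> hphi h0; have i1 : cL1 circ (fun z => phi z * conjc (phi z)).
  by apply: cL2_cL1M => //; exact: cL2_conj.
have hc n : Cint circ (fun z => phi z * conjc (phi z) * conjc z ^+ n.+1) = 0.
  have := congr1 conjc (h0 n); rewrite conjc0 -Cint_conj; last exact: cL1_Xn.
  move=> <-; congr (Cint circ _); apply/funext => z.
  by rewrite !conjcM conjcK conjcX [conjc (phi z) * _]mulrC.
have := fourier_cst i1 h0 hc; apply: filterS => z /(_ I).
rewrite mulc_conj => /(congr1 (@complex.Re R)) /= ->.
rewrite /n2; congr Rintegral; apply/funext => w.
by rewrite mulc_conj.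
Qed.

(** [phi] is the projection of 1, so [1 - phi] is orthogonal to every [p z * z ^+ n] and, in the
    limit, to every [phi z * z ^+ n]. Hence [phi z * conjc (phi z)] and [p z * conjc (phi z)] have
    the same integrals against [z ^+ n] as [phi] and [p]: the former is constant, the latter lies in
    [H2]. *)
Lemma beurling_projection p : H2 p -> Cint circ p <> 0 ->
  exists phi (c : R) (b_ : nat -> R[i] -> R[i]),
  [/\ H2 phi, 0 < c /\ (\forall z \ae circ, normc (phi z) ^+ 2 = c),
    forall n, H2 (b_ n) /\ Linf (b_ n),
    n2 circ (fun z => b_ n z * p z - phi z) @[n --> \oo] --> 0 &
    H2 (fun z => p z * conjc (phi z))].
Proof.
move=> hp p0; have p2 := H2_cL2 hp.
pose S := [set s | exists b, [/\ H2 b, Linf b & s = fun z => b z * p z]].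
have SX s n : S s -> S (fun z => s z * z ^+ n).
  move=> [b [hb1 hb2 ->]]; exists (fun z => b z * z ^+ n); split.
  - exact: (H2M hb1 (H2_X n) (Linf_X n)).
  - exact: (LinfM hb2 (Linf_X n)).
  - by apply/funext => z; ring.
have Sp : S p.
  exists (fun=> 1); split; [exact: H2_cst|exact: Linf_cst|].
  by apply/funext => z; rewrite mul1r.
have SH s : S s -> H2 s.
  move=> [b [hb1 hb2 ->]]; have := H2M hp hb1 hb2; congr H2.
  by apply/funext => z; rewrite mulrC.
have one2 : cL2 circ (fun=> 1 : R[i]) by exact: H2_cL2 (H2_cst 1).
have S2 : S `<=` cL2 circ by move=> s /SH /H2_cL2.
have SD s t : S s -> S t -> S (fun z => s z + t z).
  move=> [b [hb1 hb2 ->]] [b' [hb1' hb2' ->]]; exists (fun z => b z + b' z); split.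
  - exact: (H2D hb1 hb1').
  - exact: (LinfD hb2 hb2').
  - by apply/funext => z; ring.
have SZ (c : R[i]) s : S s -> S (fun z => c * s z).
  move=> [b [hb1 hb2 ->]]; exists (fun z => c * b z); split.
  - exact: (H2Z c hb1).
  - exact: (LinfM (Linf_cst c) hb2).
  - by apply/funext => z; ring.
have [phi [s_ [phi2 Ss lim orth]]] := L2_projection (ex_intro _ p Sp) S2 one2 SD SZ.
have hphi : H2 phi by apply: (H2_cvg _ phi2 lim) => n; exact: SH.
pose r z := conjc (1 - phi z).
have r2 : cL2 circ r by apply: cL2_conj; exact: cL2B.
have orth' s n : S s -> Cint circ (fun z => s z * (r z * z ^+ n)) = 0.
  move=> Ssn; have := orth _ (SX _ n Ssn) => /(congr1 conjc).
  rewrite conjc0 -Cint_conj; last first.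
    by apply: cL2_cL1M; [exact: cL2B|apply: cL2_conj; exact: S2 (SX _ _ Ssn)].
  move=> <-; congr (Cint circ _); apply/funext => z.
  by rewrite [in RHS]conjcM conjcK /r; ring.
have phiorth n : Cint circ (fun z => phi z * (r z * z ^+ n)) = 0.
  have rn := cL2_Xn n r2.
  have h := n2_cvg_Cint (fun m => S2 _ (Ss m)) phi2 rn lim.
  apply: cvgc_unique h _.
  rewrite (_ : (fun m => _) = (fun=> 0)); first exact: cvg_cst.
  by apply/funext => m; exact: orth'.
have sqr n : Cint circ (fun z => phi z * z ^+ n) =
    Cint circ (fun z => phi z * conjc (phi z) * z ^+ n).
  apply/eqP; rewrite -subr_eq0 -CintB; first last.
  - by apply: cL1_Xn; apply: cL2_cL1M => //; exact: cL2_conj.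
  - by apply: cL1_Xn; exact: cL2_cL1.
  rewrite -[X in _ == X](phiorth n); apply/eqP; congr (Cint circ _); apply/funext => z.
  by rewrite /r conjcB conjc1; ring.
have phic : \forall z \ae circ, normc (phi z) ^+ 2 = n2 circ phi.
  by apply: sqr_normc_cst_mean => // n; rewrite -sqr; exact: H2_fourier0.
have hpphi n : Cint circ (fun z => p z * conjc (phi z) * z ^+ n) =
    Cint circ (fun z => p z * z ^+ n).
  apply/eqP; rewrite eq_sym -subr_eq0 -CintB; first last.
  - by apply: cL1_Xn; apply: cL2_cL1M => //; exact: cL2_conj.
  - by apply: cL1_Xn; exact: cL2_cL1.
  rewrite -[X in _ == X](orth' _ n Sp); apply/eqP; congr (Cint circ _); apply/funext => z.
  by rewrite /r conjcB conjc1; ring.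
have phib : Linf phi.
  split; first exact: H2_meas.
  exists (Num.sqrt (n2 circ phi)); apply: filterS phic => z <-.
  by rewrite sqrtr_sqr ger0_norm ?normc_ge0.
have [b_ hb] := choice Ss.
exists phi, (n2 circ phi), b_; split; first exact: hphi.
- split; last exact: phic.
  (* If [phi] vanished, so would the mean of [p], which is also that of [p z * conjc (phi z)]. *)
  rewrite lt_neqAle n2_ge0 andbT eq_sym; apply/eqP => c0; apply: p0.
  have -> : Cint circ p = Cint circ (fun z => p z * z ^+ 0).
    by congr (Cint circ _); apply/funext => z; rewrite expr0 mulr1.
  rewrite -hpphi -[RHS](Cint_cst circ); apply: Cint_ae.
  + by apply: measurable_cM; [apply: measurable_cM; [exact: H2_meas|
      apply: measurable_cconj; exact: H2_meas]|exact: measurable_Xn].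
  + exact: measurable_cst.
  + apply: filterS phic => z; rewrite c0 => /eqP; rewrite sqrf_eq0 normc_eq0 => /eqP -> _.
    by rewrite conjc0 mulr0 mul0r.
- by move=> n; have [h1 h2 _] := hb n.
- rewrite (_ : (fun n => _) = (fun n => n2 circ (fun z => s_ n z - phi z))) //.
  by apply/funext => n; have [_ _ ->] := hb n.
- apply: H2_of_fourier; first exact: (cL2_Linf p2 (Linf_conj phib)).
  by move=> n; rewrite hpphi; exact: H2_fourier0.
Qed.

Lemma H2_eq_cst f : H2 f -> (forall n, Cint circ (fun z => f z * conjc z ^+ n.+1) = 0) ->
  f = cst (Cint circ f) %[ae circ].
Proof.
move=> hf h; apply: fourier_cst => //; first exact: cL2_cL1 (H2_cL2 hf).
by move=> n; exact: H2_fourier0.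
Qed.

Lemma H2_divX f m : H2 f -> (forall j, (j < m)%N -> Cint circ (fun z => f z * conjc z ^+ j) = 0) ->
  H2 (fun z => f z * conjc z ^+ m).
Proof.
move=> hf f0; have f2 := H2_cL2 hf.
have mX j : measurable_fun [set: R[i]] (fun z : R[i] => conjc z ^+ j).
  by apply: measurable_cX; apply: measurable_cconj; exact: measurable_id.
apply: H2_of_fourier.
  have lX : Linf (fun z : R[i] => conjc z ^+ m).
    split=> //; exists 1; apply: filterS ae_normc_circle => z z1.
    by rewrite normcX normc_conj z1 expr1n.
  exact: cL2_Linf f2 lX.
move=> n; have mf := H2_meas hf.
have zz : \forall z \ae circ, z * conjc z = 1 := ae_conj_unimodular (I := id) ae_normc_circle.
(* For [n < m] the integral is one of the coefficients assumed to vanish, that of index [m - n.+1];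
   otherwise it is a coefficient of negative index of [f]. *)
have [mn|nm] := ltnP n m.
  rewrite -(f0 (m - n.+1)%N) ?ltn_subrL ?(leq_ltn_trans _ mn)//.
  apply: Cint_ae.
  - by do ?apply: measurable_cM => //; exact: measurable_Xn.
  - by apply: measurable_cM.
  - apply: filterS zz => z z1 _; rewrite -{1}(subnK mn) exprD -!mulrA -exprMn mulrC.
    by rewrite [conjc z * z]mulrC z1 expr1n mulr1 mulrC.
rewrite -(H2_fourier0 (n - m)%N hf); apply: Cint_ae.
- by do ?apply: measurable_cM => //; exact: measurable_Xn.
- by apply: measurable_cM => //; exact: measurable_Xn.
- apply: filterS zz => z z1 _; rewrite -subSn// -{1}(subnKC (leqW nm)) exprD !mulrA.
  by rewrite -[X in X * _]mulrA -exprMn [conjc z * z]mulrC z1 expr1n mulr1.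
Qed.

(** After division by its leading power of [z], [k] has nonzero mean, and bounded multiples of the
    quotient tend to some [phi] of constant positive modulus. Each of these multiples is annihilated
    by [g], hence so is [phi]. *)
Lemma H2_zero_divisor g k : Linf g -> H2 k -> ~ (k = cst 0 %[ae circ]) ->
  (\forall z \ae circ, g z * k z = 0) -> g = cst 0 %[ae circ].
Proof.
move=> hg hk k0 gk0.
have [m hm hmin] : exists2 m, Cint circ (fun z => k z * conjc z ^+ m) != 0 &
    forall j, (j < m)%N -> Cint circ (fun z => k z * conjc z ^+ j) = 0.
  have [ex|nex] := pselect (exists m, Cint circ (fun z => k z * conjc z ^+ m) != 0).
    case: (ex_minnP ex) => m hm hmin; exists m => // j jm; apply/eqP/negPn/negP => /hmin.
    by rewrite leqNgt jm.
  exfalso; have z0 m : Cint circ (fun z => k z * conjc z ^+ m) = 0.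
    by apply/eqP/negPn/negP => h; apply: nex; exists m.
  apply: k0; have := H2_eq_cst hk (fun n => z0 n.+1).
  rewrite (_ : Cint circ k = 0) //; rewrite -[RHS](z0 0%N).
  by congr (Cint circ _); apply/funext => z; rewrite expr0 mulr1.
have hp := H2_divX hk hmin; move/eqP in hm.
have [phi [c [b_ [hphi [c0 phic] hb lim _]]]] := beurling_projection hp hm.
have [mg [M gM]] := hg; have phi2 := H2_cL2 hphi.
have s2 n : cL2 circ (fun z => b_ n z * (k z * conjc z ^+ m) - phi z).
  apply: cL2B => //; have := cL2_Linf (H2_cL2 hp) (hb n).2; congr cL2.
  by apply/funext => z; rewrite mulrC.
have gphi2 : cL2 circ (fun z => - phi z * g z) by exact: cL2_Linf (cL2N phi2) hg.
have gphi n : n2 circ (fun z => - phi z * g z) <=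
    M ^+ 2 * n2 circ (fun z => b_ n z * (k z * conjc z ^+ m) - phi z).
  have [h1 h2] := cL2M (s2 n) mg gM; apply: le_trans h2; rewrite le_eqVlt; apply/orP; left.
  apply/eqP; apply: n2_ae; [exact: gphi2.1|exact: h1.1|].
  apply: filterS gk0 => z gz _; rewrite mulrBl mulNr -!mulrA.
  by rewrite (_ : k z * (conjc z ^+ m * g z) = 0) ?mulr0 ?sub0r// mulrCA [k z * _]mulrC gz mulr0.
have gphi0 : n2 circ (fun z => - phi z * g z) = 0.
  apply/eqP; rewrite eq_le n2_ge0 andbT.
  have limM : M ^+ 2 * n2 circ (fun z => b_ n z * (k z * conjc z ^+ m) - phi z) @[n --> \oo] --> M ^+ 2 * 0.
    by apply: cvgM => //; exact: cvg_cst.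
  rewrite mulr0 in limM; rewrite -(cvg_lim (@Rhausdorff R) limM).
  apply: limr_ge; first by apply/cvg_ex; exists 0.
  by apply: nearW.
have := n2_eq0 gphi2 gphi0; apply: filterS2 phic => z phiz /(_ I) /eqP.
rewrite mulf_eq0 oppr_eq0 => /orP[/eqP h|/eqP -> //].
by move: c0; rewrite -phiz h normc0 expr0n ltxx.
Qed.

Lemma maximal_vector_shift g k I : Linf g -> maximal_vector k g -> H2 I ->
  (\forall z \ae circ, normc (I z) = 1) ->
  H2 (fun z => conjc (I z) * conjc (z * (g z * k z))) ->
  forall n, H2 (fun z => conjc (I z) ^+ n * conjc (z * (g z * k z))).
Proof.
move=> hg [hk k0 [f [hf fE kf fmin]]] hI I1 hq.
have lI : Linf I by split; [exact: H2_meas|exists 1; exact: ae_le_of_eq].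
have lIg : Linf (fun z => I z * g z) by exact: LinfM.
have sub : toeplitz_ker g `<=` toeplitz_ker (fun z => I z * g z).
  rewrite fE; apply: (fmin _ lIg); apply/(toeplitz_kerP _ lIg); split; first exact: hk.
  move: hq; congr H2; apply/funext => z; rewrite -conjcM; congr conjc; ring.
have hIn n : H2 (fun z => I z ^+ n) by case: (H2X n hI lI).
have lIn n : Linf (fun z => I z ^+ n) by case: (H2X n hI lI).
have kn n : toeplitz_ker g (fun z => k z * I z ^+ n).
  (* By minimality [k z * I z ^+ n] also lies in the kernel of symbol [I z * g z]; moving the factor
     [I z] from the symbol to the vector gives the next power. *)
  elim: n => [|n /sub /(toeplitz_kerP _ lIg) [h1 h2]].
    rewrite fE; move: kf; congr toeplitz_ker; apply/funext => z.
    by rewrite expr0 mulr1.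
  apply/(toeplitz_kerP _ hg); split; first exact: (H2M hk (hIn _) (lIn _)).
  move: h2; congr H2; apply/funext => z; congr conjc; rewrite exprS; ring.
move=> n; have /(toeplitz_kerP _ hg) [_] := kn n; congr H2; apply/funext => z.
by rewrite -conjcX -conjcM; congr conjc; ring.
Qed.

Lemma maximal_vector_cyclic g k : Linf g -> ~ (g = cst 0 %[ae circ]) ->
  maximal_vector k g -> exists b_ : nat -> R[i] -> R[i],
  (forall n, H2 (b_ n) /\ Linf (b_ n)) /\
  n2 circ (fun z => b_ n z * conjc (z * (g z * k z)) - 1) @[n --> \oo] --> 0.
Proof.
move=> hg g0 kmax; have [hk k0 [f [hf fE kf fmin]]] := kmax.
pose p z := conjc (z * (g z * k z)).
have hp : H2 p by move: kf; rewrite -fE => /(toeplitz_kerP _ hg) [].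
have pn0 : ~ (p = cst 0 %[ae circ]).
  move=> p0; apply: g0; apply: (H2_zero_divisor hg hk k0).
  apply: filterS2 p0 ae_normc_circle => z /(_ I) /eqP; rewrite /p /= conjc_eq0.
  rewrite mulf_eq0 => /orP[/eqP -> |/eqP //]; rewrite normc0 => /eqP.
  by rewrite eq_sym oner_eq0.
(* With mean 0, [p] is divisible by [z], which serves as the inner factor; divisibility by all
   powers of [z] then kills every coefficient of [p]. *)
have [p0|p0] := eqVneq (Cint circ p) 0.
  exfalso; apply: pn0.
  have h1 : H2 (fun z => conjc z * p z).
    have := @H2_divX p 1 hp; rewrite (_ : (fun z => _) = (fun z => conjc z * p z)).
      apply=> -[|//] _; rewrite -[RHS]p0; congr (Cint circ _); apply/funext => z.
      by rewrite expr0 mulr1.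
    by apply/funext => z; rewrite expr1 mulrC.
  have hz : H2 (fun z : R[i] => z) by exact: (H2_X 1).
  have hn := maximal_vector_shift hg kmax hz ae_normc_circle h1.
  rewrite -p0; apply: (H2_eq_cst hp) => n.
  have := H2_fourier0 0 (hn n.+2) => <-; apply: Cint_ae.
  - apply: measurable_cM; first exact: H2_meas.
    by apply: measurable_cX; apply: measurable_cconj; exact: measurable_id.
  - by apply: measurable_cM; [exact: H2_meas (hn _)|exact: measurable_Xn].
  - apply: filterS (ae_conj_unimodular (I := id) ae_normc_circle) => z z1 _.
    by rewrite -/(p z) expr1 (exprS _ n.+1) mulrC -[LHS]mul1r -z1; ring.
move/eqP in p0; have [phi [c [b_ [hphi [c0 phic] hb lim hpphi]]]] := beurling_projection hp p0.
(* [phi] has constant modulus [Num.sqrt c]. Once normalized it is unimodular, and dividing [p] by it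
   stays in [H2] because [p z * conjc (phi z)] does. *)
pose I z := ((Num.sqrt c)^-1)%:C * phi z.
have hI : H2 I by exact: H2Z.
have sc0 : 0 < Num.sqrt c by rewrite sqrtr_gt0.
have I1 : \forall z \ae circ, normc (I z) = 1.
  apply: filterS phic => z phiz; rewrite normcM normc_real.
  have -> : normc (phi z) = Num.sqrt c by rewrite -phiz sqrtr_sqr ger0_norm ?normc_ge0.
  by rewrite ger0_norm ?invr_ge0 ?sqrtr_ge0// mulVf// gt_eqF.
have hq : H2 (fun z => conjc (I z) * p z).
  have := H2Z ((Num.sqrt c)^-1)%:C hpphi; congr H2; apply/funext => z.
  by rewrite conjcM conjc_real; ring.
have hn := maximal_vector_shift hg kmax hI I1 hq.
(* If [I] is constant, so is the projection of 1, and the [b_ n] give cyclicity up to that constant.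
   If not, its mean has modulus less than 1, and infinite divisibility forces the mean of [p] to be
   0. *)
have [[a Ia]|nc] := pselect (exists a, I = cst a %[ae circ]); last first.
  exfalso; apply: p0.
  have lI : Linf I by split; [exact: H2_meas|exists 1; exact: ae_le_of_eq].
  have lt1 := unimodular_mean_lt1 hI I1 nc.
  (* The mean of [p] is the product of the means of [I z ^+ n] and of the quotient; the quotient has
     the same modulus as [p], so its mean is bounded independently of [n]. *)
  have bound n : normc (Cint circ p) <= 2 * n1 circ p * normc (Cint circ I) ^+ n.
    have [hIn lIn] := H2X n hI lI.
    have pE : Cint circ p = Cint circ I ^+ n * Cint circ (fun z => conjc (I z) ^+ n * p z).
      rewrite -(Cint_H2X n hI lI) -(Cint_H2M hIn (hn n)); apply: Cint_ae.
      - exact: H2_meas.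
      - by apply: measurable_cM; [exact: H2_meas hIn|exact: H2_meas (hn n)].
      - apply: filterS (ae_conj_unimodular I1) => z z1 _.
        by rewrite mulrA -exprMn z1 expr1n mul1r.
    rewrite pE normcM normcX mulrC ler_wpM2r ?exprn_ge0 ?normc_ge0//.
    apply: le_trans (normc_Cint (cL2_cL1 (H2_cL2 (hn n)))) _.
    rewrite ler_wpM2l// le_eqVlt; apply/orP; left; apply/eqP; apply: Rint_ae.
    - exact: measurable_normc (H2_meas (hn n)).
    - exact: measurable_normc (H2_meas hp).
    - by apply: filterS I1 => z z1; rewrite normcM normcX normc_conj z1 expr1n mul1r.
  apply/eqP; rewrite -normc_eq0 eq_le normc_ge0 andbT.
  have limM : 2 * n1 circ p * normc (Cint circ I) ^+ n @[n --> \oo] --> 2 * n1 circ p * 0.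
    apply: cvgM; first exact: cvg_cst.
    by apply: cvg_expr; rewrite ger0_norm ?normc_ge0.
  rewrite mulr0 in limM; rewrite -(cvg_lim (@Rhausdorff R) limM).
  apply: limr_ge; first by apply/cvg_ex; exists 0.
  by apply: nearW.
pose a' := (Num.sqrt c)%:C * a.
have phia : \forall z \ae circ, phi z = a'.
  apply: filterS Ia => z /(_ Logic.I) /=; rewrite /a' => <-; rewrite /I mulrA -realcM divff ?mul1r//.
  by rewrite gt_eqF.
have a0 : a' != 0.
  apply/eqP => a'0; move: c0; rewrite -(Rint_cst circ c).
  rewrite (@Rint_ae _ _ _ circ _ (fun=> 0)); first by rewrite Rint_cst ltxx.
  - exact: measurable_cst.
  - exact: measurable_cst.
  - by apply: filterS2 phia phic => z -> <-; rewrite a'0 normc0 expr0n.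
exists (fun n z => a'^-1 * b_ n z); split.
  move=> n; have [h1 h2] := hb n; split; first exact: H2Z.
  by apply: (LinfM _ h2); exact: Linf_cst.
have s2 n : cL2 circ (fun z => b_ n z * p z - phi z).
  apply: cL2B; last exact: H2_cL2.
  have := cL2_Linf (H2_cL2 hp) (hb n).2; congr cL2.
  by apply/funext => z; rewrite mulrC.
rewrite (_ : (fun n => _) = (fun n => normc a'^-1 ^+ 2 * n2 circ (fun z => b_ n z * p z - phi z))).
  by rewrite -[X in _ --> X](mulr0 (normc a'^-1 ^+ 2)); apply: cvgM => //; exact: cvg_cst.
apply/funext => n; have [h1 <-] := cL2Z a'^-1 (s2 n); apply: n2_ae.
- apply: measurable_cB; last exact: measurable_cst.
  apply: measurable_cM; last exact: H2_meas hp.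
  by apply: measurable_cM; [exact: measurable_cst|exact: H2_meas (hb n).1].
- exact: h1.1.
- by apply: filterS phia => z -> _; rewrite -/(p z) mulrBr mulVf// mulrA.
Qed.

End cyclic_vectors.

(** * From cyclicity to minimal kernels, and multiplication by invertible functions *)

Section maximal_vectors_under_composition.
Context {R : realType}.
Local Notation circ := (@circle_measure R).
Implicit Types f g k : R[i] -> R[i].

Lemma cyclic_is_Kmin g k (b_ : nat -> R[i] -> R[i]) : Linf g -> toeplitz_ker g k ->
  (forall n, H2 (b_ n) /\ Linf (b_ n)) ->
  n2 circ (fun z => b_ n z * conjc (z * (g z * k z)) - 1) @[n --> \oo] --> 0 ->
  is_Kmin k (toeplitz_ker g).
Proof.
move=> hg kg hb lim; exists g; split; [exact: hg|by []|exact: kg|].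
move=> h hh /(toeplitz_kerP _ hh) [_ hr] f /(toeplitz_kerP _ hg) [hf hs].
move/(toeplitz_kerP _ hg) : kg => [hk hp].
apply/(toeplitz_kerP _ hh); split; first exact: hf.
pose v z := conjc (z * (h z * f z)).
have v2 : cL2 circ v.
  apply: cL2_conj; have := cL2_Xn 1 (cL2_Linf (H2_cL2 hf) hh); congr cL2.
  by apply/funext => z; rewrite expr1; ring.
apply: H2_of_fourier => // n.
have bp2 m : cL2 circ (fun z => b_ m z * conjc (z * (g z * k z))).
  have := cL2_Linf (H2_cL2 hp) (hb m).2; congr cL2.
  by apply/funext => z; rewrite mulrC.
have one2 : cL2 circ (fun=> 1 : R[i]) by exact: H2_cL2 (H2_cst 1).
have cv := n2_cvg_Cint bp2 one2 (cL2_Xn n.+1 v2) lim.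
transitivity (Cint circ (fun z => 1 * (v z * z ^+ n.+1))).
  by congr (Cint circ _); apply/funext => z; rewrite mul1r.
apply: cvgc_unique cv _.
rewrite (_ : (fun m => _) = (fun=> 0)); first exact: cvg_cst.
(* Exchanging [f] and [k] between the two conjugated products exhibits a product of two functions of
   [H2], one of them multiplied by the bounded [b_ m]. *)
apply/funext => m; rewrite -(H2M_fourier0 n (H2M hs (hb m).1 (hb m).2) hr).
congr (Cint circ _); apply/funext => z; rewrite /v.
transitivity (conjc ((z * (g z * k z)) * (z * (h z * f z))) * (b_ m z * z ^+ n.+1)).
  by rewrite [in RHS]conjcM; ring.
transitivity (conjc ((z * (g z * f z)) * (z * (h z * k z))) * (b_ m z * z ^+ n.+1)).
  by congr (conjc _ * _); ring.
by rewrite [in LHS]conjcM; ring.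
Qed.

Lemma H2_Hinf_ae f u v : measurable_fun [set: R[i]] f -> H2 u -> Hinf v ->
  (\forall z \ae circ, f z = u z * v z) -> H2 f.
Proof.
move=> mf hu /Hinf_H2 [v2 vb] fE; apply: (H2_ae mf _ (H2M hu v2 vb)).
by apply: filterS fE => z ->.
Qed.

(** In the form of [toeplitz_kerP], [hp] acts on the vector and the conjugate of [hm] on the
    conjugated product. Both are bounded and in [H2], and so are their inverses, so membership
    passes in both directions. *)
Lemma toeplitz_ker_mul g hp hpi hm hmi : Linf g ->
  Hinf hp -> Hinf hpi -> (\forall z \ae circ, hp z * hpi z = 1) ->
  conj_Hinf hm -> conj_Hinf hmi -> (\forall z \ae circ, hm z * hmi z = 1) ->
  Linf (fun z => hm z * g z * hp z) ->
  toeplitz_ker (fun z => hm z * g z * hp z) = mul_set (fun z => (hp z)^-1) (toeplitz_ker g).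
Proof.
move=> hg php phpi hpE phm phmi hmE lG; have mg := hg.1.
have [hp2 lhp] := Hinf_H2 php.
have mz : measurable_fun [set: R[i]] (fun z : R[i] => z) by exact: measurable_id.
apply/seteqP; split=> f.
- move=> /(toeplitz_kerP _ lG) [hf hs]; split; first exact: H2_meas.
  exists (fun z => f z * hp z).
    apply/(toeplitz_kerP _ hg); split; first exact: H2M hf hp2 lhp.
    apply: (H2_Hinf_ae _ hs phmi).
      apply: measurable_cconj; apply: measurable_cM => //; apply: measurable_cM => //.
      by apply: measurable_cM; [exact: H2_meas hf|exact: H2_meas hp2].
    apply: filterS hmE => z hz; rewrite -conjcM; congr conjc.
    by rewrite -[LHS]mul1r -hz; ring.
  apply: filterS hpE => z hz _; rewrite mulrCA mulVf ?mulr1//.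
  by apply/eqP => hz0; move: hz; rewrite hz0 mul0r => /eqP; rewrite eq_sym oner_eq0.
- move=> [mf [v /(toeplitz_kerP _ hg) [hv hs] fE]].
  have fE' : \forall z \ae circ, f z = v z * hpi z.
    apply: filterS2 fE hpE => z /(_ I) -> hz; rewrite mulrC; congr (_ * _).
    have h0 : hp z != 0.
      by apply/eqP => hz0; move: hz; rewrite hz0 mul0r => /eqP; rewrite eq_sym oner_eq0.
    by apply: (mulfI h0); rewrite hz mulfV.
  apply/(toeplitz_kerP _ lG); split; first exact: H2_Hinf_ae mf hv phpi fE'.
  apply: (H2_Hinf_ae _ hs phm).
    by apply: measurable_cconj; apply: measurable_cM => //; apply: measurable_cM => //; exact: lG.1.
  apply: filterS2 fE' hpE => z -> hz; rewrite -conjcM; congr conjc.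
  by rewrite -[RHS]mulr1 -hz; ring.
Qed.

End maximal_vectors_under_composition.

(** * Cyclicity and maximality of the composed vector *)

Theorem proposition4p3 (R : realType) (g k : R[i] -> R[i])
  (hg : Linf g) (hg0 : ~ (g = cst 0 %[ae circle_measure]))
  (hk : maximal_vector k g)
  (psi : R[i] -> R[i]) (hpsi : inner psi) (hpsi_nc : nonconstant psi)
  (hp : R[i] -> R[i]) (hhp : invertible_in Hinf hp)
  (hm : R[i] -> R[i]) (hhm : invertible_in conj_Hinf hm) :
  let k' := fun z => (hp z)^-1 * k (psi z) * psi z in
  let G := fun z => conjc z * hm z * g (psi z) * hp z in
  let K := mul_set (fun z => (hp z)^-1)
             (toeplitz_ker (fun z => conjc z * g (psi z))) in
  [/\ maximal_vector k' G, toeplitz_ker G = K,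
      is_Kmin k' (toeplitz_ker G) & is_Kmin k' K].
Proof.
move=> k' G K; pose circ := @circle_measure R.
have [b_ [hb lim]] := maximal_vector_cyclic hg hg0 hk.
have [kH2 k0 [f0 [_ fE kf _]]] := hk.
have pH2 : H2 (fun z => conjc (z * (g z * k z))).
  by move: kf; rewrite -fE => /(toeplitz_kerP _ hg) [].
have [php [hpi phpi hpE]] := hhp.
have [phm [hmi phmi hmE]] := hhm.
have hpE' : \forall z \ae circ, hp z * hpi z = 1 by apply: filterS hpE => z; exact.
have hmE' : \forall z \ae circ, hm z * hmi z = 1 by apply: filterS hmE => z; exact.
have [hp2 lhp] := Hinf_H2 php.
have [psi2 lpsi] := inner_H2 hpsi; have psi1 := hpsi.2.
have [C dC] := inner_dominated hpsi hpsi_nc.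
have gpsi := Linf_comp hg hpsi hpsi_nc.
have kpsi := H2_comp kH2 hpsi hpsi_nc.
have ppsi := H2_comp pH2 hpsi hpsi_nc.
have lz : Linf (fun z : R[i] => conjc z) by exact: (Linf_conj (Linf_X 1)).
have lzg : Linf (fun z => conjc z * g (psi z)) by exact: LinfM lz gpsi.
have lhm : Linf hm.
  by have := Linf_conj (Hinf_H2 phm).2; congr Linf; apply/funext => z; rewrite conjcK.
have GE : G = fun z => hm z * (conjc z * g (psi z)) * hp z.
  by apply/funext => z; rewrite /G; ring.
have lG : Linf G by rewrite GE; exact: LinfM (LinfM lhm lzg) lhp.
(* [(hp z)^-1] is the pointwise inverse; it agrees with the inverse of [hp] in [Hinf] only almost
   everywhere. *)
have hpV : \forall z \ae circ, (hp z)^-1 = hpi z /\ hp z != 0.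
  apply: filterS hpE' => z hz; have h0 : hp z != 0.
    by apply/eqP => hz0; move: hz; rewrite hz0 mul0r => /eqP; rewrite eq_sym oner_eq0.
  by split=> //; apply: (mulfI h0); rewrite hz mulfV.
have mk' : measurable_fun [set: R[i]] k'.
  exact: measurable_cM (measurable_cM (measurable_cV (H2_meas hp2)) (H2_meas kpsi))
    (H2_meas psi2).
have k'H2 : H2 k'.
  apply: (H2_Hinf_ae mk' (H2M kpsi psi2 lpsi) phpi).
  by apply: filterS hpV => z [e _]; rewrite /k' e; ring.
have zz : \forall z \ae circ, z * conjc z = 1.
  exact: (ae_conj_unimodular (I := id) (@ae_normc_circle R)).
pose P z := conjc (z * (G z * k' z)).
(* The factor [psi z] of [k'] plays the part of [z] in [p] composed with [psi]. The factors
   [conjc z] and [hp z] of [G] cancel against [z] and [(hp z)^-1], so only the conjugate of [hm] is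
   left over. *)
have PE : \forall z \ae circ,
    P z = conjc (psi z * (g (psi z) * k (psi z))) * conjc (hm z).
  apply: filterS2 zz hpV => z z1 [_ h0]; rewrite /P -conjcM; congr conjc.
  rewrite /G /k'; transitivity ((z * conjc z) * (hp z * (hp z)^-1) *
    (psi z * (g (psi z) * k (psi z)) * hm z)); first by ring.
  by rewrite z1 divff// !mul1r.
have mP : measurable_fun [set: R[i]] P.
  apply: measurable_cconj; apply: measurable_cM; first exact: measurable_id.
  by apply: measurable_cM => //; exact: lG.1.
have PH2 : H2 P by exact: H2_Hinf_ae mP ppsi phm PE.
have k'G : toeplitz_ker G k' by apply/(toeplitz_kerP _ lG).
have [w2 lw] := Hinf_H2 phmi.
(* The second factor undoes the conjugate of [hm] in [P], so that [c_ n z * P z] is almost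
   everywhere the product of [b_ n] and [p] at [psi z]. *)
pose c_ n z := b_ n (psi z) * conjc (hmi z).
have hc n : H2 (c_ n) /\ Linf (c_ n).
  have [h1 h2] := hb n; split.
    exact: H2M (H2_comp h1 hpsi hpsi_nc) w2 lw.
  exact: LinfM (Linf_comp h2 hpsi hpsi_nc) lw.
have b2 n : cL2 circ (fun z => b_ n z * conjc (z * (g z * k z)) - 1).
  apply: cL2B; last exact: H2_cL2 (H2_cst 1).
  have := cL2_Linf (H2_cL2 pH2) (hb n).2; congr cL2.
  by apply/funext => z; rewrite mulrC.
have mcP n : measurable_fun [set: R[i]] (fun z => c_ n z * P z - 1).
  apply: measurable_cB; last exact: measurable_cst.
  by apply: measurable_cM => //; exact: H2_meas (hc n).1.
have cE n : n2 circ (fun z => c_ n z * P z - 1) = n2 circ (fun z =>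
    b_ n (psi z) * conjc (psi z * (g (psi z) * k (psi z))) - 1).
  apply: n2_ae; [exact: mcP|exact: (dominated_cL2 dC (b2 n)).1.1|].
  apply: filterS2 PE hmE' => z -> /(congr1 conjc); rewrite conjcM conjc1 => hz _.
  rewrite /c_; congr (_ - _); rewrite -[RHS]mulr1 -hz; ring.
have climP : n2 circ (fun z => c_ n z * P z - 1) @[n --> \oo] --> 0.
  apply: (@squeeze_cvgr _ _ _ _ (fun=> 0)
    (fun n => C * n2 circ (fun z => b_ n z * conjc (z * (g z * k z)) - 1))).
  - by apply: nearW => n; rewrite n2_ge0 cE; exact: (dominated_cL2 dC (b2 n)).2.
  - exact: cvg_cst.
  - by rewrite -[X in _ --> X](mulr0 C); apply: cvgM => //; exact: cvg_cst.
have Kmin : is_Kmin k' (toeplitz_ker G) by exact: cyclic_is_Kmin lG k'G hc climP.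
have GK : toeplitz_ker G = K.
  rewrite /K GE; apply: toeplitz_ker_mul; [exact: lzg|exact: php|exact: phpi|exact: hpE'|
    exact: phm|exact: phmi|exact: hmE'|by rewrite -GE].
split; [split=> //|exact: GK|exact: Kmin|by rewrite -GK].
(* Were [k'] zero almost everywhere, [P] would be too, and [c_ n z * P z - 1] would have squared
   norm 1 for every [n]. *)
move=> k'0; have /(cvg_lim (@Rhausdorff R)) := climP.
rewrite (_ : (fun n => _) = (fun=> 1)).
  by rewrite (cvg_lim (@Rhausdorff R) (@cvg_cst _ _ _ _ _)) => /eqP; rewrite oner_eq0.
apply/funext => n; rewrite -[RHS](Rint_cst circ); apply: Rint_ae.
- exact: measurable_normc2.
- exact: measurable_cst.
- apply: filterS k'0 => z /(_ I) /= kz.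
  by rewrite /P kz !mulr0 conjc0 mulr0 sub0r normcNc normc1 expr1n.
Qed.
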